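(* Let $\Gamma$ and $\Lambda$ be countable icc groups such that $\mathrm{L}\Gamma = \mathrm{L}\Lambda$ (i.e. two group von Neumann algebra decompositions of the same II$_1$ factor, with trace $\tau$). Denote by $(u_g)_{g\in\Gamma}$ and $(v_s)_{s \in \Lambda}$ the respective canonical unitaries. Let $\mathbb{T}\Gamma = \{\lambda u_g \mid \lambda\in\mathbb{T}, g\in\Gamma\}$ and $\mathbb{T}\Lambda=\{\lambda v_s\mid \lambda\in\mathbb{T}, s\in\Lambda\}$, and denote by $$\operatorname{dist}_{\|\cdot\|_2}(\mathbb{T}\Gamma,\mathbb{T}\Lambda) = \sup_{u \in \mathbb{T}\Gamma}\Bigl(\inf_{v \in \mathbb{T}\Lambda}\|u-v\|_2\Bigr)$$ the (asymmetric) upper Hausdorff distance. Then the following two statements are equivalent. (1) $\operatorname{dist}_{\|\cdot\|_2}(\mathbb{T}\Gamma,\mathbb{T}\Lambda) < \sqrt{2}$. (2) There exist a unitary $w \in \mathrm{L}\Lambda$, a character $\gamma : \Gamma \to \mathbb{T}$ and an isomorphism of groups $\delta : \Gamma \to \Lambda$ such that $$w u_g w^* = \gamma(g)\, v_{\delta(g)} \quad\text{for all } g \in \Gamma .$$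
   Context: A group is icc if every conjugacy class other than that of the identity is infinite. $\mathrm{L}\Lambda$ is the group von Neumann algebra generated by the left regular representation, with canonical unitaries $v_s$ and canonical trace $\tau$; $\|x\|_2 = \tau(x^*x)^{1/2}$. A character is a group homomorphism to the circle group $\mathbb{T}$. *)

(* Defs.v *)
From HB Require Import structures.
From mathcomp Require Import all_boot all_order all_algebra.
From mathcomp Require Import all_classical all_reals all_analysis.
From mathcomp Require Import complex ring.

Set Implicit Arguments.
Unset Strict Implicit.
Unset Printing Implicit Defensive.

Import Order.TTheory GRing.Theory Num.Theory.

Local Open Scope classical_set_scope.
Local Open Scope ring_scope.
Local Open Scope complex_scope.

Definition icc (G : groupType) : Prop :=
  forall g : G, g <> 1%g -> infinite_set [set (g ^ h)%g | h in [set: G]].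

Section ell2.
Variables (R : realType) (G : choiceType).

Definition sqabs (z : R[i]) : R := complex.Re z ^+ 2 + complex.Im z ^+ 2.

Lemma sqabs_ge0 z : 0 <= sqabs z.
Proof. by rewrite addr_ge0 ?sqr_ge0. Qed.

Lemma sqabsM z w : sqabs (z * w) = sqabs z * sqabs w.
Proof. by case: z w => [a b] [c d]; rewrite /sqabs /=; ring. Qed.

Lemma sqabsD z w : sqabs (z + w) <= 2 * sqabs z + 2 * sqabs w.
Proof.
case: z w => [a b] [c d]; rewrite /sqabs /= -subr_ge0.
rewrite (_ : _ - _ = (a - c) ^+ 2 + (b - d) ^+ 2); last by ring.
by rewrite addr_ge0 ?sqr_ge0.
Qed.

Definition square_summable (f : G -> R[i]^o) : bool :=
  `[< (\esum_(g in [set: G]) (sqabs (f g))%:E < +oo)%E >].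

Lemma square_summableP f : reflect
  (\esum_(g in [set: G]) (sqabs (f g))%:E < +oo)%E (f \in square_summable).
Proof. exact: asboolP. Qed.

Lemma esum_sqabsZ (a : R[i]) (f : G -> R[i]^o) : f \in square_summable ->
  (\esum_(g in [set: G]) (sqabs (a * f g))%:E < +oo)%E.
Proof.
move=> /square_summableP; set s := esum _ _ => s_fin.
have s_fin' : s \is a fin_num.
  by rewrite ge0_fin_numE// esum_ge0// => g _; rewrite lee_fin sqabs_ge0.
apply: (@le_lt_trans _ _ ((sqabs a)%:E * s)%E); last first.
  by rewrite -(fineK s_fin') -EFinM ltry.
apply: ub_ereal_sup => _ [A [Afin _] <-].
under eq_fsbigr do rewrite sqabsM EFinM.
rewrite -ge0_mule_fsumr; last by move=> g; rewrite lee_fin sqabs_ge0.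
by rewrite lee_wpmul2l ?lee_fin ?sqabs_ge0//; apply: ereal_sup_ubound; exists A.
Qed.

Fact square_summable_submod : submod_closed square_summable.
Proof.
split=> [|a f h sf sh].
  apply/square_summableP; rewrite esum1 ?ltry// => g _.
  by rewrite /sqabs !expr0n/= addr0.
have s2 (k : G -> R[i]^o) : k \in square_summable ->
  (\esum_(g in [set: G]) (2 * sqabs (k g))%:E < +oo)%E.
  move=> /(esum_sqabsZ (Num.sqrt 2)%:C); congr (_ < _)%E.
  by apply: eq_esum => g _; rewrite sqabsM /sqabs/= expr0n addr0 sqr_sqrtr.
apply/square_summableP.
have saf : a *: f \in square_summable by apply/square_summableP/esum_sqabsZ.
apply: (@le_lt_trans _ _ (\esum_(g in [set: G])
    ((2 * sqabs ((a *: f) g))%:E + (2 * sqabs (h g))%:E))%E).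
  by apply: le_esum => g _; rewrite -EFinD lee_fin; apply: sqabsD.
have ge0 (k : G -> R[i]^o) g : (0 <= (2 * sqabs (k g))%:E)%E.
  by rewrite lee_fin mulr_ge0 ?sqabs_ge0.
by rewrite esumD => [|g _|g _]; rewrite ?ge0//; apply: lte_add_pinfty; apply: s2.
Qed.

HB.instance Definition _ := GRing.isSubmodClosed.Build R[i] (G -> R[i]^o)
  square_summable square_summable_submod.

Record ell2 := Ell2 {
  ell2_fun :> G -> R[i]^o;
  ell2_mem : ell2_fun \in square_summable }.

HB.instance Definition _ := [isSub for ell2_fun].
HB.instance Definition _ := [Choice of ell2 by <:].
HB.instance Definition _ := [SubChoice_isSubLmodule of ell2 by <:].

Definition ell2_norm (f : ell2) : R :=
  Num.sqrt (fine (\esum_(g in [set: G]) (sqabs (f g))%:E)).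

(* Positive part minus negative part; this is the sum of the family when it is
   absolutely summable, and only then. *)
Definition real_sum (a : G -> R) : R :=
  fine (\esum_(g in [set: G]) (Num.max (a g) 0)%:E) -
  fine (\esum_(g in [set: G]) (Num.max (- a g) 0)%:E).

Definition complex_sum (a : G -> R[i]) : R[i] :=
  real_sum (fun g => complex.Re (a g)) +i* real_sum (fun g => complex.Im (a g)).

(* Linear in the first variable. The terms are absolutely summable. *)
Definition inner (f h : ell2) : R[i] :=
  complex_sum (fun g => (f g : R[i]) * (h g : R[i])^*).

Fact delta_summable (s : G) :
  (fun g : G => (g == s)%:R : R[i]^o) \in square_summable.
Proof.
apply/square_summableP.
rewrite (_ : esum _ _ = (\esum_(g in [set s]) 1%:E)%E).
  by rewrite esum_set1 ?ltry ?lee_fin.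
rewrite [RHS]esum_mkcond; apply: eq_esum => g _; rewrite /sqabs.
have [->|/eqP gs] := eqVneq g s.
  by rewrite mem_set//= expr1n expr0n addr0.
by rewrite memNset//= expr0n addr0.
Qed.

Definition delta (s : G) : ell2 := Ell2 (delta_summable s).

End ell2.

Notation operator R G := (ell2 R G -> ell2 R G).

Section operators.
Variables (R : realType) (G : choiceType).
Implicit Types (T S : operator R G) (A : set (operator R G)).

Definition bounded_operator T : Prop :=
  linear T /\ exists C : R, forall f, ell2_norm (T f) <= C * ell2_norm f.

(* The bounded operator T^* with <T f, h> = <f, T^* h>, which is unique and exists
   for every bounded T; the default value 0 is only reached for other T. *)
Definition adjoint T : operator R G :=
  xget 0 [set S | bounded_operator S /\
                  forall f h, inner (T f) h = inner f (S h)].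

Definition commutant A : set (operator R G) :=
  [set T | bounded_operator T /\ forall S, A S -> T \o S = S \o T].

Definition unitary T : Prop :=
  adjoint T \o T = idfun /\ T \o adjoint T = idfun.

End operators.

Section group_von_Neumann_algebra.
Variables (R : realType) (G : groupType).

Fact lreg_summable (s : G) (f : ell2 R G) :
  (fun g : G => f (s^-1 * g)%g) \in @square_summable R G.
Proof.
apply/square_summableP; have /square_summableP := ell2_mem f.
congr (_ < _)%E; apply: (@reindex_esum _ _ _ setT setT (fun g => s^-1 * g)%g).
by split=> // [x y _ _ /mulgI//|x _]; exists (s * x)%g => //; rewrite mulKg.
Qed.

Definition lreg (s : G) : operator R G := fun f => Ell2 (lreg_summable s f).

(* The commutants are taken in the bounded operators, so the bicommutant of
   the self-adjoint set of the [lreg s] is the von Neumann algebra they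
   generate. *)
Definition groupvN : set (operator R G) :=
  commutant (commutant (range lreg)).

Definition trace (x : operator R G) : R[i] := inner (x (delta R 1%g)) (delta R 1%g).

Definition norm2 (x : operator R G) : R :=
  Num.sqrt (complex.Re (trace (adjoint x \o x))).

End group_von_Neumann_algebra.
Arguments lreg R {G} s.
Arguments groupvN : clear implicits.

(* Bijective *-homomorphism of A onto B; neither normality nor preservation of
   a trace is assumed. *)
Definition star_isomorphism (R : realType) (G H : choiceType)
    (A : set (operator R G)) (B : set (operator R H))
    (theta : operator R G -> operator R H) : Prop :=
  [/\ set_bij A B theta,
      forall x y, A x -> A y -> theta (x + y) = theta x + theta y,
      forall (a : R[i]) x, A x -> theta (a *: x) = a *: theta x,
      forall x y, A x -> A y -> theta (x \o y) = theta x \o theta y &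
      forall x, A x -> theta (adjoint x) = adjoint (theta x)].

Definition circle_multiples (R : realType) (I : Type) (G : choiceType)
    (u : I -> operator R G) : set (operator R G) :=
  [set x | exists lam : R[i], exists g, `|lam| = 1 /\ x = lam *: u g].

(* The asymmetric upper Hausdorff distance; it is taken in the extended reals so
   that suprema and infima are never default values. *)
Definition dist2 (R : realType) (G : groupType)
    (A B : set (operator R G)) : \bar R :=
  ereal_sup [set ereal_inf [set (norm2 (x - y))%:E | y in B] | x in A].

Definition character (R : realType) (G : groupType) (gamma : G -> R[i]) : Prop :=
  (forall g, `|gamma g| = 1) /\
  (forall g h, gamma (g * h)%g = gamma g * gamma h).

(* Main.v *)
Require Import Defs.
From HB Require Import structures.
From mathcomp Require Import all_boot all_order all_algebra.
From mathcomp Require Import all_classical all_reals all_analysis.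
From mathcomp Require Import complex ring lra.

(* Both u_g = theta (lreg g) and the v_s act on H = ell2 Lam, and theta preserves
   the trace (an icc group von Neumann algebra has only one, here without
   assuming theta normal), so that (u_g delta_1)_g is an orthonormal basis.
   Condition (1) says that every u_g has a coefficient bounded below uniformly
   in g. If (2) holds, truncating w delta_1 and w^* delta_1 gives this bound.

   Conversely, let W_g = u_g (x) conj u_g act on the kernels ell2 (Lam * Lam), and
   let D be the projection onto the diagonal kernels. On operators commuting with
   the right translations there is a Hilbert-Schmidt norm [hsq], finite at D. The
   element of least norm in the weakly closed convex hull of the W_g D W_g^* is
   fixed by conjugation, and nonzero because of the uniform bound. As Gam is icc,
   two such fixed operators are proportional: the Gam^3-translates of one of them
   already form an orthonormal basis. So the fixed operator is a multiple of a
   projection P, which inherits from D the symmetry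
   <P (tens x y), tens z t> = <P (tens t y), tens z x>.

   Such a P looks like D in some orthonormal basis: Gram vectors and a
   compactness argument give a unit xi with P (tens xi xi) = tens xi xi, and two
   rank-one projections in the range of P are equal or orthogonal. Hence u_g xi
   and rho_s xi are orthogonal or proportional, where rho is the right regular
   representation. The stabilizer of the line of xi in Gam is finite, and
   normalized by a subgroup of finite index (a Schur test bounds the index), so it
   is trivial by icc; likewise in Lam. Proportionality is then the graph of an
   isomorphism delta, and w f (s) = <f, rho_(s^-1) xi> is the required unitary. *)

Set Implicit Arguments.
Unset Strict Implicit.
Unset Printing Implicit Defensive.

Import Order.TTheory GRing.Theory Num.Theory.
Import ComplexField.Normc.

Local Open Scope classical_set_scope.
Local Open Scope ring_scope.
Local Notation "x %:C" := (real_complex _ x) : ring_scope.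
Local Notation "z ^*" := (Num.conj z) : complex_scope.

(** Without normality, [theta] carries over algebraic relations and norm bounds, but neither weak
    limits nor smallness in the 2-norm. The trace argument therefore turns elements [y k] that are
    small in the 2-norm into a single operator [T] such that [y k \o T] is small in norm while [T]
    annihilates no nonzero element of the algebra; both facts survive [theta]. Three factors Gam
    appear because the matrix entries of an operator on kernels are indexed by four elements of Lam,
    one of which the right translations remove; the other three are expanded in the basis [u g d1].
    Conjugation by W_g becomes diagonal conjugation on Gam^3, whose nontrivial orbits are infinite,
    whereas matrix coefficients of a regular representation vanish at infinity: a coefficient that
    is constant along orbits is zero. The symmetry of P identifies the inner product of
    [P (tens a a)] and [tens h h] with the squared norm of [P (tens h a)]. So each [P (tens a a)] is
    a positive trace-class kernel, and the unit vector is found by maximizing over a top eigenspace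
    of such a kernel. *)

Section complex_lemmas.
Variable R : realType.
Implicit Types z w : R[i].

Lemma complexP z w : complex.Re z = complex.Re w -> complex.Im z = complex.Im w ->
  z = w.
Proof. by case: z w => a b [c d] /= -> ->. Qed.

Lemma cReM z w : complex.Re (z * w) =
  complex.Re z * complex.Re w - complex.Im z * complex.Im w.
Proof. by case: z w => a b [c d]. Qed.

Lemma cImM z w : complex.Im (z * w) =
  complex.Re z * complex.Im w + complex.Im z * complex.Re w.
Proof. by case: z w => a b [c d]. Qed.

Lemma ReD z w : complex.Re (z + w) = complex.Re z + complex.Re w.
Proof. by case: z w => a b [c d]. Qed.

Lemma ImD z w : complex.Im (z + w) = complex.Im z + complex.Im w.
Proof. by case: z w => a b [c d]. Qed.

Lemma ReN z : complex.Re (- z) = - complex.Re z.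
Proof. by case: z. Qed.

Lemma ImN z : complex.Im (- z) = - complex.Im z.
Proof. by case: z. Qed.

Lemma ReB z w : complex.Re (z - w) = complex.Re z - complex.Re w.
Proof. by rewrite ReD ReN. Qed.

Lemma ReJ z : complex.Re z^* = complex.Re z.
Proof. by case: z. Qed.

Lemma ImJ z : complex.Im z^* = - complex.Im z.
Proof. by case: z. Qed.

Lemma ReZ (a : R) z : complex.Re (a%:C * z) = a * complex.Re z.
Proof. by rewrite cReM /= mul0r subr0. Qed.

Lemma Re_sum I (r : seq I) P (F : I -> R[i]) :
  complex.Re (\sum_(i <- r | P i) F i) = \sum_(i <- r | P i) complex.Re (F i).
Proof. by apply: (big_morph _ ReD). Qed.

Lemma conjM z w : (z * w)^* = z^* * w^*. Proof. exact: rmorphM. Qed.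
Lemma conjD z w : (z + w)^* = z^* + w^*. Proof. exact: rmorphD. Qed.
Lemma conjN z : (- z)^* = - z^*. Proof. exact: rmorphN. Qed.
Lemma conjK z : z^*^* = z. Proof. exact: conjCK. Qed.
Lemma conj0 : (0 : R[i])^* = 0. Proof. exact: conjC0. Qed.
Lemma conj1 : (1 : R[i])^* = 1. Proof. exact: conjC1. Qed.
Lemma conj_real (a : R) : (a%:C)^* = a%:C.
Proof. by apply: complexP; rewrite ?ReJ ?ImJ //= oppr0. Qed.

Lemma halfC z : (2^-1)%:C * (z + z) = z.
Proof. by case: z => a b; apply: complexP; rewrite ?ReZ /=; lra. Qed.

Lemma sqabsE z : z * z^* = (sqabs z)%:C.
Proof. by case: z => a b; apply: complexP; rewrite ?cReM ?cImM ?ReJ ?ImJ /sqabs /=; ring. Qed.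

Lemma sqabs_normc z : sqabs z = normc z ^+ 2.
Proof.
by case: z => a b; rewrite /sqabs /= sqr_sqrtr// addr_ge0 ?sqr_ge0.
Qed.

Lemma normc_ge0 z : 0 <= normc z.
Proof. by case: z => a b; apply: sqrtr_ge0. Qed.

Lemma normc_real (a : R) : normc a%:C = `|a|.
Proof. by rewrite /= expr0n addr0 sqrtr_sqr. Qed.

Lemma sqabs_real (a : R) : sqabs a%:C = a ^+ 2.
Proof. by rewrite /sqabs /= expr0n addr0. Qed.

Lemma sqabsJ z : sqabs z^* = sqabs z.
Proof. by rewrite /sqabs ReJ ImJ sqrrN. Qed.

Lemma normc_conj z : normc z^* = normc z.
Proof. by apply/eqP; rewrite -(@eqrXn2 _ 2) ?normc_ge0// -!sqabs_normc sqabsJ. Qed.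

Lemma sqabsN z : sqabs (- z) = sqabs z.
Proof. by case: z => a b; rewrite /sqabs /= !sqrrN. Qed.

Lemma sqabs0 : sqabs (0 : R[i]) = 0.
Proof. by rewrite /sqabs/= expr0n addr0. Qed.

Lemma sqabs1 : sqabs (1 : R[i]) = 1.
Proof. by rewrite /sqabs/= expr0n expr1n addr0. Qed.

Lemma sqabs_eq0 z : (sqabs z == 0) = (z == 0).
Proof.
case: z => a b; rewrite /sqabs /= paddr_eq0 ?sqr_ge0// !sqrf_eq0.
by rewrite eq_complex.
Qed.

Lemma sqabs_normr z : `|z| ^+ 2 = (sqabs z)%:C.
Proof. by rewrite -add_Re2_Im2. Qed.

Lemma sqabs_eq1 z : sqabs z = 1 <-> `|z| = 1.
Proof.
split=> [h|h].
  by apply/eqP; rewrite -(@eqrXn2 _ 2)// ?ler01// sqabs_normr h expr1n.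
by apply: complexI; rewrite -sqabs_normr h expr1n.
Qed.

Lemma ler_norm_Re z : `|complex.Re z| <= normc z.
Proof.
by case: z => a b /=; rewrite -[`|a|]sqrtr_sqr ler_wsqrtr// lerDl sqr_ge0.
Qed.

Lemma ler_norm_Im z : `|complex.Im z| <= normc z.
Proof.
by case: z => a b /=; rewrite -[`|b|]sqrtr_sqr ler_wsqrtr// lerDr sqr_ge0.
Qed.

Lemma le_Re_normc z : complex.Re z <= normc z.
Proof. exact: le_trans (ler_norm _) (ler_norm_Re z). Qed.

Lemma normc_eq0 z : (normc z == 0) = (z == 0).
Proof. by rewrite -sqabs_eq0 sqabs_normc sqrf_eq0. Qed.

End complex_lemmas.

(** * Sums over arbitrary index types *)

Section sums.
Variables (R : realType) (G : choiceType).
Implicit Types (a b : G -> R) (c d : G -> R[i]).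

Lemma esum_leP a C : (forall g, 0 <= a g) ->
  (\esum_(g in [set: G]) (a g)%:E <= C%:E)%E <->
  forall s : seq G, uniq s -> \sum_(g <- s) a g <= C.
Proof.
move=> a0; split=> [h s us|h].
  rewrite -lee_fin (le_trans _ h)// esum_ge//; exists [set` s] => //.
  by rewrite -fsbig_seq// -sumEFin.
apply: ge_ereal_sup => _ [A [Afin _] <-].
by rewrite fsbig_finite//= sumEFin lee_fin h.
Qed.

Definition asummable a := (\esum_(g in [set: G]) `|a g|%:E < +oo)%E.

Lemma asummable_le a b : (forall g, `|a g| <= `|b g|) -> asummable b -> asummable a.
Proof. by move=> ab; apply: le_lt_trans; apply: le_esum => g _; rewrite lee_fin. Qed.

Lemma asummableD a b : asummable a -> asummable b -> asummable (fun g => a g + b g).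
Proof.
move=> sa sb; apply: le_lt_trans (lte_add_pinfty sa sb).
by rewrite -esumD//; apply: le_esum => g _; rewrite lee_fin ler_normD.
Qed.

Lemma ge0_esum_fin a : (forall g, 0 <= a g) -> asummable a ->
  (\esum_(g in [set: G]) (a g)%:E = (fine (\esum_(g in [set: G]) (a g)%:E))%:E)%E.
Proof.
move=> a0 sa; rewrite fineK// ge0_fin_numE; last first.
  by apply: esum_ge0 => g _; rewrite lee_fin.
by apply: le_lt_trans sa; apply: le_esum => g _; rewrite lee_fin ler_norm.
Qed.

Lemma real_sum_ge0E a : (forall g, 0 <= a g) ->
  real_sum a = fine (\esum_(g in [set: G]) (a g)%:E).
Proof.
move=> a0; rewrite /real_sum [X in _ - fine X]esum1; last first.
  by move=> g _; rewrite max_r// oppr_le0.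
by rewrite subr0; congr fine; apply: eq_esum => g _; rewrite max_l.
Qed.

Lemma eq_real_sum a b : a =1 b -> real_sum a = real_sum b.
Proof. by move=> /funext ->. Qed.

Lemma real_sumN a : real_sum (fun g => - a g) = - real_sum a.
Proof.
rewrite /real_sum opprB; congr (_ - fine _).
by apply: eq_esum => g _; rewrite opprK.
Qed.

Lemma real_sumD a b : asummable a -> asummable b ->
  real_sum (fun g => a g + b g) = real_sum a + real_sum b.
Proof.
move=> sa sb; have sab := asummableD sa sb.
have sp (c : G -> R) : asummable c -> asummable (fun g => Num.max (c g) 0).
  by apply: asummable_le => g; case: (leP (c g) 0); rewrite ?normr0.
have sn (c : G -> R) : asummable c -> asummable (fun g => Num.max (- c g) 0).
  by apply: asummable_le => g; case: (leP (- c g) 0); rewrite ?normr0 ?normrN.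
have p0 (c : G -> R) g : 0 <= Num.max (c g) 0 by rewrite le_max lexx orbT.
have n0 (c : G -> R) g : 0 <= Num.max (- c g) 0 by rewrite le_max lexx orbT.
rewrite /real_sum.
have : (\esum_(g in [set: G]) (Num.max (a g + b g) 0)%:E
  + (\esum_(g in [set: G]) (Num.max (- a g) 0)%:E
    + \esum_(g in [set: G]) (Num.max (- b g) 0)%:E) =
  \esum_(g in [set: G]) (Num.max (- (a g + b g)) 0)%:E
  + (\esum_(g in [set: G]) (Num.max (a g) 0)%:E
    + \esum_(g in [set: G]) (Num.max (b g) 0)%:E))%E.
  rewrite -!esumD; try by move=> g _; rewrite -?EFinD lee_fin;
    do ?apply: addr_ge0; rewrite le_max lexx orbT.
  apply: eq_esum => g _; rewrite -!EFinD; congr (_%:E).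
  by case: (leP (a g + b g) 0); case: (leP (- (a g + b g)) 0);
     case: (leP (a g) 0); case: (leP (- a g) 0); case: (leP (b g) 0);
     case: (leP (- b g) 0); lra.
have /= -> := ge0_esum_fin (p0 _) (sp _ sab).
have /= -> := ge0_esum_fin (n0 _) (sn _ sab).
have /= -> := ge0_esum_fin (p0 _) (sp _ sa).
have /= -> := ge0_esum_fin (n0 _) (sn _ sa).
have /= -> := ge0_esum_fin (p0 _) (sp _ sb).
have /= -> := ge0_esum_fin (n0 _) (sn _ sb).
rewrite -!EFinD => -[] /=; lra.
Qed.

Lemma asummableZ (x : R) a : asummable a -> asummable (fun g => x * a g).
Proof.
move=> sa; have e := ge0_esum_fin (fun g => normr_ge0 (a g)).
have {}sa : asummable (fun g => `|a g|) by apply: asummable_le sa => g; rewrite normr_id.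
have {}e := e sa; move: e; set S := fine _ => e.
have h : (\esum_(g in [set: G]) `|a g|%:E <= S%:E)%E by rewrite e.
apply: (@le_lt_trans _ _ (`|x| * S)%:E); last exact: ltry.
have /= := esum_leP S (fun g => normr_ge0 (a g)) => -[/(_ h) {}h _].
apply/esum_leP => // s us; under eq_bigr do rewrite normrM.
by rewrite -mulr_sumr ler_wpM2l// h.
Qed.

Lemma fine_esumZ_le (x : R) a : 0 <= x -> (forall g, 0 <= a g) -> asummable a ->
  fine (\esum_(g in [set: G]) (x * a g)%:E) <=
  x * fine (\esum_(g in [set: G]) (a g)%:E).
Proof.
move=> x0 a0 sa; rewrite -lee_fin -ge0_esum_fin; last exact: asummableZ.
  apply/esum_leP => [g|s us]; first by rewrite mulr_ge0.
  rewrite -mulr_sumr ler_wpM2l//; apply: (esum_leP _ a0).1 us.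
  by rewrite -ge0_esum_fin.
by move=> g; rewrite mulr_ge0.
Qed.

Lemma fine_esumZ (x : R) a : 0 <= x -> (forall g, 0 <= a g) -> asummable a ->
  fine (\esum_(g in [set: G]) (x * a g)%:E) =
  x * fine (\esum_(g in [set: G]) (a g)%:E).
Proof.
move=> x0 a0 sa; have [->|xn0] := eqVneq x 0.
  by rewrite mul0r esum1// => g _; rewrite mul0r.
apply/eqP; rewrite eq_le fine_esumZ_le//=.
rewrite -ler_pdivlMl ?lt_neqAle ?x0 1?eq_sym ?xn0//.
apply: le_trans (fine_esumZ_le _ _ (asummableZ x sa)); last 2 first.
- by rewrite invr_ge0.
- by move=> g; rewrite mulr_ge0.
rewrite [leRHS](_ : _ = fine (\esum_(g in [set: G]) (a g)%:E))//.
by congr fine; apply: eq_esum => g _; rewrite mulKf.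
Qed.

Lemma asummable_max a : asummable a -> asummable (fun g => Num.max (a g) 0).
Proof. by apply: asummable_le => g; case: (leP (a g) 0); rewrite ?normr0. Qed.

Lemma real_sumZ (x : R) a : asummable a ->
  real_sum (fun g => x * a g) = x * real_sum a.
Proof.
move=> sa; wlog x0 : x / 0 <= x => [H|].
  have [/H//|x0] := leP 0 x; have := H (- x); rewrite oppr_ge0 => /(_ (ltW x0)) h.
  apply: oppr_inj; rewrite -mulNr -h -real_sumN; apply: eq_real_sum => g.
  by rewrite mulNr.
have sn : asummable (fun g => - a g).
  by apply: asummable_le sa => g; rewrite normrN.
rewrite /real_sum mulrBr -!fine_esumZ//; try exact: asummable_max;
  try by move=> g; rewrite le_max lexx orbT.
congr (fine _ - fine _); apply: eq_esum => g _; congr (_%:E).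
  by rewrite maxr_pMr ?mulr0.
by rewrite -mulrN maxr_pMr ?mulr0.
Qed.

Lemma real_sum_ge0 a : (forall g, 0 <= a g) -> 0 <= real_sum a.
Proof.
move=> a0; rewrite real_sum_ge0E// fine_ge0//.
by apply: esum_ge0 => g _; rewrite lee_fin.
Qed.

Lemma real_sum1 (x : G) (r : R) : real_sum (fun g => if g == x then r else 0) = r.
Proof.
have e : (fun g => if g == x then r else 0) = (fun g => r * (g == x)%:R).
  by apply/funext => g; case: ifP; rewrite ?mulr1 ?mulr0.
suff h1 : (\esum_(g in [set: G]) ((g == x)%:R : R)%:E = 1)%E.
  rewrite e real_sumZ; first by rewrite real_sum_ge0E// h1 mulr1.
  rewrite /asummable; under eq_esum do rewrite ger0_norm//.
  by rewrite h1 ltry.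
have -> : 1%E = (\esum_(g in [set x]) 1%:E)%E :> \bar R.
  by rewrite esum_set1 ?lee_fin.
rewrite [RHS]esum_mkcond; apply: eq_esum => g _.
have [->|/eqP gs] := eqVneq g x; first by rewrite mem_set.
by rewrite memNset.
Qed.

Definition csummable c := asummable (fun g => normc (c g)).

Lemma csummable_Re c : csummable c -> asummable (fun g => complex.Re (c g)).
Proof.
by apply: asummable_le => g; rewrite [leRHS]ger0_norm ?normc_ge0// ler_norm_Re.
Qed.

Lemma csummable_Im c : csummable c -> asummable (fun g => complex.Im (c g)).
Proof.
by apply: asummable_le => g; rewrite [leRHS]ger0_norm ?normc_ge0// ler_norm_Im.
Qed.

Lemma csummableZ x c : csummable c -> csummable (fun g => x * c g).
Proof.
move=> sc; apply: asummable_le (asummableZ (normc x) sc) => g.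
by rewrite normcM.
Qed.

Lemma eq_complex_sum c d : c =1 d -> complex_sum c = complex_sum d.
Proof. by move=> /funext ->. Qed.

Lemma complex_sumD c d : csummable c -> csummable d ->
  complex_sum (fun g => c g + d g) = complex_sum c + complex_sum d.
Proof.
move=> sc sd; apply: complexP; rewrite /complex_sum /=.
  rewrite -real_sumD ?csummable_Re//.
  by apply: eq_real_sum => g; rewrite ReD.
rewrite -real_sumD ?csummable_Im//.
by apply: eq_real_sum => g; rewrite ImD.
Qed.

Lemma complex_sumZ x c : csummable c ->
  complex_sum (fun g => x * c g) = x * complex_sum c.
Proof.
move=> sc; apply: complexP; rewrite /complex_sum ?cReM ?cImM /=.
  rewrite -!real_sumZ ?csummable_Re ?csummable_Im// -real_sumN -real_sumD.
  - by apply: eq_real_sum => g; rewrite cReM.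
  - exact/asummableZ/csummable_Re.
  - apply: (asummable_le (b := fun g => complex.Im x * complex.Im (c g))) => [g|].
      by rewrite normrN.
    exact/asummableZ/csummable_Im.
rewrite -!real_sumZ ?csummable_Re ?csummable_Im// -real_sumD.
- by apply: eq_real_sum => g; rewrite cImM.
- exact/asummableZ/csummable_Im.
- exact/asummableZ/csummable_Re.
Qed.

Lemma complex_sumJ c : complex_sum (fun g => (c g)^*) = (complex_sum c)^*.
Proof.
apply: complexP; rewrite /complex_sum /=.
  by apply: eq_real_sum => g; rewrite ReJ.
by rewrite -real_sumN; apply: eq_real_sum => g; rewrite ImJ.
Qed.

Lemma complex_sum1 (x : G) (r : R[i]) :
  complex_sum (fun g => if g == x then r else 0) = r.
Proof.
apply: complexP; rewrite /complex_sum /=.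
  by rewrite -[RHS](real_sum1 x); apply: eq_real_sum => g; case: ifP.
by rewrite -[RHS](real_sum1 x); apply: eq_real_sum => g; case: ifP.
Qed.

End sums.

Lemma reindex_complex_sum (R : realType) (G H : choiceType) (e : G -> H)
  (c : H -> R[i]) : bijective e -> complex_sum c = complex_sum (c \o e).
Proof.
move=> be; have se : set_bij [set: G] [set: H] e.
  case: be => e' eK e'K; split=> // [x y _ _ /(can_inj eK)//|y _].
  by exists (e' y).
by rewrite /complex_sum /real_sum !(reindex_esum [set: G] [set: H] e).
Qed.

(** Real and imaginary parts are each dominated by the sum of [d], hence the factor 2. *)
Lemma complex_sum_bound (R : realType) (G : choiceType) (c : G -> R[i]) (d : G -> R) :
  (forall g, normc (c g) <= d g) -> asummable d ->
  sqabs (complex_sum c) <= 2 * real_sum d ^+ 2.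
Proof.
move=> cd sd.
have bound (a : G -> R) : (forall g, `|a g| <= normc (c g)) -> real_sum a ^+ 2 <= real_sum d ^+ 2.
  move=> ac; have ad g := le_trans (ac g) (cd g).
  have sa : asummable a.
    by apply: asummable_le sd => g; rewrite (le_trans (ad g))// ler_norm.
  have sN : asummable (fun g => - a g) by apply: asummable_le sa => g; rewrite normrN.
  have h1 : 0 <= real_sum d + real_sum a.
    rewrite -real_sumD//; apply: real_sum_ge0 => g.
    by have := ad g; rewrite ler_norml => /andP[]; lra.
  have h2 : 0 <= real_sum d + real_sum (fun g => - a g).
    rewrite -real_sumD//; apply: real_sum_ge0 => g.
    by have := ad g; rewrite ler_norml => /andP[]; lra.
  by move: h1 h2; rewrite real_sumN; move: (real_sum a) (real_sum d) => x y; nra.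
have := bound _ (fun g => ler_norm_Re (c g)); have := bound _ (fun g => ler_norm_Im (c g)).
rewrite /complex_sum /sqabs /=; lra.
Qed.

Lemma asummable_ge0 (R : realType) (G : choiceType) (d : G -> R) (S : R) : (forall g, 0 <= d g) ->
  (\esum_(g in [set: G]) (d g)%:E = S%:E)%E -> asummable d /\ real_sum d = S.
Proof.
move=> d0 h; split; last by rewrite real_sum_ge0E// h.
rewrite /asummable; under eq_esum do rewrite ger0_norm//.
by rewrite h ltry.
Qed.

Lemma esum_swap (R : realType) (I J : choiceType) (a : I -> J -> \bar R) :
  (forall i j, 0 <= a i j)%E ->
  (\esum_(i in [set: I]) \esum_(j in [set: J]) a i j =
   \esum_(j in [set: J]) \esum_(i in [set: I]) a i j)%E.
Proof.
move=> a0; rewrite !esum_esum//.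
rewrite (@reindex_esum _ _ _ ([set: J] `*`` fun=> [set: I]) ([set: I] `*`` fun=> [set: J])
  (fun p => (p.2, p.1)))//.
by split=> // [[x y] [x' y'] _ _ [-> ->]//|[x y] _]; exists (y, x).
Qed.

Lemma esum_pair (R : realType) (I J : choiceType) (a : I * J -> \bar R) :
  (forall p, 0 <= a p)%E ->
  (\esum_(p in [set: I * J]) a p =
   \esum_(i in [set: I]) \esum_(j in [set: J]) a (i, j))%E.
Proof.
move=> a0; rewrite (@esum_esum _ _ _ setT (fun=> setT) (fun i j => a (i, j)))//.
rewrite (_ : [set: I] `*`` _ = setT); last by apply/seteqP; split.
by apply: eq_esum => -[].
Qed.

Lemma sup_seq (R : realType) (T : Type) (A : T -> Prop) (F : T -> R) (b : R) : (exists x, A x) ->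
  (forall x, A x -> F x <= b) ->
  exists m : R, (forall x, A x -> F x <= m) /\ forall n, exists x, A x /\ m - n.+1%:R^-1 <= F x.
Proof.
move=> [x0 Ax0] hb; pose S := [set F x | x in A].
have hS : has_sup S by split; [exists (F x0), x0|exists b => _ [x Ax <-]; exact: hb].
exists (sup S); split=> [x Ax|n]; first by apply: ub_le_sup; [exact: hS.2|exists x].
have [|_ [x Ax <-] hx] := @sup_adherent R S n.+1%:R^-1 _ hS; first by rewrite invr_gt0.
by exists x; split=> //; exact: ltW.
Qed.

Lemma inv_small (R : realType) (r : R) : 0 < r -> exists N, forall n, (N <= n)%N -> n.+1%:R^-1 <= r.
Proof.
move=> r0; exists (Num.truncn r^-1) => n Nn.
rewrite invf_ple ?posrE//; apply: le_trans (ltW (truncnS_gt _)) _.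
by rewrite ler_nat ltnS.
Qed.

(** * The Hilbert space [ell2] *)

Section hilbert.
Variables (R : realType) (G : choiceType).
Implicit Types (f h : ell2 R G) (a b : R[i]) (s : seq G).

Definition nsq f : R := fine (\esum_(g in [set: G]) (sqabs (f g))%:E)%E.

Lemma nsqE f : (\esum_(g in [set: G]) (sqabs (f g))%:E = (nsq f)%:E)%E.
Proof.
rewrite fineK// ge0_fin_numE; first exact/square_summableP/ell2_mem.
by apply: esum_ge0 => g _; rewrite lee_fin sqabs_ge0.
Qed.

Lemma nsq_ge0 f : 0 <= nsq f.
Proof.
by rewrite -lee_fin -nsqE; apply: esum_ge0 => g _; rewrite lee_fin sqabs_ge0.
Qed.

Lemma ell2_norm_sq f : ell2_norm f ^+ 2 = nsq f.
Proof. by rewrite sqr_sqrtr ?nsq_ge0. Qed.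

Lemma nsq_leP f C :
  nsq f <= C <-> forall s, uniq s -> \sum_(g <- s) sqabs (f g) <= C.
Proof.
by rewrite -lee_fin -nsqE; apply: esum_leP => g; exact: sqabs_ge0.
Qed.

Lemma sum_le_nsq f s : uniq s -> \sum_(g <- s) sqabs (f g) <= nsq f.
Proof. exact: (nsq_leP f _).1. Qed.

Lemma sqabs_le_nsq f g : sqabs (f g) <= nsq f.
Proof. by have := sum_le_nsq f (s := [:: g]) isT; rewrite big_seq1. Qed.

Lemma ell2_memP (F : G -> R[i]) C :
  (forall s, uniq s -> \sum_(g <- s) sqabs (F g) <= C) ->
  (F : G -> R[i]^o) \in @square_summable R G.
Proof.
move=> h; apply/square_summableP; apply: (@le_lt_trans _ _ C%:E); last exact: ltry.
by apply/esum_leP => // g; exact: sqabs_ge0.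
Qed.

Lemma ell2P f h : f =1 h -> f = h.
Proof. by move=> e; apply: val_inj; apply/funext. Qed.

Lemma ell2DE f h g : (f + h) g = f g + h g. Proof. by []. Qed.
Lemma ell2NE f g : (- f) g = - f g. Proof. by []. Qed.
Lemma ell2BE f h g : (f - h) g = f g - h g. Proof. by []. Qed.
Lemma ell2ZE a f g : (a *: f) g = a * f g. Proof. by []. Qed.
Lemma ell20E g : (0 : ell2 R G) g = 0. Proof. by []. Qed.
Lemma ell2_sumE I (r : seq I) (F : I -> ell2 R G) g :
  (\sum_(i <- r) F i) g = \sum_(i <- r) F i g.
Proof. by apply: (big_morph (fun f : ell2 R G => f g : R[i])) => //. Qed.

Definition ell2E := (ell2DE, ell2NE, ell2BE, ell2ZE, ell20E, ell2_sumE).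

Lemma deltaE (x g : G) : delta R x g = (g == x)%:R.
Proof. by []. Qed.

Definition toell2 (F : G -> R[i]) : ell2 R G := insubd (0 : ell2 R G) (F : G -> R[i]^o).

Lemma toell2E (F : G -> R[i]) : (F : G -> R[i]^o) \in @square_summable R G ->
  toell2 F =1 F.
Proof. by move=> h g; rewrite /toell2 -[LHS]/(val (insubd _ _) g) insubdK. Qed.

Lemma innerE f h : inner f h = complex_sum (fun g => (f g : R[i]) * (h g : R[i])^*).
Proof. by []. Qed.

Lemma csummable_inner f h : csummable (fun g => (f g : R[i]) * (h g : R[i])^*).
Proof.
apply: (@le_lt_trans _ _ (nsq f + nsq h)%:E); last exact: ltry.
apply/esum_leP => [//|s us].
apply: (@le_trans _ _ (\sum_(g <- s) (sqabs (f g) + sqabs (h g)))); last first.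
  by rewrite big_split lerD ?sum_le_nsq.
apply: ler_sum => g _; rewrite ger0_norm ?normc_ge0// normcM normc_conj !sqabs_normc.
have := normc_ge0 (f g); have := normc_ge0 (h g); nra.
Qed.

Lemma innerDl f1 f2 h : inner (f1 + f2) h = inner f1 h + inner f2 h.
Proof.
rewrite /inner -complex_sumD; try exact: csummable_inner.
by apply: eq_complex_sum => g; rewrite ell2E mulrDl.
Qed.

Lemma innerZl a f h : inner (a *: f) h = a * inner f h.
Proof.
rewrite /inner -complex_sumZ; try exact: csummable_inner.
by apply: eq_complex_sum => g; rewrite ell2E mulrA.
Qed.

Lemma innerJ f h : inner h f = (inner f h)^*.
Proof.
rewrite /inner -complex_sumJ; apply: eq_complex_sum => g.
by rewrite conjM conjK mulrC.
Qed.

Lemma innerDr f h1 h2 : inner f (h1 + h2) = inner f h1 + inner f h2.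
Proof. by rewrite innerJ innerDl conjD -!innerJ. Qed.

Lemma innerZr a f h : inner f (a *: h) = a^* * inner f h.
Proof. by rewrite innerJ innerZl conjM -!innerJ. Qed.

Lemma inner0l h : inner 0 h = 0.
Proof. by rewrite -(scale0r (0 : ell2 R G)) innerZl mul0r. Qed.
Lemma inner0r h : inner h 0 = 0.
Proof. by rewrite innerJ inner0l conj0. Qed.
Lemma innerNl f h : inner (- f) h = - inner f h.
Proof. by rewrite -scaleN1r innerZl mulN1r. Qed.
Lemma innerNr f h : inner f (- h) = - inner f h.
Proof. by rewrite innerJ innerNl conjN -innerJ. Qed.
Lemma innerBl f1 f2 h : inner (f1 - f2) h = inner f1 h - inner f2 h.
Proof. by rewrite innerDl innerNl. Qed.
Lemma innerBr f h1 h2 : inner f (h1 - h2) = inner f h1 - inner f h2.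
Proof. by rewrite innerDr innerNr. Qed.

Lemma inner_suml I (r : seq I) (F : I -> ell2 R G) h :
  inner (\sum_(i <- r) F i) h = \sum_(i <- r) inner (F i) h.
Proof.
by apply: (big_morph (fun f => inner f h)) => [x y|]; rewrite ?innerDl ?inner0l.
Qed.
Lemma inner_sumr I (r : seq I) (F : I -> ell2 R G) h :
  inner h (\sum_(i <- r) F i) = \sum_(i <- r) inner h (F i).
Proof.
by apply: (big_morph (fun f => inner h f)) => [x y|]; rewrite ?innerDr ?inner0r.
Qed.

Lemma inner_delta f x : inner f (delta R x) = f x.
Proof.
rewrite /inner -[RHS](complex_sum1 x); apply: eq_complex_sum => g.
rewrite deltaE; have [->|_] := eqVneq g x; first by rewrite conj1 mulr1.
by rewrite conj0 mulr0.
Qed.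

Lemma delta_inner f x : inner (delta R x) f = (f x : R[i])^*.
Proof. by rewrite innerJ inner_delta. Qed.

Lemma inner_nsq f : inner f f = (nsq f)%:C.
Proof.
apply: complexP; rewrite /inner /complex_sum /=.
  rewrite real_sum_ge0E => [|g]; last by rewrite sqabsE /= sqabs_ge0.
  by rewrite /nsq; congr fine; apply: eq_esum => g _; rewrite sqabsE.
rewrite (eq_real_sum (b := fun=> 0)) => [|g]; last by rewrite sqabsE.
by rewrite real_sum_ge0E// esum1.
Qed.

Lemma nsq_Re f : nsq f = complex.Re (inner f f).
Proof. by rewrite inner_nsq. Qed.

Lemma ReinnerC f h : complex.Re (inner h f) = complex.Re (inner f h).
Proof. by rewrite innerJ ReJ. Qed.

Lemma nsqD f h : nsq (f + h) = nsq f + nsq h + 2 * complex.Re (inner f h).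
Proof.
rewrite !nsq_Re innerDl !innerDr !ReD (ReinnerC f h); ring.
Qed.

Lemma nsqZ a f : nsq (a *: f) = sqabs a * nsq f.
Proof.
by rewrite !nsq_Re innerZl innerZr mulrA sqabsE ReZ.
Qed.

Lemma nsqN f : nsq (- f) = nsq f.
Proof. by rewrite -scaleN1r nsqZ sqabsN sqabs1 mul1r. Qed.

Lemma nsqB f h : nsq (f - h) = nsq f + nsq h - 2 * complex.Re (inner f h).
Proof. by rewrite nsqD nsqN innerNr ReN mulrN. Qed.

Lemma nsq0 : nsq 0 = 0.
Proof. by rewrite nsq_Re inner0l. Qed.

Lemma nsq_eq0 f : nsq f = 0 -> f = 0.
Proof.
move=> f0; apply: ell2P => g; apply/eqP; rewrite -sqabs_eq0 eq_le sqabs_ge0 andbT.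
by rewrite -f0 sqabs_le_nsq.
Qed.

Lemma nsq_le0 f : nsq f <= 0 -> f = 0.
Proof. by move=> h; apply: nsq_eq0; apply: le_anti; rewrite h nsq_ge0. Qed.

Lemma nsq_delta x : nsq (delta R x) = 1.
Proof. by rewrite nsq_Re inner_delta deltaE eqxx. Qed.

Lemma nsqD_le f h : nsq (f + h) <= 2 * nsq f + 2 * nsq h.
Proof.
have := nsq_ge0 (f - h); rewrite nsqB nsqD; lra.
Qed.

Lemma parallelogram f h : nsq (f - h) = 2 * nsq f + 2 * nsq h - nsq (f + h).
Proof. by rewrite nsqB nsqD; ring. Qed.

Lemma cauchy_schwarz f h : sqabs (inner f h) <= nsq f * nsq h.
Proof.
have [h0|hn0] := eqVneq (nsq h) 0.
  by rewrite (nsq_eq0 h0) inner0r sqabs0 mulr_ge0 ?nsq_ge0.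
have hp : 0 < nsq h by rewrite lt_neqAle eq_sym hn0 nsq_ge0.
have := nsq_ge0 ((nsq h)%:C *: f - inner f h *: h).
rewrite nsqB !nsqZ innerZl innerZr.
rewrite (_ : _ * (_ * inner f h) = (nsq h * sqabs (inner f h))%:C); last first.
  by rewrite [_^* * _]mulrC sqabsE rmorphM.
rewrite /= sqabs_real => H.
have {}H : 0 <= nsq h * (nsq f * nsq h - sqabs (inner f h)) by nra.
by rewrite pmulr_rge0 // in H; rewrite -subr_ge0.
Qed.

Lemma inner_ext f h : (forall k, inner k f = inner k h) -> f = h.
Proof.
move=> e; apply/eqP; rewrite -subr_eq0; apply/eqP/nsq_eq0.
by rewrite nsq_Re innerBr e subrr.
Qed.

Lemma sum_deltaE (c : G -> R[i]) s g : uniq s ->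
  (\sum_(i <- s) c i *: delta R i) g = if g \in s then c g else 0.
Proof.
elim: s => [|i s IH /andP[ns us]]; first by rewrite big_nil.
rewrite big_cons ell2DE ell2ZE IH// deltaE inE; have [->|gi] := eqVneq g i.
  by rewrite (negPf ns) addr0 mulr1.
by rewrite mulr0 add0r.
Qed.

Lemma nsq_sum_delta (c : G -> R[i]) s : uniq s ->
  nsq (\sum_(g <- s) c g *: delta R g) = \sum_(g <- s) sqabs (c g).
Proof.
move=> us; rewrite nsq_Re inner_suml Re_sum big_seq [RHS]big_seq.
apply: eq_bigr => g gs; rewrite innerZl delta_inner sum_deltaE// gs.
by rewrite sqabsE.
Qed.

Lemma fin_approx f (e : R) : 0 < e -> exists s,
  uniq s /\ nsq (f - \sum_(g <- s) f g *: delta R g) < e.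
Proof.
move=> e0; have [s [us hs]] : exists s, uniq s /\ nsq f - e < \sum_(g <- s) sqabs (f g).
  apply: contrapT; rewrite -forallNE => h.
  have : nsq f <= nsq f - e.
    by apply/nsq_leP => s us; rewrite leNgt; apply/negP => hs; by apply: (h s).
  by rewrite leNgt ltrBlDr ltrDl e0.
exists s; split=> //; rewrite nsqB nsq_sum_delta// inner_sumr Re_sum.
rewrite [X in 2 * X](_ : _ = \sum_(g <- s) sqabs (f g)); first lra.
by apply: eq_bigr => g _; rewrite innerZr inner_delta mulrC sqabsE.
Qed.

(** Boundedness is stated for squared moduli and squared norms, as it is for operators in [isbop];
    this keeps square roots out of the estimates. *)
Definition bfunctional (F : ell2 R G -> R[i]) := scalar F /\
  exists C, forall f, sqabs (F f) <= C * nsq f.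

Lemma bfunctional_sum F (c : G -> R[i]) s : bfunctional F ->
  F (\sum_(g <- s) c g *: delta R g) = \sum_(g <- s) c g * F (delta R g).
Proof.
move=> [lF _]; have F0 : F 0 = 0.
  by have := lF (-1) 0 0; rewrite scaler0 addr0 mulN1r addNr.
elim: s => [|g s IH]; first by rewrite !big_nil.
by rewrite !big_cons lF IH.
Qed.

Lemma bfunctional_eq0 F : bfunctional F -> (forall x, F (delta R x) = 0) ->
  forall f, F f = 0.
Proof.
move=> bF F0 f; have [lF [C hC]] := bF; apply/eqP; rewrite -sqabs_eq0 eq_le sqabs_ge0 andbT.
have lFB k k' : F (k - k') = F k - F k'.
  by rewrite addrC -scaleN1r lF mulN1r addrC.
apply/ler_addgt0Pr => e e0; rewrite add0r.
have e'0 : 0 < e / (`|C| + 1) by rewrite divr_gt0// ltr_wpDl.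
have [s [us /ltW hs]] := fin_approx f e'0.
have -> : F f = F (f - \sum_(g <- s) f g *: delta R g).
  by rewrite lFB bfunctional_sum// big1 ?subr0// => g _; rewrite F0 mulr0.
apply: le_trans (hC _) _;
  apply: (@le_trans _ _ ((`|C| + 1) * nsq (f - \sum_(g <- s) f g *: delta R g))).
  by rewrite ler_wpM2r ?nsq_ge0// (le_trans (ler_norm _))// lerDl.
by rewrite -ler_pdivlMl ?ltr_wpDl// mulrC.
Qed.

Lemma bfunctionalB F F' : bfunctional F -> bfunctional F' ->
  bfunctional (fun f => F f - F' f).
Proof.
move=> [lF [C hC]] [lF' [C' hC']]; split=> [a f h|].
  by rewrite lF lF'; rewrite mulrBr; ring.
exists (2 * C + 2 * C') => f; apply: le_trans (sqabsD _ _) _.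
by rewrite sqabsN; have := hC f; have := hC' f; nra.
Qed.

Lemma bfunctional_inner h : bfunctional (fun f => inner f h).
Proof.
split=> [a f k|]; first by rewrite innerDl innerZl.
by exists (nsq h) => f; rewrite mulrC; exact: cauchy_schwarz.
Qed.

Lemma bfunctional_ext F F' : bfunctional F -> bfunctional F' ->
  (forall x, F (delta R x) = F' (delta R x)) -> F =1 F'.
Proof.
move=> bF bF' e f; apply/eqP; rewrite -subr_eq0; apply/eqP.
by apply: (bfunctional_eq0 (bfunctionalB bF bF')) => x; rewrite e subrr.
Qed.

(** The coordinates of the vector must be the conjugates of the values at the deltas. Testing [F] on
    a finite truncation of squared norm [q] gives [q ^+ 2 <= C * q], which bounds [q] and makes the
    family square-summable. *)
Lemma riesz F C : 0 <= C -> scalar F -> (forall f, sqabs (F f) <= C * nsq f) ->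
  exists v, (forall f, F f = inner f v) /\ nsq v <= C.
Proof.
move=> C0 lF hC; have bF : bfunctional F by split=> //; exists C.
have hs s : uniq s -> \sum_(g <- s) sqabs (F (delta R g))^* <= C.
  move=> us; set q := \sum_(g <- s) _.
  have q0 : 0 <= q by apply: sumr_ge0 => g _; exact: sqabs_ge0.
  have := hC (\sum_(g <- s) (F (delta R g))^* *: delta R g).
  rewrite bfunctional_sum// nsq_sum_delta// -/q.
  rewrite (_ : \sum_(g <- s) _ = q%:C); last first.
    rewrite /q rmorph_sum; apply: eq_bigr => g _.
    by rewrite mulrC sqabsE sqabsJ.
  rewrite sqabs_real expr2; have [->//|qn0] := eqVneq q 0.
  by rewrite ler_pM2r// lt_neqAle eq_sym qn0.
have mem := ell2_memP hs; exists (toell2 (fun g => (F (delta R g))^*)); split; last first.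
  by apply/nsq_leP => s us; under eq_bigr do rewrite toell2E//; exact: hs.
apply: bfunctional_ext => // [|x]; first exact: bfunctional_inner.
by rewrite delta_inner toell2E// conjK.
Qed.

End hilbert.

(** Polarization with [z] among 0, 1, -1, i, -i. The two pairs may live in different spaces, so that
    an invariance of norms becomes an invariance of inner products. *)
Lemma polar (R : realType) (G H : choiceType) (a b : ell2 R G) (a' b' : ell2 R H) :
  (forall z : R[i], nsq (a + z *: b) = nsq (a' + z *: b')) ->
  inner a b = inner a' b'.
Proof.
move=> h; have h0 := h 0; rewrite !scale0r !addr0 in h0.
have h1 := h 1; rewrite !scale1r in h1.
have hm := h (-1); rewrite !scaleN1r in hm.
have hi := h (Complex 0 1); have hmi := h (Complex 0 (-1)).
move: h1 hm hi hmi; rewrite !nsqB !nsqD !nsqZ !innerZr !cReM /= => h1 hm hi hmi.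
apply: complexP; move: h0 h1 hm hi hmi; rewrite /sqabs /=; nra.
Qed.

Lemma normalize (R : realType) (G : choiceType) (z : ell2 R G) :
  z <> 0 -> exists c : R, sqabs c%:C * nsq z = 1.
Proof.
move=> z0; exists (Num.sqrt (nsq z))^-1; rewrite sqabs_real exprVn sqr_sqrtr ?nsq_ge0//.
by rewrite mulVf//; apply/eqP => /nsq_eq0.
Qed.

Local Opaque inner nsq toell2 adjoint.

(** * Bounded operators and orthonormal bases *)

Section operators.
Variable R : realType.
Implicit Types (G H I J : choiceType).

Definition isbop G H (T : ell2 R G -> ell2 R H) := linear T /\
  exists2 C : R, 0 <= C & forall f, nsq (T f) <= C * nsq f.

Lemma isbop_bounded G (T : operator R G) : isbop T <-> bounded_operator T.
Proof.
split=> -[lT [C]] => [C0 hC|hC]; split=> //.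
  exists (Num.sqrt C) => f.
  by rewrite /ell2_norm -sqrtrM// ler_wsqrtr// hC.
exists (C ^+ 2) => [|f]; first exact: sqr_ge0.
rewrite -!ell2_norm_sq -exprMn lerXn2r// ?nnegrE ?sqrtr_ge0//.
exact: le_trans (sqrtr_ge0 _) (hC f).
Qed.

Section linear.
Variables (G H : choiceType) (T : ell2 R G -> ell2 R H).
Hypothesis lT : linear T.

Lemma bop0 : T 0 = 0.
Proof. by have := lT (-1) 0 0; rewrite !scaler0 addr0 scaleN1r addNr. Qed.
Lemma bopD f h : T (f + h) = T f + T h.
Proof. by rewrite -[f]scale1r lT !scale1r. Qed.
Lemma bopZ a f : T (a *: f) = a *: T f.
Proof. by rewrite -[a *: f]addr0 lT bop0 addr0. Qed.
Lemma bopN f : T (- f) = - T f.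
Proof. by rewrite -scaleN1r bopZ scaleN1r. Qed.
Lemma bopB f h : T (f - h) = T f - T h.
Proof. by rewrite bopD bopN. Qed.
Lemma bop_sum K (r : seq K) F : T (\sum_(i <- r) F i) = \sum_(i <- r) T (F i).
Proof. by apply: (big_morph T bopD bop0). Qed.

End linear.

Lemma isbop_functional G H (T : ell2 R G -> ell2 R H) h :
  isbop T -> bfunctional (fun f => inner (T f) h).
Proof.
move=> [lT [C C0 hC]]; split=> [a f k|]; first by rewrite lT innerDl innerZl.
exists (C * nsq h) => f; apply: le_trans (cauchy_schwarz _ _) _.
by rewrite mulrAC ler_wpM2r ?nsq_ge0.
Qed.

Lemma isbop_ext G H (T S : ell2 R G -> ell2 R H) : isbop T -> isbop S ->
  (forall x, T (delta R x) = S (delta R x)) -> T = S.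
Proof.
move=> bT bS e; apply/funext => f; apply: ell2P => y.
rewrite -!inner_delta.
apply: (bfunctional_ext (isbop_functional _ bT) (isbop_functional _ bS)) => x.
by rewrite e.
Qed.

Lemma isbop_id G : isbop (@idfun (ell2 R G)).
Proof. by split=> //; exists 1 => // f; rewrite mul1r. Qed.

Lemma isbop_comp G H I (S : ell2 R H -> ell2 R I) (T : ell2 R G -> ell2 R H) :
  isbop S -> isbop T -> isbop (S \o T).
Proof.
move=> [lS [C C0 hC]] [lT [D D0 hD]]; split=> [a f h /=|]; first by rewrite lT lS.
exists (C * D) => [|f /=]; first exact: mulr_ge0.
by apply: le_trans (hC _) _; rewrite -mulrA ler_wpM2l.
Qed.

Lemma isbopD G H (S T : ell2 R G -> ell2 R H) : isbop S -> isbop T -> isbop (S + T).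
Proof.
move=> [lS [C C0 hC]] [lT [D D0 hD]]; split=> [a f h|].
  by rewrite !fctE lS lT scalerDr addrACA.
exists (2 * C + 2 * D) => [|f]; first lra.
by apply: le_trans (nsqD_le _ _) _; have := hC f; have := hD f; nra.
Qed.

Lemma opDE G H (S T : ell2 R G -> ell2 R H) f : (S + T) f = S f + T f.
Proof. by []. Qed.

Lemma opBE G H (S T : ell2 R G -> ell2 R H) f : (S - T) f = S f - T f.
Proof. by []. Qed.

Lemma opZE G H a (T : ell2 R G -> ell2 R H) f : (a *: T) f = a *: T f.
Proof. by []. Qed.

Lemma isbopZ G H a (T : ell2 R G -> ell2 R H) : isbop T -> isbop (a *: T).
Proof.
move=> [lT [D D0 hD]]; split=> [b f h|].
  by rewrite !opZE lT scalerDr !scalerA mulrC.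
exists (sqabs a * D) => [|f]; first by rewrite mulr_ge0 ?sqabs_ge0.
by rewrite nsqZ -mulrA ler_wpM2l ?sqabs_ge0.
Qed.

Lemma isbopB G H (S T : ell2 R G -> ell2 R H) : isbop S -> isbop T -> isbop (S - T).
Proof.
by move=> bS bT; rewrite -scaleN1r; apply: isbopD => //; apply: isbopZ.
Qed.

Lemma form_op G H (B : ell2 R G -> ell2 R H -> R[i]) (C : R) : 0 <= C ->
  (forall h, scalar (B^~ h)) ->
  (forall f a h k, B f (a *: h + k) = a^* * B f h + B f k) ->
  (forall f h, sqabs (B f h) <= C * nsq f * nsq h) ->
  exists T, [/\ linear T, forall f, nsq (T f) <= C * nsq f &
    forall f h, inner (T f) h = B f h].
Proof.
move=> C0 Bl Br hB.
have /choice [T hT] f : exists v, (forall h, (B f h)^* = inner h v) /\ nsq v <= C * nsq f.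
  apply: riesz => [|a h k|h]; first by rewrite mulr_ge0 ?nsq_ge0.
    by rewrite Br conjD conjM conjK.
  by rewrite sqabsJ.
have TE f h : inner (T f) h = B f h by rewrite innerJ -(hT f).1 conjK.
exists T; split=> // [a f h|f]; last exact: (hT f).2.
apply: inner_ext => k; apply: (can_inj (@conjK R)); rewrite -!innerJ.
by rewrite innerDl innerZl !TE Bl.
Qed.

Lemma adj_exists G H (T : ell2 R G -> ell2 R H) (C : R) : 0 <= C -> linear T ->
  (forall f, nsq (T f) <= C * nsq f) ->
  exists S : ell2 R H -> ell2 R G, [/\ linear S, forall h, nsq (S h) <= C * nsq h &
    forall f h, inner (T f) h = inner f (S h)].
Proof.
move=> C0 lT hC.
have [|h|f a h k|h f|S [lS bS hS]] := @form_op H G (fun h f => (inner (T f) h)^*) C => //.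
- by move=> a x y; rewrite innerDr innerZr conjD conjM conjK.
- by rewrite lT innerDl innerZl conjD conjM.
- rewrite sqabsJ; apply: le_trans (cauchy_schwarz _ _) _.
  by rewrite mulrAC ler_wpM2r ?nsq_ge0.
by exists S; split=> // f h; rewrite [RHS]innerJ hS conjK.
Qed.

(** A relation rather than a function: it makes sense between two different spaces, and [adjointE]
    converts it to the chosen [adjoint] where the statement asks for it. *)
Definition isadj G H (T : ell2 R G -> ell2 R H) S :=
  isbop S /\ forall f h, inner (T f) h = inner f (S h).

Lemma isadj_exists G H (T : ell2 R G -> ell2 R H) : isbop T -> exists S, isadj T S.
Proof.
move=> [lT [C C0 hC]]; have [S [lS bS hS]] := adj_exists C0 lT hC.
by exists S; split=> //; split=> //; exists C.
Qed.

Lemma isadj_sym G H (T : ell2 R G -> ell2 R H) S : isbop T -> isadj T S -> isadj S T.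
Proof. by move=> bT [bS h]; split=> // f k; rewrite innerJ -h -innerJ. Qed.

Local Transparent adjoint.
Lemma adjointE G (T S : operator R G) : isadj T S -> adjoint T = S.
Proof.
move=> [bS hS]; rewrite /adjoint; case: xgetP => [S' _ [_ h]|h].
  apply/funext => f; apply: inner_ext => k; by rewrite -h hS.
by exfalso; apply: (h S); split=> //; apply/isbop_bounded.
Qed.

Local Opaque adjoint.

Lemma adjointP G (T : operator R G) : isbop T -> isadj T (adjoint T).
Proof. by move=> /isadj_exists[S hS]; rewrite (adjointE hS). Qed.

(** If [S] is the adjoint of [A], then the squared norm of [S (A f) - f] is at most
    [nsq f - 2 * nsq f + nsq f = 0]. *)
Lemma contraction_fix G (H : choiceType) (A : ell2 R G -> ell2 R H) f :
  linear A -> (forall f, nsq (A f) <= nsq f) -> nsq (A f) = nsq f ->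
  forall h, inner (A f) (A h) = inner f h.
Proof.
move=> lA bA Af h.
have bA' k : nsq (A k) <= 1 * nsq k by rewrite mul1r.
have [S [lS bS hS]] := adj_exists ler01 lA bA'.
have e : S (A f) = f.
  apply/subr0_eq/nsq_le0; rewrite nsqB ReinnerC -hS -nsq_Re Af.
  by have := bS (A f); rewrite Af; lra.
by rewrite -[in RHS]e innerJ hS -innerJ.
Qed.

(* Analysis operator of a family of vectors; a junk value unless the
   coefficients are square-summable. *)
Definition coefs G I (b : I -> ell2 R G) (f : ell2 R G) : ell2 R I :=
  toell2 (fun i => inner f (b i)).

Definition orthofam G I (b : I -> ell2 R G) :=
  forall i j, inner (b i) (b j) = (i == j)%:R.

Lemma bessel G (I : eqType) (b : I -> ell2 R G) (s : seq I) f : uniq s ->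
  (forall i j, i \in s -> j \in s -> inner (b i) (b j) = (i == j)%:R) ->
  \sum_(i <- s) sqabs (inner f (b i)) <= nsq f.
Proof.
move=> us ob; have e1 : inner f (\sum_(i <- s) inner f (b i) *: b i) =
    (\sum_(i <- s) sqabs (inner f (b i)))%:C.
  rewrite inner_sumr rmorph_sum; apply: eq_bigr => i _.
  by rewrite innerZr mulrC sqabsE.
have e2 : nsq (\sum_(i <- s) inner f (b i) *: b i) =
    \sum_(i <- s) sqabs (inner f (b i)).
  rewrite nsq_Re inner_suml Re_sum big_seq [RHS]big_seq; apply: eq_bigr => i si.
  rewrite innerZl inner_sumr (bigD1_seq i)//= innerZr ob// eqxx mulr1.
  rewrite big_seq_cond big1 ?addr0 ?sqabsE// => j /andP[js ji].
  by rewrite innerZr ob// eq_sym (negPf ji) mulr0.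
have := nsq_ge0 (f - \sum_(i <- s) inner f (b i) *: b i).
by rewrite nsqB e1 e2 /=; lra.
Qed.

Section coefs.
Variables (G I : choiceType) (b : I -> ell2 R G).
Hypothesis ob : orthofam b.

Lemma coefsE f i : coefs b f i = inner f (b i).
Proof.
by rewrite /coefs toell2E//; apply: (ell2_memP (C := nsq f)) => s us; apply: bessel.
Qed.

Lemma nsq_coefs_le f : nsq (coefs b f) <= nsq f.
Proof.
by apply/nsq_leP => s us; under eq_bigr do rewrite coefsE; apply: bessel.
Qed.

Lemma linear_coefs : linear (coefs b).
Proof.
by move=> a f h; apply: ell2P => i; rewrite !ell2E !coefsE innerDl innerZl.
Qed.

Lemma isbop_coefs : isbop (coefs b).
Proof.
split; first exact: linear_coefs.
by exists 1 => // f; rewrite mul1r nsq_coefs_le.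
Qed.

End coefs.

(** Completeness is expressed by Parseval's identity. *)
Definition isonb G I (b : I -> ell2 R G) := orthofam b /\
  forall f h, inner (coefs b f) (coefs b h) = inner f h.

(** The analysis operator is a contraction by Bessel, so [contraction_fix] extends the preservation
    of norm from the deltas to all inner products. *)
Lemma isonbP G I (b : I -> ell2 R G) : orthofam b ->
  (forall x, nsq (coefs b (delta R x)) = 1) -> isonb b.
Proof.
move=> ob h1; split=> // f h.
have cf x := contraction_fix (linear_coefs ob) (nsq_coefs_le ob)
  (etrans (h1 x) (esym (nsq_delta R x))).
have b1 := isbop_functional (coefs b h) (isbop_coefs ob).
exact: (bfunctional_ext b1 (bfunctional_inner h) (fun x => cf x h)).
Qed.

Lemma onb_nsq G I (b : I -> ell2 R G) f : isonb b -> nsq (coefs b f) = nsq f.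
Proof. by move=> [_ h]; rewrite !nsq_Re h. Qed.

Lemma onb_ext G I (b : I -> ell2 R G) f h : isonb b ->
  (forall i, inner f (b i) = inner h (b i)) -> f = h.
Proof.
move=> ob e; apply/eqP; rewrite -subr_eq0; apply/eqP/nsq_eq0.
rewrite -(onb_nsq _ ob) (_ : coefs b _ = 0) ?nsq0//; apply: ell2P => i.
by rewrite (coefsE ob.1) innerBl e subrr.
Qed.

Lemma isonb_delta G : isonb (@delta R G).
Proof.
have ob : orthofam (@delta R G) by move=> i j; rewrite inner_delta deltaE eq_sym.
have e (f : ell2 R G) : coefs (@delta R G) f = f.
  by apply: ell2P => i; rewrite coefsE// inner_delta.
by split=> // f h; rewrite !e.
Qed.

Lemma isonb_unitary G I (b : I -> ell2 R G) (U V : operator R G) :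
  isonb b -> (forall f h, inner (U f) h = inner f (V h)) ->
  cancel U V -> cancel V U -> isonb (fun i => U (b i)).
Proof.
move=> ob UV UK VK.
have ob' : orthofam (fun i => U (b i)).
  by move=> i j; rewrite UV UK ob.1.
have e f : coefs (fun i => U (b i)) f = coefs b (V f).
  apply: ell2P => i; rewrite (coefsE ob') (coefsE ob.1).
  by rewrite innerJ UV -innerJ.
by split=> // f h; rewrite !e ob.2 innerJ -UV VK -innerJ.
Qed.

(* The rank-one operator xi eta^*, as a Hilbert-Schmidt kernel. *)
Definition tens G H (xi : ell2 R G) (eta : ell2 R H) : ell2 R (G * H)%type :=
  toell2 (fun p => xi p.1 * (eta p.2)^*).

Section tens.
Variables (G H : choiceType).
Implicit Types (x : ell2 R G) (y : ell2 R H).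

Lemma esum_tens x y :
  (\esum_(p in [set: G * H]) (sqabs (x p.1 * (y p.2)^*))%:E = (nsq x * nsq y)%:E)%E.
Proof.
have e1 : (\esum_(p in [set: G * H]) (sqabs (x p.1 * (y p.2)^*))%:E =
   \esum_(g in [set: G]) \esum_(h in [set: H]) (sqabs (x g * (y h)^*))%:E)%E.
  rewrite esum_esum => [|i j _ _]; last by rewrite lee_fin sqabs_ge0.
  by congr (esum _ _); apply/seteqP; split.
have aux (c : R) (K : choiceType) (a : K -> R) (q : R) : 0 <= c -> (forall k, 0 <= a k) ->
   (\esum_(k in [set: K]) (a k)%:E = q%:E)%E ->
   (\esum_(k in [set: K]) (c * a k)%:E = (c * q)%:E)%E.
  move=> c0 a0 aq; have sa : asummable a.
    rewrite /asummable -(@eq_esum _ _ _ (fun k => (a k)%:E)) ?aq ?ltry// => k _.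
    by rewrite ger0_norm.
  rewrite ge0_esum_fin; last 2 first.
  - by move=> k; rewrite mulr_ge0.
  - exact: asummableZ.
  by rewrite fine_esumZ// aq.
rewrite e1 (@eq_esum _ _ _ _ (fun g => (nsq y * sqabs (x g))%:E)) => [|g _].
  by rewrite (aux _ _ _ (nsq x)) ?nsq_ge0// ?nsqE 1?mulrC// => k; exact: sqabs_ge0.
rewrite [in RHS]mulrC -(aux _ _ _ _ _ _ (nsqE y)) ?sqabs_ge0// => [|k]; last exact: sqabs_ge0.
by apply: eq_esum => h _; rewrite sqabsM sqabsJ.
Qed.

Lemma tens_mem x y : ((fun p => x p.1 * (y p.2)^*) : G * H -> R[i]^o)
   \in @square_summable R (G * H)%type.
Proof. by apply/square_summableP; rewrite esum_tens ltry. Qed.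

Lemma tensE x y p : tens x y p = x p.1 * (y p.2)^*.
Proof. by rewrite /tens toell2E// tens_mem. Qed.

Lemma nsq_tens x y : nsq (tens x y) = nsq x * nsq y.
Proof.
apply: EFin_inj; rewrite -nsqE -esum_tens; apply: eq_esum => p _.
by rewrite tensE.
Qed.

Lemma tens_delta g h : tens (delta R g) (delta R h) = delta R ((g, h) : (G * H)%type).
Proof.
apply: ell2P => -[g' h']; rewrite tensE !deltaE /= xpair_eqE.
by case: eqP; case: eqP; rewrite ?conj0 ?conj1 ?mulr0 ?mulr1.
Qed.

Lemma tensDl x x' y : tens (x + x') y = tens x y + tens x' y.
Proof. by apply: ell2P => p; rewrite ell2DE !tensE ell2DE mulrDl. Qed.
Lemma tensZl a x y : tens (a *: x) y = a *: tens x y.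
Proof. by apply: ell2P => p; rewrite ell2ZE !tensE ell2ZE mulrA. Qed.
Lemma tensDr x y y' : tens x (y + y') = tens x y + tens x y'.
Proof. by apply: ell2P => p; rewrite ell2DE !tensE ell2DE conjD mulrDr. Qed.
Lemma tensZr a x y : tens x (a *: y) = a^* *: tens x y.
Proof. by apply: ell2P => p; rewrite ell2ZE !tensE ell2ZE conjM mulrCA. Qed.

Lemma inner_tens x y x' y' :
  inner (tens x y) (tens x' y') = inner x x' * inner y' y.
Proof.
have b1 g : bfunctional (fun y' => inner (tens x y) (tens (delta R g) y')).
  split=> [a h k|]; first by rewrite tensDr tensZr innerDr innerZr conjK.
  exists (nsq (tens x y)) => f; apply: le_trans (cauchy_schwarz _ _) _.
  by rewrite (nsq_tens (delta R g)) nsq_delta mul1r.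
have b2 (c : R[i]) : bfunctional (fun y' => c * inner y' y).
  split=> [a h k|]; first by rewrite innerDl innerZl mulrDr mulrCA.
  exists (sqabs c * nsq y) => f; rewrite sqabsM -mulrA ler_wpM2l ?sqabs_ge0//.
  by rewrite mulrC cauchy_schwarz.
have e1 g h : inner (tens x y) (tens (delta R g) h) = x g * inner h y.
  apply: (bfunctional_ext (b1 g) (b2 (x g))) => k.
  by rewrite tens_delta inner_delta tensE /= delta_inner.
have b3 : bfunctional (fun x' => inner (tens x' y') (tens x y)).
  split=> [a h k|]; first by rewrite tensDl tensZl innerDl innerZl.
  exists (nsq y' * nsq (tens x y)) => f; apply: le_trans (cauchy_schwarz _ _) _.
  by rewrite nsq_tens; rewrite mulrAC [leRHS]mulrC mulrA mulrAC.
have b4 : bfunctional (fun x' => (inner y' y)^* * inner x' x).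
  split=> [a h k|]; first by rewrite innerDl innerZl mulrDr mulrCA.
  exists (sqabs (inner y' y)^* * nsq x) => f; rewrite sqabsM -mulrA ler_wpM2l ?sqabs_ge0//.
  by rewrite mulrC cauchy_schwarz.
rewrite innerJ (bfunctional_ext b3 b4).
  by rewrite conjM conjK -innerJ mulrC.
by move=> g; rewrite innerJ e1 conjM delta_inner mulrC.
Qed.

End tens.

Lemma tens_onb G H I J (b : I -> ell2 R G) (c : J -> ell2 R H) :
  isonb b -> isonb c -> isonb (fun p : I * J => tens (b p.1) (c p.2)).
Proof.
move=> ob oc; have o : orthofam (fun p : I * J => tens (b p.1) (c p.2)).
  move=> [i j] [i' j']; rewrite inner_tens /= ob.1 oc.1 xpair_eqE (eq_sym j').
  by case: eqP; case: eqP; rewrite ?mulr0 ?mulr1.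
apply: isonbP => // -[g h].
rewrite (_ : coefs _ _ = tens (coefs b (delta R g)) (coefs c (delta R h))).
  by rewrite nsq_tens !onb_nsq// !nsq_delta mulr1.
apply: ell2P => -[i j]; rewrite coefsE// tensE (coefsE ob.1) (coefsE oc.1) /=.
by rewrite -tens_delta inner_tens -innerJ.
Qed.

End operators.

Lemma isadj_comp (R : realType) (G H I : choiceType)
    (S : ell2 R H -> ell2 R I) S' (T : ell2 R G -> ell2 R H) T' :
  isadj S S' -> isadj T T' -> isadj (S \o T) (T' \o S').
Proof.
move=> [bS hS] [bT hT]; split; first exact: isbop_comp.
by move=> f h; rewrite /= hS hT.
Qed.

(** Polarization turns the invariance of the norm of [W] under [U] into the invariance of its Gram
    form; moving [U] across the inner product gives the commutation. *)
Lemma gram_commute (R : realType) (G H : choiceType)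
    (W : ell2 R H -> ell2 R G) W' (U V : operator R H) :
  isadj W W' -> isbop W -> isbop U -> (forall f h, inner (U f) h = inner f (V h)) ->
  cancel V U -> (forall f, nsq (W (U f)) = nsq (W f)) ->
  forall f, W' (W (U f)) = U (W' (W f)).
Proof.
move=> WW' bW bU UV VK iso f; apply: inner_ext => h.
have e : inner h (U (W' (W f))) = inner (W (V h)) (W f).
  by rewrite innerJ UV -innerJ -(WW'.2 (V h)).
rewrite e -(WW'.2 h) -{1}(VK h); apply: polar => z.
have lW := bW.1; have lU := bU.1.
by rewrite -!(bopZ lW) -!(bopD lW) -(bopZ lU) -(bopD lU) iso.
Qed.

(** * Weak limits *)

Section ultralimits.
Import numFieldNormedType.Exports.
Variable R : realType.

Lemma ultra_exists : exists F : set_system nat, UltraFilter F /\ \oo `<=` F.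
Proof. exact: ultraFilterLemma. Qed.

(** Along a free ultrafilter every bounded sequence converges, so one filter serves all inner
    products at once and no subsequences are extracted. *)
Definition ultra : set_system nat := projT1 (cid ultra_exists).

Local Instance ultra_ultra : UltraFilter ultra.
Proof. by rewrite /ultra; case: cid => F []. Qed.

Lemma eventually_ultra : \oo `<=` ultra.
Proof. by rewrite /ultra; case: cid => F []. Qed.

Lemma ultra_eventually (P : nat -> Prop) N : (forall n, (N <= n)%N -> P n) ->
  \forall n \near ultra, P n.
Proof. by move=> h; apply: eventually_ultra; exists N. Qed.

Lemma bounded_ucvg (x : nat -> R) (C : R) : (forall n, `|x n| <= C) ->
  exists l : R, x @ ultra --> l.
Proof.
move=> hx; have := @segment_compact R (- C) C => /(_ (fmap x ultra) _).
case=> [|p [_ hp]].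
  apply: (ultra_eventually (N := 0)) => n _.
  by rewrite /= in_itv /= -ler_norml.
exists p => A pA; have [//|h] := in_ultra_setVsetC (x @^-1` A) ultra_ultra.
by have [y [/= hy /hy]] := hp (~` A) A h pA.
Qed.

Implicit Types (z w : nat -> R[i]) (l : R[i]).

Definition ucvg z l := (fun n => complex.Re (z n)) @ ultra --> complex.Re l /\
  (fun n => complex.Im (z n)) @ ultra --> complex.Im l.

Lemma ucvg_exists z C : (forall n, sqabs (z n) <= C) -> exists l, ucvg z l.
Proof.
move=> hz; have h n : normc (z n) <= Num.sqrt C.
  rewrite -[leLHS]ger0_norm ?normc_ge0// -sqrtr_sqr ler_wsqrtr//.
  by rewrite -sqabs_normc.
have [a ha] := @bounded_ucvg (fun n => complex.Re (z n)) (Num.sqrt C)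
  (fun n => le_trans (ler_norm_Re _) (h n)).
have [b hb] := @bounded_ucvg (fun n => complex.Im (z n)) (Num.sqrt C)
  (fun n => le_trans (ler_norm_Im _) (h n)).
by exists (Complex a b).
Qed.

Lemma ucvg_unique z l l' : ucvg z l -> ucvg z l' -> l = l'.
Proof.
move=> [h1 h2] [h1' h2']; apply: complexP.
  exact: (cvg_unique (@norm_hausdorff _ _) h1 h1').
exact: (cvg_unique (@norm_hausdorff _ _) h2 h2').
Qed.

Lemma ucvg_cst l : ucvg (fun=> l) l.
Proof. by split; apply: cvg_cst. Qed.

Lemma eq_ucvg z w l : z =1 w -> ucvg z l -> ucvg w l.
Proof. by move=> /funext ->. Qed.

Lemma ucvgD z w l l' : ucvg z l -> ucvg w l' -> ucvg (fun n => z n + w n) (l + l').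
Proof.
move=> [h1 h2] [h1' h2']; split.
  by rewrite ReD; under eq_fun do rewrite ReD; apply: cvgD.
by rewrite ImD; under eq_fun do rewrite ImD; apply: cvgD.
Qed.

Lemma ucvgM z w l l' : ucvg z l -> ucvg w l' -> ucvg (fun n => z n * w n) (l * l').
Proof.
move=> [h1 h2] [h1' h2']; split.
  by rewrite cReM; under eq_fun do rewrite cReM; apply: cvgB; apply: cvgM.
by rewrite cImM; under eq_fun do rewrite cImM; apply: cvgD; apply: cvgM.
Qed.

Lemma ucvgZ a z l : ucvg z l -> ucvg (fun n => a * z n) (a * l).
Proof. exact/ucvgM/ucvg_cst. Qed.

Lemma ucvgJ z l : ucvg z l -> ucvg (fun n => (z n)^*) (l^*).
Proof.
move=> [h1 h2]; split.
  by rewrite ReJ; under eq_fun do rewrite ReJ.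
by rewrite ImJ; under eq_fun do rewrite ImJ; apply: cvgN.
Qed.

Lemma ucvgB z w l l' : ucvg z l -> ucvg w l' -> ucvg (fun n => z n - w n) (l - l').
Proof.
move=> h /(ucvgZ (-1)) h'; rewrite -mulN1r.
by apply: (eq_ucvg _ (ucvgD h h')) => n; rewrite mulN1r.
Qed.

Lemma ucvg_sum I (r : seq I) (z : I -> nat -> R[i]) (l : I -> R[i]) :
  (forall i, ucvg (z i) (l i)) ->
  ucvg (fun n => \sum_(i <- r) z i n) (\sum_(i <- r) l i).
Proof.
move=> h; elim: r => [|i r IH].
  by rewrite big_nil; apply: (eq_ucvg _ (ucvg_cst 0)) => n; rewrite big_nil.
rewrite big_cons; apply: (eq_ucvg _ (ucvgD (h i) IH)) => n.
by rewrite big_cons.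
Qed.

Lemma ucvg_Re_le z l C N : (forall n, (N <= n)%N -> complex.Re (z n) <= C) ->
  ucvg z l -> complex.Re l <= C.
Proof.
move=> h [h1 _]; apply: cvgr_to_le h1 _; exact: ultra_eventually h.
Qed.

Lemma ucvg_Re_ge z l C N : (forall n, (N <= n)%N -> C <= complex.Re (z n)) ->
  ucvg z l -> C <= complex.Re l.
Proof.
move=> h [h1 _]; apply: cvgr_to_ge h1 _; exact: ultra_eventually h.
Qed.

Lemma ucvg_sqabs_le z l C N : (forall n, (N <= n)%N -> sqabs (z n) <= C) ->
  ucvg z l -> sqabs l <= C.
Proof.
move=> h hz; have : ucvg (fun n => z n * (z n)^*) (l * l^*).
  by apply: ucvgM => //; apply: ucvgJ.
move=> /(@ucvg_Re_le _ _ C N); rewrite sqabsE; apply=> n Nn.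
by rewrite sqabsE h.
Qed.

Lemma ucvg_small z l :
  (forall e, 0 < e -> exists N, forall n, (N <= n)%N -> sqabs (z n - l) <= e) ->
  ucvg z l.
Proof.
move=> h; have H (x : nat -> R) a :
    (forall n, `|a - x n| <= normc (z n - l)) -> x @ ultra --> a.
  move=> hx; apply/cvgrPdist_le => e e0.
  have [N hN] := h _ (exprn_gt0 2 e0); apply: (ultra_eventually (N := N)) => n Nn.
  apply: le_trans (hx n) _; rewrite -(@ler_pXn2r _ 2) ?nnegrE ?normc_ge0 ?(ltW e0)//.
  by rewrite -sqabs_normc hN.
split; apply: H => n.
  by rewrite distrC -ReB ler_norm_Re.
by rewrite distrC -ImN -ImD ler_norm_Im.
Qed.

Section weak.
Variables (G : choiceType).

(** The limits of the inner products form a bounded functional, up to conjugation, and [riesz]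
    represents it. *)
Lemma wlim (f : nat -> ell2 R G) C : (forall n, nsq (f n) <= C) ->
  exists f', nsq f' <= C /\ forall h, ucvg (fun n => inner (f n) h) (inner f' h).
Proof.
move=> hf; have C0 : 0 <= C by apply: le_trans (hf 0%N); exact: nsq_ge0.
have bd h n : sqabs (inner (f n) h) <= C * nsq h.
  by apply: le_trans (cauchy_schwarz _ _) _; rewrite ler_wpM2r ?nsq_ge0.
have /choice [L hL] h : exists l, ucvg (fun n => inner (f n) h) l.
  by apply: (ucvg_exists (C := C * nsq h)) => n; exact: bd.
have [|a h k|h|v [hv vC]] := @riesz _ _ (fun h => (L h)^*) C => //.
- rewrite -[a in RHS]conjK -conjM -conjD; congr (_^*)%C.
  apply: (ucvg_unique (hL _)).
  apply: (eq_ucvg _ (ucvgD (ucvgZ a^* (hL h)) (hL k))) => n.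
  by rewrite innerDr innerZr.
- rewrite sqabsJ; apply: (ucvg_sqabs_le (N := 0)) (hL h) => n _; exact: bd.
exists v; split=> // h; rewrite innerJ -hv conjK; exact: hL.
Qed.

End weak.

Lemma wlim_op (G H : choiceType) (T : nat -> ell2 R G -> ell2 R H) C : 0 <= C ->
  (forall n, linear (T n)) -> (forall n f, nsq (T n f) <= C * nsq f) ->
  exists T', [/\ linear T', forall f, nsq (T' f) <= C * nsq f &
    forall f h, ucvg (fun n => inner (T n f) h) (inner (T' f) h)].
Proof.
move=> C0 lT bT.
have /choice [T' hT'] f := @wlim H (fun n => T n f) (C * nsq f) (fun n => bT n f).
exists T'; split=> [a f h|f|f]; [|exact: (hT' f).1|exact: (hT' f).2].
apply: inner_ext => k; rewrite innerJ [RHS]innerJ; congr (_^*)%C.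
apply: (ucvg_unique ((hT' _).2 k)).
rewrite innerDl innerZl.
apply: (eq_ucvg _ (ucvgD (ucvgZ a ((hT' f).2 k)) ((hT' h).2 k))) => n.
by rewrite lT innerDl innerZl.
Qed.

(** Entries of the tensors are products of converging entries, and a bounded sequence has a weak
    limit, which its entries determine. *)
Lemma wlim_tens (G H : choiceType) (f : nat -> ell2 R G) f' (h : nat -> ell2 R H) h' C D K :
  (forall n, nsq (f n) <= C) -> (forall n, nsq (h n) <= D) ->
  (forall k, ucvg (fun n => inner (f n) k) (inner f' k)) ->
  (forall k, ucvg (fun n => inner (h n) k) (inner h' k)) ->
  ucvg (fun n => inner (tens (f n) (h n)) K) (inner (tens f' h') K).
Proof.
move=> fC hD ff' hh'.
have [|Z [_ hZ]] := @wlim _ (fun n => tens (f n) (h n)) (C * D).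
  by move=> n; rewrite nsq_tens ler_pM ?nsq_ge0.
suff -> : tens f' h' = Z by exact: hZ.
apply: ell2P => -[x y]; rewrite -[RHS]inner_delta tensE /=.
apply: (ucvg_unique _ (hZ _)).
rewrite -[f' x]inner_delta -[h' y]inner_delta.
apply: (eq_ucvg _ (ucvgM (ff' _) (ucvgJ (hh' _)))) => n.
by rewrite !inner_delta tensE.
Qed.

End ultralimits.

(** * Convolution operators *)

Section group.
Variables (R : realType) (G : groupType).
Implicit Types (f h : ell2 R G) (s t x : G) (A B : operator R G).

Local Opaque ell2_norm.

Lemma lregE s f x : lreg R s f x = f (s^-1 * x)%g. Proof. by []. Qed.

Lemma nsq_lreg s f : nsq (lreg R s f) = nsq f.
Proof.
apply: EFin_inj; rewrite -!nsqE.
rewrite (@reindex_esum _ _ _ setT setT (fun g => s^-1 * g)%g (fun g => (sqabs (f g))%:E))//.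
by split=> // [x y _ _ /mulgI//|x _]; exists (s * x)%g => //; rewrite mulKg.
Qed.

Lemma linear_lreg s : linear (lreg R s : operator R G).
Proof. by move=> a f h; apply: ell2P. Qed.

Lemma isbop_isometry (T : operator R G) : linear T ->
  (forall f, nsq (T f) = nsq f) -> isbop T.
Proof. by move=> lT h; split=> //; exists 1 => // f; rewrite mul1r h. Qed.

Lemma isbop_lreg s : isbop (lreg R s : operator R G).
Proof. by apply: isbop_isometry (linear_lreg s) (nsq_lreg s). Qed.

Lemma lreg_comp s t f : lreg R s (lreg R t f) = lreg R (s * t)%g f.
Proof. by apply: ell2P => x; rewrite !lregE invgM mulgA. Qed.

Lemma lreg_id f : lreg R 1%g f = f.
Proof. by apply: ell2P => x; rewrite lregE invg1 mul1g. Qed.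

Lemma lreg_delta s x : lreg R s (delta R x) = delta R (s * x)%g.
Proof.
apply: ell2P => g; rewrite lregE !deltaE; congr (_%:R).
by rewrite (can2_eq (mulVKg s) (mulKg s)).
Qed.

Definition rtr t f : ell2 R G := toell2 (fun x => f (x * t)%g).

Lemma rtrE t f x : rtr t f x = f (x * t)%g.
Proof.
rewrite /rtr toell2E//; apply/square_summableP.
have /square_summableP := ell2_mem f; congr (_ < _)%E.
apply: (@reindex_esum _ _ _ setT setT (fun g => g * t)%g).
by split=> // [y z _ _ /mulIg//|y _]; exists (y * t^-1)%g => //; rewrite mulgVK.
Qed.

Lemma nsq_rtr t f : nsq (rtr t f) = nsq f.
Proof.
apply: EFin_inj; rewrite -!nsqE.
rewrite (@reindex_esum _ _ _ setT setT (fun g => g * t)%g (fun g => (sqabs (f g))%:E)).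
  by apply: eq_esum => g _; rewrite rtrE.
by split=> // [y z _ _ /mulIg//|y _]; exists (y * t^-1)%g => //; rewrite mulgVK.
Qed.

Lemma linear_rtr t : linear (rtr t).
Proof. by move=> a f h; apply: ell2P => x; rewrite !ell2E !rtrE. Qed.

Lemma isbop_rtr t : isbop (rtr t).
Proof. by apply: isbop_isometry (linear_rtr t) (nsq_rtr t). Qed.

Lemma rtrM s t f : rtr s (rtr t f) = rtr (s * t)%g f.
Proof. by apply: ell2P => x; rewrite !rtrE mulgA. Qed.

Lemma rtr1 f : rtr 1%g f = f.
Proof. by apply: ell2P => x; rewrite rtrE mulg1. Qed.

Lemma rtr_delta t x : rtr t (delta R x) = delta R (x * t^-1)%g.
Proof.
apply: ell2P => g; rewrite rtrE !deltaE; congr (_%:R).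
by rewrite (can2_eq (mulgK t) (mulgVK t)).
Qed.

Lemma lreg_rtr s t f : lreg R s (rtr t f) = rtr t (lreg R s f).
Proof. by apply: ell2P => x; rewrite lregE !rtrE lregE mulgA. Qed.

Lemma isometry_inner (T : operator R G) : linear T ->
  (forall f, nsq (T f) = nsq f) -> forall f h, inner (T f) (T h) = inner f h.
Proof.
move=> lT iT f h; apply: contraction_fix => // k; by rewrite iT.
Qed.

Lemma inner_lreg s f h : inner (lreg R s f) h = inner f (lreg R s^-1%g h).
Proof.
rewrite -[RHS](isometry_inner (linear_lreg s) (nsq_lreg s)).
by rewrite lreg_comp mulgV lreg_id.
Qed.

Lemma inner_rtr t f h : inner (rtr t f) h = inner f (rtr t^-1%g h).
Proof.
rewrite -[RHS](isometry_inner (linear_rtr t) (nsq_rtr t)).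
by rewrite rtrM mulgV rtr1.
Qed.

Lemma delta_rtr x : delta R x = rtr x^-1%g (delta R 1%g).
Proof. by rewrite rtr_delta mul1g invgK. Qed.

Lemma delta_lreg x : delta R x = lreg R x (delta R 1%g).
Proof. by rewrite lreg_delta mulg1. Qed.

(** The commutant of the right translations. [groupvNP] identifies it with the bicommutant
    [groupvN]; this form is the one that can be checked on vectors. *)
Definition vn A := isbop A /\ forall t f, A (rtr t f) = rtr t (A f).

Lemma vn_delta A x : vn A -> A (delta R x) = rtr x^-1%g (A (delta R 1%g)).
Proof. by move=> [_ h]; rewrite delta_rtr h. Qed.

Lemma vn_deltaE A x y : vn A -> A (delta R x) y = A (delta R 1%g) (y * x^-1)%g.
Proof. by move=> vA; rewrite vn_delta// rtrE. Qed.

Lemma vn_adj A B : vn A -> isadj A B -> vn B.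
Proof.
move=> [bA hA] [bB hB]; split=> // t f; apply: inner_ext => k.
rewrite -(hB k (rtr t f)); have := inner_rtr t^-1%g k (B f); rewrite invgK => <-.
by rewrite -(hB _ f) hA inner_rtr invgK.
Qed.

Lemma vn_ext A B : vn A -> vn B -> A (delta R 1%g) = B (delta R 1%g) -> A = B.
Proof.
move=> vA vB e; apply: isbop_ext => [||x]; [exact: vA.1|exact: vB.1|].
by rewrite (vn_delta x vA) (vn_delta x vB) e.
Qed.

Lemma adj_deltaE A B x y : isadj A B ->
  B (delta R x) y = (A (delta R y) x)^*%C.
Proof. by move=> [_ h]; rewrite -inner_delta innerJ -h inner_delta. Qed.

(** In the delta basis the entries of [A] depend on [y * x^-1] and those of [z] on [x^-1 * y]; the
    two product entries at [(x, y)] are the same sum after a change of summation variable. *)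
Lemma vn_commute A z : vn A -> isbop z ->
  (forall s f, z (lreg R s f) = lreg R s (z f)) -> A \o z = z \o A.
Proof.
move=> vA bz hz.
have [A' hA] := isadj_exists vA.1; have [z' hz'] := isadj_exists bz.
have zE x y : z (delta R x) y = z (delta R 1%g) (x^-1 * y)%g.
  by rewrite delta_lreg hz lregE.
apply: (isbop_ext (isbop_comp vA.1 bz) (isbop_comp bz vA.1)) => x.
apply: ell2P => y; rewrite -!inner_delta /= (hA.2 (z _)) (hz'.2 (A _)) !innerE.
(* This substitution exchanges the quotients [y * r^-1] and [x^-1 * r] that occur in the two
   sums. *)
rewrite (@reindex_complex_sum _ _ _ (fun r => x * r^-1 * y)%g); last first.
  exists (fun r => y * r^-1 * x)%g => r.
    by rewrite !invgM invgK !mulgA mulgV mul1g mulgVK.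
  by rewrite !invgM invgK !mulgA mulgV mul1g mulgVK.
apply: eq_complex_sum => r /=.
rewrite (adj_deltaE _ _ hA) (adj_deltaE _ _ hz') !conjK mulrC.
rewrite (vn_deltaE (x / r * y)%g y vA) (zE x (x / r * y)%g) (vn_deltaE x r vA) (zE r y).
by rewrite !invgM invgK !mulgA mulgV mulVg !mul1g.
Qed.

Lemma groupvNP A : groupvN R G A <-> vn A.
Proof.
split=> [[/isbop_bounded bA hA]|vA]; split=> //.
- move=> t f; have /hA /(congr1 (fun T => T f)) // : commutant (range (@lreg R G)) (rtr t).
  split; first exact/isbop_bounded/isbop_rtr.
  by move=> _ [s _ <-]; apply/funext => k /=; rewrite lreg_rtr.
- exact/isbop_bounded/vA.1.
move=> S [/isbop_bounded bS hS]; apply: vn_commute => // s f.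
by have /hS /(congr1 (fun T => T f)) : range (@lreg R G) (lreg R s) by exists s.
Qed.

Lemma vn_comp A B : vn A -> vn B -> vn (A \o B).
Proof.
move=> [bA hA] [bB hB]; split=> [|t f /=]; first exact: isbop_comp.
by rewrite hB hA.
Qed.

Lemma vnD A B : vn A -> vn B -> vn (A + B).
Proof.
move=> [bA hA] [bB hB]; split=> [|t f /=]; first exact: isbopD.
by rewrite !opDE hB hA (bopD (linear_rtr t)).
Qed.

Lemma vnZ a A : vn A -> vn (a *: A).
Proof.
move=> [bA hA]; split=> [|t f /=]; first exact: isbopZ.
by rewrite !opZE hA (bopZ (linear_rtr t)).
Qed.

Lemma vnB A B : vn A -> vn B -> vn (A - B).
Proof. by move=> vA vB; rewrite -scaleN1r; apply: vnD => //; apply: vnZ. Qed.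

Lemma vn_id : vn idfun.
Proof. by split=> //; exact: isbop_id. Qed.

Lemma vn_lreg s : vn (lreg R s).
Proof. by split=> [|t f]; [exact: isbop_lreg|exact: lreg_rtr]. Qed.

Lemma vn_wlim (T : nat -> operator R G) T' : (forall n, vn (T n)) -> isbop T' ->
  (forall f h, ucvg (fun n => inner (T n f) h) (inner (T' f) h)) -> vn T'.
Proof.
move=> vT bT hT; split=> // t f; apply: inner_ext => k.
rewrite innerJ [RHS]innerJ; congr (_^*)%C.
apply: (ucvg_unique (hT _ _)); rewrite inner_rtr.
by apply: eq_ucvg (hT _ _) => n; rewrite (vT n).2 inner_rtr.
Qed.

(** Both sides are the sum over [r] of a coefficient of one vector at [r] times a coefficient of the
    other at [r^-1]. *)
Lemma trace_comm A B : vn A -> vn B ->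
  inner (A (B (delta R 1%g))) (delta R 1%g) = inner (B (A (delta R 1%g))) (delta R 1%g).
Proof.
move=> vA vB; have [A' hA] := isadj_exists vA.1; have [B' hB] := isadj_exists vB.1.
rewrite (hA.2 (B _)) (hB.2 (A _)) !innerE (@reindex_complex_sum _ _ _ (fun r : G => r^-1)%g); last first.
  by exists (fun r : G => r^-1)%g; exact: invgK.
apply: eq_complex_sum => r /=; rewrite (adj_deltaE _ _ hA) (adj_deltaE _ _ hB) !conjK.
by rewrite [A _ 1%g]vn_deltaE// [B _ 1%g]vn_deltaE// invgK !mul1g mulrC.
Qed.

Lemma trace_conj N U V : vn N -> vn U -> isadj U V -> cancel V U ->
  inner (N (U (delta R 1%g))) (U (delta R 1%g)) =
  inner (N (delta R 1%g)) (delta R 1%g).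
Proof.
move=> vN vU UV VK; have vV := vn_adj vU UV; have VU := isadj_sym vU.1 UV.
by rewrite -VU.2; have /= -> := trace_comm (vn_comp vV vN) vU; rewrite VK.
Qed.

End group.

(** For finitely supported vectors, a translate by [k] meets the other support only if
    [k = y * x^-1] with [x], [y] in the supports. Truncation at [e / (4 * C)] makes each of the two
    errors at most [e / 4], and [sqabsD] doubles both. *)
Lemma lreg_c0 (R : realType) (G : groupType) (f h : ell2 R G) (e : R) : 0 < e ->
  exists s : seq G, forall k, k \notin s -> sqabs (inner (lreg R k f) h) <= e.
Proof.
move=> e0; pose C := nsq f + nsq h + 1.
have C0 : 0 < C by rewrite ltr_wpDl// addr_ge0// nsq_ge0.
have e1 : 0 < e / (4 * C) by rewrite divr_gt0// mulr_gt0.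
have [s1 [us1]] := fin_approx f e1; set f' := \sum_(x <- s1) _ => hf.
have [s2 [us2]] := fin_approx h e1; set h' := \sum_(x <- s2) _ => hh.
exists [seq (y * x^-1)%g | y <- s2, x <- s1] => k ks.
have z : inner (lreg R k f') h' = 0.
  rewrite /f' (bop_sum (linear_lreg k)) inner_suml big_seq big1// => x xs.
  rewrite inner_sumr big_seq big1// => y ys.
  rewrite (bopZ (linear_lreg k)) innerZl innerZr lreg_delta inner_delta deltaE.
  have [kxy|] := eqVneq y (k * x)%g; last by rewrite !mulr0.
  by case/negP: ks; apply/allpairsP; exists (y, x); rewrite /= kxy mulgK; split=> //;
    rewrite -kxy.
have nf : nsq f' <= nsq f by rewrite nsq_sum_delta// sum_le_nsq.
have -> : inner (lreg R k f) h = inner (lreg R k (f - f')) h + inner (lreg R k f') (h - h').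
  rewrite (bopB (linear_lreg k)) innerBl innerBr z subr0; ring.
apply: le_trans (sqabsD _ _) _.
have a1 := cauchy_schwarz (lreg R k (f - f')) h.
have a2 := cauchy_schwarz (lreg R k f') (h - h').
rewrite !nsq_lreg in a1 a2.
have b1 : nsq (f - f') * nsq h <= e / (4 * C) * C.
  by apply: ler_pM; rewrite ?nsq_ge0 ?(ltW hf)// /C; have := nsq_ge0 f; lra.
have b2 : nsq f' * nsq (h - h') <= C * (e / (4 * C)).
  by apply: ler_pM; rewrite ?nsq_ge0 ?(ltW hh)// /C; have := nsq_ge0 h; lra.
have h4 : e / (4 * C) * C = e / 4.
  by rewrite invfM mulrA mulfVK// gt_eqF.
have : C * (e / (4 * C)) = e / 4 by rewrite mulrC.
move: a1 a2 b1 b2 h4; move: (e / (4 * C) * C) (C * (e / (4 * C))) => p q; lra.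
Qed.

(** * Norm estimates, Neumann series and resolvents *)

Section norms.
Import numFieldNormedType.Exports.
Variables (R : realType) (G : choiceType).
Implicit Types (f h : ell2 R G).

Local Notation nm := (@ell2_norm R G).

Lemma ell2_norm_ge0 f : 0 <= nm f.
Proof. exact: sqrtr_ge0. Qed.

Lemma normc_inner_le f h : normc (inner f h) <= nm f * nm h.
Proof.
rewrite -(@ler_pXn2r _ 2) ?nnegrE ?normc_ge0 ?mulr_ge0 ?ell2_norm_ge0//.
by rewrite exprMn !ell2_norm_sq -sqabs_normc cauchy_schwarz.
Qed.

Lemma Re_inner_le f h : complex.Re (inner f h) <= nm f * nm h.
Proof. exact: le_trans (le_Re_normc _) (normc_inner_le f h). Qed.

Lemma Re_inner_half f h : 2 * complex.Re (inner f h) <= nsq f + nsq h.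
Proof. by have := nsq_ge0 (f - h); rewrite nsqB; lra. Qed.

Lemma ell2_normD f h : nm (f + h) <= nm f + nm h.
Proof.
rewrite -(@ler_pXn2r _ 2) ?nnegrE ?addr_ge0 ?ell2_norm_ge0//.
rewrite sqrrD !ell2_norm_sq nsqD.
by have := Re_inner_le f h; lra.
Qed.

Lemma ell2_norm_le (b : R) f h : 0 <= b -> nsq f <= b ^+ 2 * nsq h -> nm f <= b * nm h.
Proof.
move=> b0 h2; rewrite -(@ler_pXn2r _ 2) ?nnegrE ?mulr_ge0 ?ell2_norm_ge0//.
by rewrite exprMn !ell2_norm_sq.
Qed.

Lemma geom_small (q c e : R) : 0 <= q -> q < 1 -> 0 <= c -> 0 < e ->
  exists N, forall n, (N <= n)%N -> q ^+ n * c <= e.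
Proof.
move=> q0 q1 c0 e0.
have /cvgrPdist_le/(_ (e / (c + 1))) : (fun n => q ^+ n) @ \oo --> (0 : R).
  by apply: cvg_expr; rewrite ger0_norm.
case=> [|N _ hN]; first by rewrite divr_gt0// ltr_wpDl.
exists N => n /hN /=; rewrite sub0r normrN ger0_norm ?exprn_ge0//.
rewrite ler_pdivlMr ?ltr_wpDl//; apply: le_trans.
by rewrite ler_wpM2l ?exprn_ge0// lerDl.
Qed.

Lemma wlim_nsq_le (f : nat -> ell2 R G) f' C N :
  (forall n, (N <= n)%N -> nsq (f n) <= C) ->
  (forall h, ucvg (fun n => inner (f n) h) (inner f' h)) -> nsq f' <= C.
Proof.
move=> hf /(_ f') /(@ucvg_Re_le _ _ _ ((C + nsq f') / 2) N).
rewrite -nsq_Re => h; suff : nsq f' <= (C + nsq f') / 2 by lra.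
apply: h => n Nn; have := Re_inner_half (f n) f'; have := hf n Nn; lra.
Qed.

Lemma isadj_bound (H : choiceType) (T : ell2 R G -> ell2 R H) S C : 0 <= C ->
  isadj T S ->
  (forall f, nsq (T f) <= C * nsq f) -> forall h : ell2 R H, nsq (S h) <= C * nsq h.
Proof.
move=> C0 TS hC h; have [Sh0|Sh0] := eqVneq (nsq (S h)) 0.
  by rewrite Sh0 mulr_ge0 ?nsq_ge0.
have Sp : 0 < nsq (S h) by rewrite lt_neqAle eq_sym Sh0 nsq_ge0.
have e : inner (T (S h)) h = (nsq (S h))%:C by rewrite TS.2 inner_nsq.
have := cauchy_schwarz (T (S h)) h; rewrite e sqabs_real expr2 => le1.
have := hC (S h) => le2.
have : nsq (S h) * nsq (S h) <= nsq (S h) * (C * nsq h).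
  apply: le_trans le1 _; rewrite mulrCA mulrA; apply: le_trans (ler_wpM2r _ le2) _.
    exact: nsq_ge0.
  by rewrite mulrAC.
by rewrite ler_pM2l.
Qed.

(** A positive operator of norm at most K satisfies S^2 <= K S. Here [K = (C + 1) / 2] dominates the
    square root of [C], and positivity is tested at [f - K^-1 S f]. *)
Lemma psd_bound (S : operator R G) : isbop S ->
  (forall f h, inner (S f) h = inner f (S h)) ->
  (forall f, 0 <= complex.Re (inner (S f) f)) ->
  exists2 K : R, 0 < K & forall f, nsq (S f) <= K * complex.Re (inner (S f) f).
Proof.
move=> [lS [C C0 hC]] hS pS; exists ((C + 1) / 2) => [|f]; first lra.
set K := (C + 1) / 2; have K0 : 0 < K by rewrite /K; lra.
have h1 : complex.Re (inner (S (S f)) (S f)) <= K * nsq (S f).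
  have := Re_inner_half (S (S f)) (S f); have := hC (S f); rewrite /K; lra.
have := pS (f - (K^-1)%:C *: S f).
rewrite (bopB lS) (bopZ lS) !(innerBl, innerBr, innerZl, innerZr) conj_real.
rewrite -[inner (S f) (S f)]/(inner (S f) (S f)) !ReB !ReZ.
rewrite (hS (S f) f) inner_nsq /= => h2.
have Ki : 0 < K^-1 by rewrite invr_gt0.
have h3 : K^-1 * (K^-1 * complex.Re (inner (S (S f)) (S f))) <= K^-1 * nsq (S f).
  rewrite ler_pM2l// -ler_pdivlMl ?invr_gt0// invrK//.
rewrite -ler_pdivrMl//; lra.
Qed.

End norms.

Section neumann.
Variables (R : realType) (G : groupType).
Implicit Types (f h : ell2 R G) (A S T : operator R G).

Lemma vn0 : vn (fun _ : ell2 R G => 0).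
Proof.
have -> : (fun _ : ell2 R G => 0 : ell2 R G) = 0 *: (@idfun (ell2 R G) : operator R G).
  by apply/funext => f; rewrite opZE scale0r.
exact/vnZ/vn_id.
Qed.

(** The partial sums [P n] of the Neumann series are bounded, and [T] is their weak limit, so that
    membership in the algebra follows from [vn_wlim]. *)
Lemma neumann A (b : R) : vn A -> 0 <= b -> b < 1 ->
  (forall f, nsq (A f) <= b ^+ 2 * nsq f) ->
  exists T, [/\ vn T, forall f, T f = f + A (T f) & forall f, A (T f) = T (A f)].
Proof.
move=> vA b0 b1 bA; have lA := vA.1.1.
have [A' hA'] := isadj_exists vA.1.
pose P := fix P n f : ell2 R G := if n is n'.+1 then f + A (P n' f) else 0.
have b1' : 0 < 1 - b by rewrite subr_gt0.
have vP n : vn (P n).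
  elim: n => [|n IH]; first exact: vn0.
  exact: (vnD (vn_id R G) (vn_comp vA IH)).
have bP n f : ell2_norm (P n f) <= (1 - b)^-1 * ell2_norm f.
  elim: n => [|n IH /=].
    rewrite (_ : ell2_norm _ = 0) ?mulr_ge0 ?ell2_norm_ge0 ?invr_ge0 ?ltW//.
    by apply/eqP; rewrite -sqrf_eq0 ell2_norm_sq nsq0.
  apply: le_trans (ell2_normD _ _) _.
  have := ell2_norm_le b0 (bA (P n f)); have := ell2_norm_ge0 f.
  move: IH; rewrite !ler_pdivlMl//; nra.
have bP2 n f : nsq (P n f) <= (1 - b) ^- 2 * nsq f.
  rewrite -!ell2_norm_sq -exprVn -exprMn lerXn2r ?nnegrE ?ell2_norm_ge0//.
  by rewrite mulr_ge0 ?ell2_norm_ge0 ?invr_ge0 ?ltW.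
have C0 : 0 <= (1 - b) ^- 2 by rewrite invr_ge0 exprn_ge0 ?ltW.
have [T [lT bT hT]] := wlim_op C0 (fun n => (vP n).1.1) bP2.
have isT : isbop T by split=> //; exists ((1 - b) ^- 2).
exists T; split=> [|f|f].
- exact: (vn_wlim vP isT hT).
- have bD n : nsq (P n.+1 f - P n f) <= (b ^+ 2) ^+ n * nsq f.
    elim: n => [|n IH]; first by rewrite /= (bop0 lA) addr0 subr0 mul1r.
    rewrite [P n.+2 f]/= [P n.+1 f in X in X <= _]/= opprD addrACA subrr add0r -(bopB lA).
    by apply: le_trans (bA _) _; rewrite [in leRHS]exprS -mulrA ler_wpM2l ?sqr_ge0.
  apply: inner_ext => k; rewrite innerJ [RHS]innerJ; congr (_^*)%C.
  rewrite innerDl hA'.2; apply: (ucvg_unique (hT f k)).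
  have h1 := ucvgD (ucvg_cst (inner f k)) (hT f (A' k)).
  suff h2 : ucvg (fun n => inner (P n.+1 f - P n f) k) 0.
    have := ucvgB h1 h2; rewrite subr0; apply: eq_ucvg => n.
    by rewrite innerBl /= innerDl (hA'.2 (P n f)); ring.
  apply: ucvg_small => e e0.
  have [||||N hN] := @geom_small R (b ^+ 2) (nsq f * nsq k) e => //.
  - exact: sqr_ge0.
  - by rewrite expr_lt1.
  - by rewrite mulr_ge0 ?nsq_ge0.
  exists N => n Nn; rewrite subr0; apply: le_trans (cauchy_schwarz _ _) _.
  apply: le_trans (hN n Nn); rewrite mulrA ler_wpM2r ?nsq_ge0//; exact: bD.
have comm n k : A (P n k) = P n (A k).
  by elim: n => [|n IH] /=; rewrite ?(bop0 lA)// (bopD lA) IH.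
apply: inner_ext => k; rewrite innerJ [RHS]innerJ; congr (_^*)%C.
apply: (ucvg_unique _ (hT (A f) k)); rewrite hA'.2.
by apply: eq_ucvg (hT f (A' k)) => n; rewrite -comm hA'.2.
Qed.

(** With [e = (1 + K)^-1] one has [e (1 + S) = 1 - A], where [A] has norm at most [1 - e] by
    [psd_bound]; the inverse of [1 + S] is [e] times the Neumann series of [A]. *)
Lemma resolvent S : vn S ->
  (forall f h, inner (S f) h = inner f (S h)) ->
  (forall f, 0 <= complex.Re (inner (S f) f)) ->
  exists T, [/\ vn T, forall f, T f + S (T f) = f & forall f, T f + T (S f) = f].
Proof.
move=> vS hS pS; have [K K0 hK] := psd_bound vS.1 hS pS; have lS := vS.1.1.
pose e := (1 + K)^-1; have e0 : 0 < e by rewrite invr_gt0 addr_gt0.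
have eE : e * (1 + K) = 1 by rewrite mulVf// gt_eqF ?addr_gt0.
pose A : operator R G := (1 - e)%:C *: idfun - e%:C *: S.
have vA : vn A by apply: vnB; apply: vnZ => //; exact: vn_id.
have AE f : A f = (1 - e)%:C *: f - e%:C *: S f by [].
have e1 : e < 1 by nra.
have [|||f|T [vT hT1 hT2]] := @neumann A (1 - e) => //; [lra|lra| |].
  rewrite AE nsqB !nsqZ !sqabs_real innerZl innerZr conj_real !ReZ ReinnerC.
  have := hK f; have := pS f; move: (complex.Re _) (nsq (S f)) => p q p0 qK.
  have : e ^+ 2 * q <= e ^+ 2 * (K * p) by rewrite ler_wpM2l// sqr_ge0.
  have : e * (K * p) <= 2 * (1 - e) * p.
    suff : e * K <= 2 * (1 - e) by rewrite mulrA; nra.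
    nra.
  nra.
have en0 : (e%:C : R[i]) != 0 by rewrite eq_complex /= gt_eqF.
have key f g : T f = f + ((1 - e)%:C *: T f - e%:C *: g) -> e%:C *: (T f + g) = f.
  move=> /(congr1 (fun k : ell2 R G => k)) h; apply: ell2P => x.
  have := congr1 (fun k : ell2 R G => k x) h; rewrite !ell2E => hx.
  rewrite -[RHS](addrK ((1 - e)%:C * T f x - e%:C * g x)) -hx rmorphB rmorph1.
  by ring.
exists (e%:C *: T); split=> [|f|f]; first exact: vnZ.
  by rewrite !opZE (bopZ lS) -scalerDr; apply: key; rewrite {1}hT1 AE.
rewrite !opZE -scalerDr; apply: key.
by rewrite {1}hT1 hT2 AE (bopB vT.1.1) !(bopZ vT.1.1).
Qed.

End neumann.

(** Pair [T n] with the limit itself: if S is the sum for [T'], the inner products converge to S and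
    are at most [(C + S) / 2], hence S <= C. *)
Lemma wlim_sum_nsq_le (R : realType) (G H : choiceType)
    (T : nat -> ell2 R G -> ell2 R H) T' (I : Type) (s : seq I) (t : I -> ell2 R G) C N :
  (forall f h, ucvg (fun n => inner (T n f) h) (inner (T' f) h)) ->
  (forall n, (N <= n)%N -> \sum_(y <- s) nsq (T n (t y)) <= C) ->
  \sum_(y <- s) nsq (T' (t y)) <= C.
Proof.
move=> hT hC; set S := \sum_(y <- s) _.
have h := ucvg_sum s (fun y => hT (t y) (T' (t y))).
have : complex.Re (\sum_(y <- s) inner (T' (t y)) (T' (t y))) <= 2^-1 * (C + S).
  apply: (@ucvg_Re_le _ _ _ _ N) h => n Nn; rewrite Re_sum.
  apply: (@le_trans _ _ (\sum_(y <- s) 2^-1 * (nsq (T n (t y)) + nsq (T' (t y))))).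
    by apply: ler_sum => y _; have := Re_inner_half (T n (t y)) (T' (t y)); lra.
  rewrite -mulr_sumr big_split /=; have := hC n Nn; rewrite -/S; lra.
rewrite Re_sum; under eq_bigr do rewrite -nsq_Re.
rewrite -/S; lra.
Qed.

(** * Isomorphisms preserve the trace *)

Lemma infinite_set_seq (T : choiceType) (A : set T) n : infinite_set A ->
  exists s : seq T, [/\ uniq s, forall x, x \in s -> A x & (n <= size s)%N].
Proof.
move=> /(@infinite_set_fset _ _ n) [B BA nB]; exists (finmap.enum_fset B).
by split=> //; exact: finmap.fset_uniq.
Qed.

Section conj_invariant.
Variables (R : realType) (G : groupType).

(** The modulus would take one nonzero value on an infinite conjugacy class, which
    square-summability forbids. *)
Lemma icc_ell2_eq0 (f : ell2 R G) (x : G) : icc G -> x <> 1%g ->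
  (forall g, sqabs (f (x ^ g)%g) = sqabs (f x)) -> f x = 0.
Proof.
move=> iG x1 hf; apply: contrapT => /eqP; rewrite -sqabs_eq0 => fx.
have fx0 : 0 < sqabs (f x) by rewrite lt_neqAle eq_sym fx sqabs_ge0.
pose n := (Num.truncn (nsq f / sqabs (f x))).+1.
have [B [uB hB hn]] := @infinite_set_seq _ _ n (iG x x1).
have := sum_le_nsq f uB.
rewrite big_seq (eq_bigr (fun=> sqabs (f x))) => [|g /hB [k _ <-]]; last exact: hf.
rewrite -big_seq big_const_seq count_predT iter_addr_0 => h.
have : nsq f < sqabs (f x) *+ n.
  by rewrite -mulr_natl -ltr_pdivrMr// truncnS_gt.
by rewrite ltNge (le_trans _ h)// ler_wpMn2l// ltW.
Qed.

End conj_invariant.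

Section normality.
Variables (R : realType) (Gam Lam : groupType).
Variable theta : operator R Gam -> operator R Lam.
Hypothesis iccG : icc Gam.
Hypothesis iso : star_isomorphism (groupvN R Gam) (groupvN R Lam) theta.
Implicit Types (A B : operator R Gam).

Lemma theta_vn A : vn A -> vn (theta A).
Proof. by case: iso => -[h _ _] _ _ _ _ /groupvNP /h /groupvNP. Qed.

Lemma theta_inj A B : vn A -> vn B -> theta A = theta B -> A = B.
Proof.
case: iso => -[_ h _] _ _ _ _ /groupvNP vA /groupvNP vB e.
by apply: h e; rewrite inE.
Qed.

Lemma theta_surj (B : operator R Lam) : vn B -> exists2 A, vn A & theta A = B.
Proof. by case: iso => -[_ _ h] _ _ _ _ /groupvNP /h [A /groupvNP vA <-]; exists A. Qed.

Lemma thetaD A B : vn A -> vn B -> theta (A + B) = theta A + theta B.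
Proof. by case: iso => _ h _ _ _ /groupvNP vA /groupvNP; exact: h. Qed.

Lemma thetaZ a A : vn A -> theta (a *: A) = a *: theta A.
Proof. by case: iso => _ _ h _ _ /groupvNP; exact: h. Qed.

Lemma thetaM A B : vn A -> vn B -> theta (A \o B) = theta A \o theta B.
Proof. by case: iso => _ _ _ h _ /groupvNP vA /groupvNP; exact: h. Qed.

Lemma thetaB A B : vn A -> vn B -> theta (A - B) = theta A - theta B.
Proof.
move=> vA vB; have -> : A - B = A + (-1) *: B.
  by apply/funext => f; rewrite opBE opDE opZE scaleN1r.
rewrite thetaD ?thetaZ//; last exact: vnZ.
by apply/funext => f; rewrite opBE opDE opZE scaleN1r.
Qed.

Lemma theta_adj A B : vn A -> isadj A B -> isadj (theta A) (theta B).
Proof.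
move=> vA AB; rewrite -(adjointE AB).
case: iso => _ _ _ _ -> //; last exact/groupvNP.
by apply: adjointP; exact: (theta_vn vA).1.
Qed.

Lemma theta1 : theta idfun = idfun.
Proof.
have [A vA hA] := theta_surj (vn_id R Lam).
have h := thetaM (vn_id R Gam) vA; rewrite hA in h.
exact: esym h.
Qed.

(* If [M] is the best constant for [theta x] and [M > C], then [M - x^* x] is
   invertible, hence so is its image, which is however not bounded below. *)
Lemma theta_contractive A (C : R) : vn A -> 0 <= C ->
  (forall f, nsq (A f) <= C * nsq f) -> forall f, nsq (theta A f) <= C * nsq f.
Proof.
move=> vA C0 hC; set y := theta A; have vy : vn y := theta_vn vA.
pose S := [set D : R | 0 <= D /\ forall f, nsq (y f) <= D * nsq f].
have Sn : S !=set0 by have [_ [D D0 hD]] := vy.1; exists D.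
have Slb : has_lbound S by exists 0 => D [].
pose M := inf S.
have M0 : 0 <= M by apply: lb_le_inf => // D [].
have hM f : nsq (y f) <= M * nsq f.
  have [f0|fn0] := eqVneq (nsq f) 0.
    by have [D [_ hD]] := Sn; have := hD f; rewrite f0 !mulr0.
  have fp : 0 < nsq f by rewrite lt_neqAle eq_sym fn0 nsq_ge0.
  by rewrite -ler_pdivrMr//; apply: lb_le_inf => // D [_ hD]; rewrite ler_pdivrMr.
suff MC : M <= C by move=> f; apply: le_trans (hM f) _; rewrite ler_wpM2r ?nsq_ge0.
rewrite leNgt; apply/negP => CM; have Mp : 0 < M by apply: le_lt_trans CM.
have [A' AA'] := isadj_exists vA.1; have vA' := vn_adj vA AA'.
have hC' := isadj_bound C0 AA' hC.
pose A1 : operator R Gam := (M^-1)%:C *: (A' \o A).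
have vA1 : vn A1 by apply: vnZ; exact: vn_comp.
have [|||T [vT hT1 hT2]] := @neumann _ _ A1 (C / M) vA1.
- by rewrite divr_ge0.
- by rewrite ltr_pdivrMr// mul1r.
- move=> f; rewrite /A1 opZE nsqZ sqabs_real.
  have h : nsq (A' (A f)) <= C ^+ 2 * nsq f.
    by apply: le_trans (hC' _) _; rewrite expr2 -mulrA ler_wpM2l.
  rewrite [leRHS](_ : _ = (M^-1) ^+ 2 * (C ^+ 2 * nsq f)); last by rewrite exprMn; ring.
  by rewrite ler_wpM2l ?sqr_ge0.
set t := theta T; have vt : vn t := theta_vn vT.
have yy' := theta_adj vA AA'; set y' := theta A' in yy'.
have hM' := isadj_bound M0 yy' hM.
have tE f : t f = f + t ((M^-1)%:C *: y' (y f)).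
  have e : T = idfun + (T \o A1) by apply/funext => k; rewrite opDE {1}hT1 hT2.
  rewrite {1}/t e thetaD; [|exact: vn_id|exact: vn_comp].
  have eA1 : theta A1 = (M^-1)%:C *: (y' \o y).
    by rewrite /A1 thetaZ; [rewrite (thetaM vA' vA)|exact: vn_comp].
  by rewrite theta1 (thetaM vT vA1) eA1 opDE.
(* [1 <= K] is what keeps the improved constant [M * (1 - K^-1)] nonnegative. *)
have [K K1 hK] : exists2 K : R, 1 <= K & forall f, nsq (t f) <= K * nsq f.
  have [_ [K K0 hK]] := vt.1; exists (1 + K) => [|f]; first by rewrite lerDl.
  by apply: le_trans (hK f) _; rewrite ler_wpM2r ?nsq_ge0// lerDr.
have Kp : 0 < K by apply: lt_le_trans K1.
have hf f : nsq f <= K * (nsq f - M^-1 * nsq (y f)).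
  have {1}-> : f = t (f - (M^-1)%:C *: y' (y f)).
    by rewrite (bopB vt.1.1) {1}tE addrK.
  apply: le_trans (hK _) _; rewrite ler_wpM2l ?(ltW Kp)//.
  rewrite nsqB nsqZ sqabs_real innerZr conj_real ReZ -yy'.2 inner_nsq /=.
  have : (M^-1) ^+ 2 * nsq (y' (y f)) <= M^-1 * nsq (y f).
    rewrite expr2 -mulrA ler_wpM2l ?invr_ge0// -ler_pdivlMl ?invr_gt0// invrK.
    exact: hM'.
  lra.
(* The lower bound [hf] yields a constant strictly below the infimum [M]. *)
have : S (M * (1 - K^-1)).
  split=> [|f]; first by rewrite mulr_ge0// subr_ge0 invf_le1.
  have := hf f; rewrite -ler_pdivrMl// => h.
  have {}h : M^-1 * nsq (y f) <= (1 - K^-1) * nsq f by lra.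
  by move: h; rewrite ler_pdivrMl// mulrA.
move=> /(inf_lbound Slb); rewrite -/M leNgt gtr_pMr// => /negP; apply.
by rewrite gtrBl invr_gt0.
Qed.

Local Notation d1 := (delta R 1%g).

Section null_sequence.
Variables (y : nat -> operator R Gam) (C : R) (c : R[i]).
Hypothesis vy : forall k, vn (y k).
Hypothesis C0 : 0 <= C.
Hypothesis hC : forall k f, nsq (y k f) <= C * nsq f.
Hypothesis small_y : forall k, nsq (y k d1) <= 64^-1 ^+ k.
Hypothesis hc : forall k, inner (theta (y k) d1) d1 = c.

Let Y k := adjoint (y k).
Let yY k : isadj (y k) (Y k). Proof. exact: adjointP (vy k).1. Qed.
Let vY k : vn (Y k). Proof. exact: vn_adj (vy k) (yY k). Qed.

(** The weights [4 ^+ n] grow, so that the resolvent of [S n] damps the [y k]; since [y n d1] has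
    norm at most [8^-1 ^+ n], the series still converges on every delta. *)
Let S := fix S n : operator R Gam :=
  if n is n'.+1 then S n' + (4 ^+ n')%:C *: (Y n' \o y n') else 0 *: idfun.

Let SE n f : S n.+1 f = S n f + (4 ^+ n)%:C *: Y n (y n f). Proof. by []. Qed.

Let vS n : vn (S n).
Proof.
elim: n => [|n IH] /=; first exact/vnZ/vn_id.
by apply: vnD => //; apply: vnZ; exact: vn_comp.
Qed.

Let inner_S n f h :
  inner (S n f) h = \sum_(k < n) (4 ^+ k)%:C * inner (y k f) (y k h).
Proof.
elim: n => [|n IH]; first by rewrite big_ord0 /= opZE scale0r inner0l.
rewrite big_ord_recr SE innerDl IH innerZl; congr (_ + _ * _).
by rewrite innerJ -(yY n).2 -innerJ.
Qed.

Let S_herm n f h : inner (S n f) h = inner f (S n h).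
Proof.
rewrite [RHS]innerJ !inner_S rmorph_sum; apply: eq_bigr => k _.
by rewrite rmorphM /= conj_real -innerJ.
Qed.

Let Re_S n f : complex.Re (inner (S n f) f) = \sum_(k < n) 4 ^+ k * nsq (y k f).
Proof.
by rewrite inner_S Re_sum; apply: eq_bigr => k _; rewrite ReZ -nsq_Re.
Qed.

Let S_pos n f : 0 <= complex.Re (inner (S n f) f).
Proof. by rewrite Re_S sumr_ge0// => k _; rewrite mulr_ge0 ?nsq_ge0 ?exprn_ge0. Qed.

(** [T] is the weak limit of [Q n = (1 + S n)^-1]. The bound on [y k (T f)] comes from the k-th term
    of [S n] alone. For the last clause, if [T e = 0], write [e = Q n e + S n (Q n e)]: the part of
    [S n] below [m] tends to 0 together with [Q n e], weakly, and the remaining tail is of order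
    [4^-1 ^+ m]. *)
Lemma null_resolvent : exists T : operator R Gam, [/\ vn T, isadj T T,
  forall k f, nsq (y k (T f)) <= 4^-1 ^+ k * nsq f &
  forall A, vn A -> T \o A = (fun=> 0) -> A = (fun=> 0)].
Proof.
have /choice [Q hQ] n := resolvent (vS n) (@S_herm n) (S_pos n).
have vQ n : vn (Q n) by case: (hQ n).
have key n f : nsq (Q n f) + 2 * \sum_(k < n) 4 ^+ k * nsq (y k (Q n f)) <= nsq f.
  have [_ h _] := hQ n; rewrite -Re_S.
  have := Re_inner_half f (Q n f); rewrite -{1}(h f) innerDl ReD -nsq_Re; lra.
have sum0 n f : 0 <= \sum_(k < n) 4 ^+ k * nsq (y k (Q n f)).
  by rewrite sumr_ge0// => k _; rewrite mulr_ge0 ?nsq_ge0 ?exprn_ge0.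
have bQ n f : nsq (Q n f) <= 1 * nsq f.
  by rewrite mul1r; have := key n f; have := sum0 n f; lra.
have byQ n k f : (k < n)%N -> nsq (y k (Q n f)) <= 4^-1 ^+ k * nsq f.
  move=> kn; rewrite exprVn ler_pdivlMl ?exprn_gt0//.
  have := key n f; rewrite (bigD1 (Ordinal kn))//=.
  have := nsq_ge0 (Q n f).
  have : 0 <= \sum_(i < n | i != Ordinal kn) 4 ^+ i * nsq (y i (Q n f)).
    by rewrite sumr_ge0// => i _; rewrite mulr_ge0 ?nsq_ge0 ?exprn_ge0.
  have : 0 <= 4 ^+ k * nsq (y k (Q n f)) by rewrite mulr_ge0 ?nsq_ge0 ?exprn_ge0.
  lra.
have hermQ n f h : inner (Q n f) h = inner f (Q n h).
  have [_ e _] := hQ n; rewrite -{1}(e h) -{2}(e f).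
  by rewrite innerDr innerDl S_herm.
have [T [lT bT hT]] := wlim_op ler01 (fun n => (vQ n).1.1) bQ.
have isT : isbop T by split=> //; exists 1.
have vT := vn_wlim vQ isT hT.
have TT : isadj T T.
  split=> // f h; apply: (ucvg_unique (hT f h)); rewrite innerJ.
  by apply: eq_ucvg (ucvgJ (hT h f)) => n; rewrite -innerJ hermQ.
exists T; split=> // [k f|A vA TA].
  apply: (@wlim_nsq_le _ _ (fun n => y k (Q n f)) _ _ k.+1) => [n kn|h]; first exact: byQ.
  rewrite (yY k).2; apply: eq_ucvg (hT f (Y k h)) => n.
  by rewrite (yY k).2.
apply/funext => f; set e := A f; have Te : T e = 0 by rewrite -[LHS]/((T \o A) f) TA.
set N := ell2_norm e; have N0 : 0 <= N := ell2_norm_ge0 e.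
have tail n x m j : (m <= j <= n)%N ->
    normc (inner (S j (Q n e) - S m (Q n e)) (delta R x)) <=
    2 * (4^-1 ^+ m - 4^-1 ^+ j) * N.
  case/andP; elim: j => [|j IH].
    rewrite leqn0 => /eqP -> _; rewrite subrr inner0l normc0.
    by rewrite subrr mulr0 mul0r.
  rewrite leq_eqVlt => /orP[/eqP -> _|mj jn].
    by rewrite !subrr inner0l normc0 mulr0 mul0r.
  rewrite SE addrAC innerDl; apply: le_trans (le_normcD _ _) _.
  have {}IH := IH mj (ltnW jn).
  suff : normc (inner ((4 ^+ j)%:C *: Y j (y j (Q n e))) (delta R x)) <= 4^-1 ^+ j * N.
    have : 0 <= 4^-1 ^+ j * N by rewrite mulr_ge0// exprn_ge0// invr_ge0.
    by move: IH; rewrite [4^-1 ^+ j.+1]exprS; nra.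
  rewrite innerZl normcM normc_real ger0_norm ?exprn_ge0//.
  rewrite innerJ -(yY j).2 -innerJ.
  have h1 : ell2_norm (y j (Q n e)) <= 2^-1 ^+ j * N.
    apply: ell2_norm_le; first by rewrite exprn_ge0// invr_ge0.
    rewrite -exprM mulnC exprM (_ : 2^-1 ^+ 2 = 4^-1); last by field.
    exact: byQ.
  have h2 : ell2_norm (y j (delta R x)) <= 8^-1 ^+ j.
    rewrite -(@ler_pXn2r _ 2) ?nnegrE ?ell2_norm_ge0 ?exprn_ge0 ?invr_ge0//.
    rewrite ell2_norm_sq -exprM mulnC exprM (_ : 8^-1 ^+ 2 = 64^-1); last by field.
    by rewrite (vn_delta x (vy j)) nsq_rtr.
  (* Weight, damping by the resolvent and smallness on deltas combine to [4 / (2 * 8) = 1 / 4], so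
     the tail is geometric; the factor 2 in [tail] covers its sum. *)
  apply: (@le_trans _ _ (4 ^+ j * (2^-1 ^+ j * N * 8^-1 ^+ j))).
    rewrite ler_wpM2l ?exprn_ge0//; apply: le_trans (normc_inner_le _ _) _.
    by rewrite ler_pM ?ell2_norm_ge0.
  rewrite (_ : _ * _ = (4 * 2^-1 * 8^-1) ^+ j * N); last by rewrite !exprMn; ring.
  by rewrite (_ : 4 * 2^-1 * 8^-1 = 4^-1) ?lexx//; field.
apply: ell2P => x; rewrite ell20E -inner_delta; apply/eqP; rewrite -sqabs_eq0.
rewrite eq_le sqabs_ge0 andbT; apply/ler_addgt0Pr => r r0; rewrite add0r.
have [||||m hm] := @geom_small R (4^-1 ^+ 2) ((2 * N) ^+ 2) r => //; first lra.
- exact: sqr_ge0.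
apply: le_trans (hm m (leqnn m)); rewrite -exprM mulnC exprM -exprMn.
pose v := delta R x + S m (delta R x).
have h0 : ucvg (fun n => inner e (delta R x) - inner (Q n e) v) (inner e (delta R x)).
  have := ucvgB (ucvg_cst (inner e (delta R x))) (hT e v).
  by rewrite Te inner0l subr0.
apply: (ucvg_sqabs_le (N := m) _ h0) => n mn.
rewrite sqabs_normc lerXn2r ?nnegrE ?normc_ge0 ?mulr_ge0 ?exprn_ge0 ?invr_ge0//.
have [_ hn _] := hQ n; rewrite -{1}(hn e) /v innerDr innerDl opprD addrACA subrr add0r.
rewrite -S_herm -innerBl; apply: le_trans (tail n x m n _) _; first by rewrite mn leqnn.
rewrite mulrA ler_wpM2r// mulrC ler_wpM2r// gerBl.
by rewrite exprn_ge0// invr_ge0.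
Qed.

(** Let [t = theta T] and [q n = (1 + n t^2)^-1]. A weak limit of [q n] is annihilated by [t];
    pulled back by [theta] it is annihilated by [T], hence is zero, and [q n d1] becomes small in
    norm. Splitting [d1] by [q n] bounds [theta (y k) d1], through [theta_contractive], by a
    multiple of [q n d1] plus the image of the norm-small [y k \o T]. *)
Lemma null_sequence_value : c = 0.
Proof.
have [T [vT TT hyT T_inj]] := null_resolvent.
pose t := theta T; have vt : vn t := theta_vn vT.
have tt : isadj t t := theta_adj vT TT.
pose S' n : operator R Lam := (n%:R)%:C *: (t \o t).
have vS' n : vn (S' n) by apply: vnZ; exact: vn_comp.
have S'E n f : S' n f = (n%:R)%:C *: t (t f) by [].
have S'h n f h : inner (S' n f) h = inner f (S' n h).
  by rewrite !S'E innerZl innerZr conj_real !tt.2.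
have ReS' n f : complex.Re (inner (S' n f) f) = n%:R * nsq (t f).
  by rewrite S'E innerZl ReZ tt.2 -nsq_Re.
have S'p n f : 0 <= complex.Re (inner (S' n f) f).
  by rewrite ReS' mulr_ge0 ?nsq_ge0 ?ler0n.
have /choice [q hq] n := resolvent (vS' n) (S'h n) (S'p n).
have vq n : vn (q n) by case: (hq n).
have key n f : nsq (q n f) + n%:R * nsq (t (q n f)) = complex.Re (inner (q n f) f).
  have [_ h _] := hq n; rewrite -{4}(h f) innerDr ReD -nsq_Re.
  by rewrite ReinnerC ReS'.
have bnt n f : 0 <= n%:R * nsq (t (q n f)) by rewrite mulr_ge0 ?nsq_ge0 ?ler0n.
have bq n f : nsq (q n f) <= 1 * nsq f.
  by rewrite mul1r; have := key n f; have := bnt n f; have := Re_inner_half (q n f) f; lra.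
have btq n f : n%:R * nsq (t (q n f)) <= nsq f.
  have := key n f; have := Re_inner_half (q n f) f; have := nsq_ge0 (q n f).
  by have := nsq_ge0 f; lra.
have [q' [lq' bq' hq']] := wlim_op ler01 (fun n => (vq n).1.1) bq.
have isq' : isbop q' by split=> //; exists 1.
have vq' := vn_wlim vq isq' hq'.
have tq' : t \o q' = (fun=> 0).
  apply/funext => f /=; apply: inner_ext => k; rewrite innerJ [RHS]innerJ inner0l.
  congr (_^*)%C; rewrite tt.2; apply: (ucvg_unique (hq' f (t k))).
  apply: ucvg_small => e e0; have fk0 : 0 <= nsq f * nsq k by rewrite mulr_ge0 ?nsq_ge0.
  exists (Num.truncn (nsq f * nsq k / e)).+1 => n hn; rewrite subr0 -tt.2.
  apply: le_trans (cauchy_schwarz _ _) _.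
  have n0 : (0 : R) < n%:R by rewrite ltr0n (leq_trans _ hn).
  have : nsq (t (q n f)) <= nsq f / n%:R by rewrite ler_pdivlMr// mulrC btq.
  move=> /(ler_wpM2r (nsq_ge0 k)) /le_trans; apply.
  rewrite mulrAC ler_pdivrMr// -ler_pdivrMl// mulrC.
  by apply: le_trans (ltW (truncnS_gt _)) _; rewrite ler_nat.
have q'0 : q' = (fun=> 0).
  have [z vz hz] := theta_surj vq'.
  have th0 : theta (fun=> 0) = (fun=> 0).
    have e (G : groupType) : (fun _ : ell2 R G => 0 : ell2 R G) = 0 *: (@idfun (ell2 R G) : operator R G).
      by apply/funext => f; rewrite opZE scale0r.
    by rewrite e thetaZ ?theta1 -?e//; exact: vn_id.
  suff : z = (fun=> 0) by move=> z0; rewrite -hz z0.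
  apply: T_inj => //; apply: theta_inj; first exact: vn_comp.
    exact: vn0.
  by rewrite thetaM// hz th0 -/t.
have smallq e : 0 < e -> exists n, nsq (q n d1) <= e.
  move=> e0; apply: contrapT; rewrite -forallNE => h.
  have : e <= complex.Re (inner (q' d1) d1).
    apply: (@ucvg_Re_ge _ _ _ _ 0%N) (hq' d1 d1) => n _; rewrite -key.
    have /negP := h n; rewrite -ltNge; have := bnt n d1; lra.
  by rewrite q'0 inner0l /= leNgt e0.
apply/eqP; rewrite -sqabs_eq0 eq_le sqabs_ge0 andbT.
apply/ler_addgt0Pr => e e0; rewrite add0r.
have e'0 : 0 < e / (4 * (C + 1)) by rewrite divr_gt0// mulr_gt0// ltr_wpDl.
have [n hn] := smallq _ e'0.
pose a := nsq ((n%:R)%:C *: t (q n d1)).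
have [||||k hk] := @geom_small R 4^-1 a (e / 4) => //; try lra.
- exact: nsq_ge0.
(* From [d1 = q n d1 + n t (t (q n d1))]; one factor [t] joins [theta (y k)], the rest is a vector
   independent of [k]. *)
have e1 : theta (y k) d1 =
    theta (y k) (q n d1) + theta (y k \o T) ((n%:R)%:C *: t (q n d1)).
  rewrite (thetaM (vy k) vT) /= -(bopD (theta_vn (vy k)).1.1); congr (theta (y k) _).
  by have [_ h _] := hq n; rewrite -[LHS](h d1) S'E -(bopZ vt.1.1).
have -> : c = inner (theta (y k) (q n d1)) d1 +
    inner (theta (y k \o T) ((n%:R)%:C *: t (q n d1))) d1.
  by rewrite -[LHS](hc k) e1 innerDl.
apply: le_trans (sqabsD _ _) _.
have h1 : sqabs (inner (theta (y k) (q n d1)) d1) <= e / 4.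
  apply: le_trans (cauchy_schwarz _ _) _; rewrite nsq_delta mulr1.
  apply: le_trans (theta_contractive (vy k) C0 (hC k) _) _.
  apply: le_trans (ler_wpM2l C0 hn) _.
  have Cn : C + 1 != 0 by rewrite gt_eqF// ltr_wpDl.
  rewrite [leLHS](_ : _ = e / 4 * (C / (C + 1))); last by field.
  rewrite ler_piMr//; first by rewrite divr_ge0// ltW.
  by rewrite ler_pdivrMr ?ltr_wpDl// mul1r lerDl.
have h2 : sqabs (inner ((theta (y k \o T)) ((n%:R)%:C *: t (q n d1))) d1) <= e / 4.
  apply: le_trans (cauchy_schwarz _ _) _; rewrite nsq_delta mulr1.
  apply: le_trans (hk k (leqnn k)).
  apply: theta_contractive => [||f]; first exact: vn_comp.
    by rewrite exprn_ge0// invr_ge0.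
  exact: hyT.
lra.
Qed.

End null_sequence.

Lemma theta_lreg_adj g : isadj (theta (lreg R g)) (theta (lreg R g^-1%g)).
Proof.
apply: theta_adj; first exact: vn_lreg.
by split; [exact: isbop_lreg|exact: inner_lreg].
Qed.

Lemma theta_lregM g h f :
  theta (lreg R g) (theta (lreg R h) f) = theta (lreg R (g * h)%g) f.
Proof.
rewrite -[LHS]/((theta (lreg R g) \o theta (lreg R h)) f).
rewrite -(thetaM (vn_lreg R g) (vn_lreg R h)); congr (theta _ _).
by apply/funext => k /=; rewrite lreg_comp.
Qed.

Lemma theta_lreg1 f : theta (lreg R 1%g) f = f.
Proof.
have -> : lreg R 1%g = idfun :> operator R Gam by apply/funext => k; rewrite lreg_id.
by rewrite theta1.
Qed.

Lemma theta_lregK g : cancel (theta (lreg R g)) (theta (lreg R g^-1%g)).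
Proof. by move=> f; rewrite theta_lregM mulVg theta_lreg1. Qed.

Definition conj_op g A : operator R Gam := lreg R g \o A \o lreg R g^-1%g.

Lemma vn_conj_op g A : vn A -> vn (conj_op g A).
Proof. by move=> vA; do 2?[apply: vn_comp => //]; exact: vn_lreg. Qed.

Lemma conj_op_deltaE g A x : vn A -> conj_op g A d1 x = A d1 (x ^ g)%g.
Proof.
move=> vA; rewrite -[LHS]/(A (lreg R g^-1%g d1) (g^-1 * x)%g).
rewrite lreg_delta mulg1 vn_deltaE// invgK.
by rewrite conjgE mulgA.
Qed.

Lemma nsq_conj_op g A : vn A -> nsq (conj_op g A d1) = nsq (A d1).
Proof. by move=> vA; rewrite /conj_op /= nsq_lreg lreg_delta mulg1 vn_delta// nsq_rtr. Qed.

Lemma theta_conj_op g A : vn A ->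
  inner (theta (conj_op g A) d1) d1 = inner (theta A d1) d1.
Proof.
move=> vA; have vg := vn_lreg R g; have vg' := vn_lreg R (g^-1)%g.
rewrite /conj_op (thetaM (vn_comp vg vA) vg') (thetaM vg vA) /=.
rewrite (theta_lreg_adj g).2; have h := theta_lreg_adj g^-1%g.
rewrite invgK in h.
exact: (trace_conj (theta_vn vA) (theta_vn vg') h (@theta_lregK g)).
Qed.

(** Minimize the 2-norm over the convex, conjugation-stable set [P] of elements sharing the norm
    bound, the image trace and the zero trace. Near-minimizers are close to each other and to their
    conjugates, so their weak limit is conjugation-invariant and vanishes at 1, hence is zero by
    icc. The infimum is then 0, and [null_sequence_value] applies to a fast minimizing sequence. *)
Lemma theta_trace0 A : vn A -> inner (A d1) d1 = 0 -> inner (theta A d1) d1 = 0.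
Proof.
move=> vA A0; have [_ [C C0 hC]] := vA.1.
set c := inner (theta A d1) d1.
pose P (y : operator R Gam) := [/\ vn y, forall f, nsq (y f) <= C * nsq f,
  inner (theta y d1) d1 = c & inner (y d1) d1 = 0].
have PA : P A by split.
pose X := [set nsq (y d1) | y in P].
have Xn : X !=set0 by exists (nsq (A d1)), A.
have Xlb : has_lbound X by exists 0 => _ [y _ <-]; exact: nsq_ge0.
pose nu := inf X.
have hnu y : P y -> nu <= nsq (y d1) by move=> Py; apply: inf_lbound => //; exists y.
have nu0 : 0 <= nu by apply: lb_le_inf => // _ [y _ <-]; exact: nsq_ge0.
have Pmid y z : P y -> P z -> P ((2^-1)%:C *: (y + z)).
  move=> [vy by_ cy y0] [vz bz cz z0]; split.
  - by apply: vnZ; exact: vnD.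
  - move=> f; rewrite opZE opDE nsqZ sqabs_real.
    by have := nsqD_le (y f) (z f); have := by_ f; have := bz f; lra.
  - rewrite thetaZ; last exact: vnD.
    rewrite (thetaD vy vz) opZE opDE innerZl innerDl cy cz.
    exact: halfC.
  - by rewrite opZE opDE innerZl innerDl y0 z0 addr0 mulr0.
have Pconj g y : P y -> P (conj_op g y).
  move=> [vy by_ cy y0]; split.
  - exact: vn_conj_op.
  - move=> f; rewrite /conj_op /= nsq_lreg; apply: le_trans (by_ _) _.
    by rewrite nsq_lreg.
  - by rewrite theta_conj_op.
  - by rewrite inner_delta conj_op_deltaE// conj1g -inner_delta.
have close y z r : P y -> P z -> nsq (y d1) <= nu + r -> nsq (z d1) <= nu + r ->
    nsq (y d1 - z d1) <= 4 * r.
  move=> Py Pz hy hz; have := hnu _ (Pmid _ _ Py Pz).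
  by rewrite opZE opDE nsqZ sqabs_real parallelogram; lra.
have near r : 0 < r -> exists y, P y /\ nsq (y d1) <= nu + r.
  move=> r0; have : inf X < nu + r by rewrite ltrDl.
  move=> /(inf_lt Xn) [_ [y Py <-] /ltW hy]; by exists y.
have nu_eq0 : nu <= 0.
  have /choice [y hy] n : exists y, P y /\ nsq (y d1) <= nu + n.+1%:R^-1.
    by apply: near; rewrite invr_gt0 ltr0n.
  have Py n : P (y n) := (hy n).1.
  have bnd n : nsq (y n d1) <= nu + 1.
    by apply: le_trans (hy n).2 _; rewrite lerD2l invf_le1 ?ler1n ?ltr0n.
  have [f [_ hf]] := wlim bnd.
  have f1 : f 1%g = 0.
    rewrite -inner_delta; apply: (ucvg_unique (hf _)).
    by apply: eq_ucvg (ucvg_cst 0) => n; have [_ _ _ ->] := Py n.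
  have small (r : R) : 0 < r -> exists N, forall n, (N <= n)%N -> 4 * n.+1%:R^-1 <= r.
    move=> r0; exists (Num.truncn (4 / r)) => n hn.
    rewrite ler_pdivrMr ?ltr0n// mulrC -ler_pdivrMr//.
    by apply: le_trans (ltW (truncnS_gt _)) _; rewrite ler_nat ltnS.
  have finv x g : f (x ^ g)%g = f x.
    apply/subr0_eq; rewrite -!inner_delta.
    apply: (ucvg_unique (ucvgB (hf _) (hf _))); apply: ucvg_small => r r0.
    have [N hN] := small r r0; exists N => n /hN; apply: le_trans.
    have [vy _ _ _] := Py n.
    rewrite subr0 !inner_delta -(conj_op_deltaE g x vy) -ell2BE.
    apply: le_trans (sqabs_le_nsq _ _) _; apply: close => //; first exact: Pconj.
      rewrite nsq_conj_op//; exact: (hy n).2.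
    exact: (hy n).2.
  have f0 : f = 0.
    apply: ell2P => x; have [->//|/eqP x1] := eqVneq x 1%g.
    by apply: icc_ell2_eq0 => // g; rewrite finv.
  suff key (r : R) : 0 < r -> nu <= r.
    by apply/ler_addgt0Pr => r r0; rewrite add0r key.
  move=> r0; have [N hN] := small r r0.
  have h m : (N <= m)%N -> nu - r <= complex.Re (inner (y m d1) (y N d1)).
    move=> Nm; have c1 : nsq (y m d1) <= nu + N.+1%:R^-1.
      apply: le_trans (hy m).2 _; rewrite lerD2l lef_pV2 ?posrE ?ltr0n// ler_nat.
      by rewrite ltnS.
    have := le_trans (close _ _ N.+1%:R^-1 (Py m) (Py N) c1 (hy N).2) (hN N (leqnn N)).
    rewrite nsqB; have := hnu _ (Py m); have := hnu _ (Py N).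
    move: (complex.Re _) (nsq _) (nsq _) => p q q'; lra.
  have := ucvg_Re_ge h (hf (y N d1)); rewrite f0 inner0l /=; lra.
have {}nu0 : nu = 0 by apply: le_anti; rewrite nu0 nu_eq0.
have /choice [y hy] k : exists y, P y /\ nsq (y d1) <= nu + 64^-1 ^+ k.
  by apply: near; rewrite exprn_gt0// invr_gt0.
have hP k := (hy k).1.
have h1 k : vn (y k) by case: (hP k).
have h2 k : forall f, nsq (y k f) <= C * nsq f by case: (hP k).
have h3 k : nsq (y k d1) <= 64^-1 ^+ k by have := (hy k).2; rewrite nu0 add0r.
have h4 k : inner (theta (y k) d1) d1 = c by case: (hP k).
exact: (null_sequence_value h1 C0 h2 h3 h4).
Qed.

Lemma theta_trace A : vn A -> inner (theta A d1) d1 = inner (A d1) d1.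
Proof.
move=> vA; set a := inner (A d1) d1.
have vid := vn_id R Gam; have va : vn (a *: idfun : operator R Gam) by apply: vnZ.
have := theta_trace0 (vnB vA va).
rewrite (thetaB vA va) (thetaZ _ vid) theta1 !opBE !opZE !innerBl !innerZl !inner_nsq.
rewrite !nsq_delta mulr1 subrr => /(_ erefl) /subr0_eq.
by [].
Qed.

(** Orthonormality is preservation of the trace. For Parseval at [delta R s], surjectivity writes
    [lreg R s] as [theta A]; the coefficients are then those of [A d1], and their squared norm is
    again a trace. *)
Lemma theta_onb : isonb (fun g => theta (lreg R g) d1).
Proof.
have ob : orthofam (fun g => theta (lreg R g) d1).
  move=> g h; have e := (theta_lreg_adj h^-1%g).2; rewrite invgK in e.
  rewrite -e theta_lregM theta_trace; last exact: vn_lreg.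
  rewrite lreg_delta mulg1 inner_delta deltaE; congr (_%:R).
  by rewrite eq_sym -(inj_eq (mulgI h)) mulVKg mulg1 eq_sym.
apply: isonbP => // s; have [A vA hA] := theta_surj (vn_lreg R s).
have [A' AA'] := isadj_exists vA.1; have vA' := vn_adj vA AA'.
have e : coefs (fun g => theta (lreg R g) d1) (delta R s) = A d1.
  apply: ell2P => g; rewrite coefsE// delta_lreg -hA.
  have h := (theta_lreg_adj g^-1%g).2; rewrite invgK in h.
  have vg := vn_lreg R g^-1%g.
  rewrite -h -[inner _ _]/(inner ((theta (lreg R g^-1%g) \o theta A) d1) d1).
  rewrite -(thetaM vg vA) theta_trace; last exact: vn_comp.
  by rewrite inner_delta -[LHS]/(A d1 (g^-1^-1 * 1)%g) invgK mulg1.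
rewrite e nsq_Re -(isadj_sym vA.1 AA').2 -[inner _ _]/(inner ((A' \o A) d1) d1).
rewrite -theta_trace; last exact: vn_comp.
rewrite (thetaM vA' vA) hA /=.
have h := isadj_sym (theta_vn vA).1 (theta_adj vA AA'); rewrite hA in h.
by rewrite h.2 -nsq_Re lreg_delta mulg1 nsq_delta.
Qed.

End normality.

(** * Hilbert-Schmidt kernels *)

(** Each output coordinate depends linearly on the conjugated second leg, hence is given by a vector
    [v]; Parseval makes the contribution [nsq v] in every basis. *)
Lemma hs_onb (R : realType) (G H I J : choiceType)
    (X : ell2 R (G * H)%type -> ell2 R I) (xi : ell2 R G) (e : J -> ell2 R H) :
  isbop X -> isonb e ->
  (\esum_(i in [set: J]) (nsq (X (tens xi (e i))))%:E =
   \esum_(y in [set: H]) (nsq (X (tens xi (delta R y))))%:E)%E.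
Proof.
move=> bX oe; have [X' XX'] := isadj_exists bX.
have key (K : choiceType) (b : K -> ell2 R H) : isonb b ->
    (\esum_(i in [set: K]) (nsq (X (tens xi (b i))))%:E =
     \esum_(p in [set: I]) \esum_(i in [set: K]) (sqabs (inner (tens xi (b i)) (X' (delta R p))))%:E)%E.
  move=> ob; rewrite esum_swap; last by move=> i j; rewrite lee_fin sqabs_ge0.
  apply: eq_esum => i _; rewrite -nsqE; apply: eq_esum => p _.
  by rewrite -XX'.2 inner_delta.
rewrite (key _ _ oe) (key _ _ (isonb_delta R H)); apply: eq_esum => p _.
set k := X' (delta R p).
have [||h|v [hv _]] := @riesz R H (fun h => inner k (tens xi h)) (nsq k * nsq xi).
- by rewrite mulr_ge0 ?nsq_ge0.
- by move=> a h h'; rewrite tensDr tensZr innerDr innerZr conjK.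
- by apply: le_trans (cauchy_schwarz _ _) _; rewrite nsq_tens mulrA.
have aux (K : choiceType) (b : K -> ell2 R H) : isonb b ->
    (\esum_(i in [set: K]) (sqabs (inner (tens xi (b i)) k))%:E = (nsq v)%:E)%E.
  move=> ob; rewrite -(onb_nsq v ob) -nsqE; apply: eq_esum => i _.
  by rewrite innerJ sqabsJ hv (coefsE ob.1) innerJ sqabsJ.
by rewrite aux// aux//; exact: isonb_delta.
Qed.

Section kernels.
Variables (R : realType) (Gam Lam : groupType) (u : Gam -> operator R Lam).
Local Notation d1 := (delta R (1%g : Lam)).
Local Notation HS := (Lam * Lam)%type.

Hypothesis vu : forall g, vn (u g).
Hypothesis uM : forall g h f, u g (u h f) = u (g * h)%g f.
Hypothesis u1 : forall f, u 1%g f = f.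
Hypothesis uadj : forall g f h, inner (u g f) h = inner f (u g^-1%g h).
Hypothesis uonb : isonb (fun g => u g d1).

Lemma uK g : cancel (u g) (u g^-1%g).
Proof. by move=> f; rewrite uM mulVg u1. Qed.
Lemma uVK g : cancel (u g^-1%g) (u g).
Proof. by move=> f; rewrite uM mulgV u1. Qed.

Lemma u_onb (I : choiceType) g (b : I -> ell2 R Lam) : isonb b -> isonb (fun x => u g (b x)).
Proof. by move=> ob; apply: isonb_unitary ob (uadj g) (uK g) (uVK g). Qed.

Lemma nsq_u g f : nsq (u g f) = nsq f.
Proof. by rewrite !nsq_Re uadj uK. Qed.

Lemma hs_ext (H : choiceType) (X Y : ell2 R HS -> ell2 R H) : isbop X -> isbop Y ->
  (forall x y, X (tens (delta R x) (delta R y)) = Y (tens (delta R x) (delta R y))) ->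
  X = Y.
Proof. by move=> bX bY h; apply: isbop_ext => // -[x y]; rewrite -tens_delta h. Qed.

Fact lock_key : unit. Proof. exact: tt. Qed.

(* [bimul a b] is the operator [u_a (x) conj u_b], or [T |-> u_a T u_b^* ]. *)
Definition bimul a b : operator R HS := locked_with lock_key
  (coefs (fun p => tens (u a^-1%g (delta R p.1)) (u b^-1%g (delta R p.2)))).

Lemma bimul_onb a b :
  isonb (fun p : HS => tens (u a^-1%g (delta R p.1)) (u b^-1%g (delta R p.2))).
Proof. by apply: (tens_onb (u_onb a^-1 _) (u_onb b^-1 _)); exact: isonb_delta. Qed.

Lemma isbop_bimul a b : isbop (bimul a b).
Proof. by rewrite /bimul unlock; exact: isbop_coefs (bimul_onb a b).1. Qed.

Lemma nsq_bimul a b K : nsq (bimul a b K) = nsq K.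
Proof. by rewrite /bimul unlock; exact/onb_nsq/bimul_onb. Qed.

Lemma bimul_tens a b xi eta : bimul a b (tens xi eta) = tens (u a xi) (u b eta).
Proof.
apply: ell2P => p; rewrite /bimul unlock (coefsE (bimul_onb a b).1) inner_tens tensE.
have h c z s : inner z (u c^-1%g (delta R s)) = u c z s by rewrite -uadj inner_delta.
by rewrite h innerJ h.
Qed.

Lemma bimul_comp a b a' b' K :
  bimul a b (bimul a' b' K) = bimul (a * a')%g (b * b')%g K.
Proof.
have /(congr1 (fun T => T K)) // : bimul a b \o bimul a' b' = bimul (a * a')%g (b * b')%g.
apply: hs_ext => [||x y]; [exact/isbop_comp/isbop_bimul/isbop_bimul|exact: isbop_bimul|].
by rewrite /= !bimul_tens !uM.
Qed.

Lemma bimul1 K : bimul 1%g 1%g K = K.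
Proof.
have /(congr1 (fun T => T K)) // : bimul 1%g 1%g = idfun.
apply: hs_ext => [||x y]; [exact: isbop_bimul|exact: isbop_id|].
by rewrite /= bimul_tens !u1.
Qed.

Lemma inner_bimul a b K L : inner (bimul a b K) L = inner K (bimul a^-1%g b^-1%g L).
Proof.
rewrite -[RHS](isometry_inner (isbop_bimul a b).1 (nsq_bimul a b)).
by rewrite bimul_comp !mulgV bimul1.
Qed.

(** The operator rho_t (x) conj rho_t, written as the analysis operator of a permuted delta
    basis. *)
Definition birtr t : operator R HS :=
  locked_with lock_key (coefs (fun p : HS => delta R ((p.1 * t, p.2 * t)%g : HS))).

Lemma birtr_fam t : orthofam (fun p : HS => delta R ((p.1 * t, p.2 * t)%g : HS)).
Proof.
move=> [x y] [x' y']; rewrite inner_delta deltaE /=; congr (_%:R).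
by rewrite !xpair_eqE !(inj_eq (mulIg t)) eq_sym (eq_sym y).
Qed.

Lemma birtrE t K p : birtr t K p = K ((p.1 * t, p.2 * t)%g : HS).
Proof. by rewrite /birtr unlock (coefsE (birtr_fam t)) inner_delta. Qed.

Lemma isbop_birtr t : isbop (birtr t).
Proof. by rewrite /birtr unlock; exact: isbop_coefs (birtr_fam t). Qed.

Lemma birtr_tens t xi eta : birtr t (tens xi eta) = tens (rtr t xi) (rtr t eta).
Proof. by apply: ell2P => p; rewrite birtrE !tensE !rtrE. Qed.

Lemma birtr_comp s t K : birtr s (birtr t K) = birtr (s * t)%g K.
Proof. by apply: ell2P => p; rewrite !birtrE /= !mulgA. Qed.

Lemma birtr1 K : birtr 1%g K = K.
Proof. by apply: ell2P => -[x y]; rewrite !birtrE /= !mulg1. Qed.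

Lemma nsq_birtr t K : nsq (birtr t K) = nsq K.
Proof.
have le s L : nsq (birtr s L) <= nsq L.
  by rewrite /birtr unlock; apply: nsq_coefs_le; exact: birtr_fam.
by apply: le_anti; rewrite le/= -{1}(birtr1 K) -(mulVg t) -birtr_comp le.
Qed.

Lemma bimul_birtr a b t K : bimul a b (birtr t K) = birtr t (bimul a b K).
Proof.
have /(congr1 (fun T => T K)) // : bimul a b \o birtr t = birtr t \o bimul a b.
apply: hs_ext => [||x y].
- exact/isbop_comp/isbop_birtr/isbop_bimul.
- exact/isbop_comp/isbop_bimul/isbop_birtr.
by rewrite /= birtr_tens !bimul_tens birtr_tens !(vu _).2.
Qed.

Implicit Types X Y : operator R HS.

Definition equivariant X := isbop X /\ forall t K, X (birtr t K) = birtr t (X K).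

Lemma equivariant_comp X Y : equivariant X -> equivariant Y -> equivariant (X \o Y).
Proof.
by move=> [bX hX] [bY hY]; split=> [|t K /=]; [exact: isbop_comp|rewrite hY hX].
Qed.

Lemma equivariantD X Y : equivariant X -> equivariant Y -> equivariant (X + Y).
Proof.
move=> [bX hX] [bY hY]; split=> [|t K]; first exact: isbopD.
by rewrite !opDE hX hY (bopD (isbop_birtr t).1).
Qed.

Lemma equivariantZ a X : equivariant X -> equivariant (a *: X).
Proof.
move=> [bX hX]; split=> [|t K]; first exact: isbopZ.
by rewrite !opZE hX (bopZ (isbop_birtr t).1).
Qed.

Lemma equivariant_bimul a b : equivariant (bimul a b).
Proof. by split=> [|t K]; [exact: isbop_bimul|exact: bimul_birtr]. Qed.

Lemma inner_birtr t K L : inner (birtr t K) L = inner K (birtr t^-1%g L).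
Proof.
rewrite -[RHS](isometry_inner (isbop_birtr t).1 (nsq_birtr t)).
by rewrite birtr_comp mulgV birtr1.
Qed.

Lemma equivariant_adj X Y : equivariant X -> isadj X Y -> equivariant Y.
Proof.
move=> [bX hX] [bY XY]; split=> // t K; apply: inner_ext => L.
rewrite -(XY L (birtr t K)) -(invgK t) -(inner_birtr t^-1%g (X L) K) -hX.
by rewrite (XY _ K) (inner_birtr t^-1%g L (Y K)).
Qed.

(* Squared Hilbert-Schmidt norm modulo the diagonal right translations. *)
Definition hsq X : \bar R := locked_with lock_key
  (\esum_(y in [set: Lam]) (nsq (X (tens d1 (delta R y))))%:E)%E.

Lemma hsq_esum X : hsq X = (\esum_(y in [set: Lam]) (nsq (X (tens d1 (delta R y))))%:E)%E.
Proof. by rewrite /hsq unlock. Qed.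

Lemma hsqE X : hsq X = (\esum_(q in [set: Lam * HS])
  (sqabs (X (tens d1 (delta R q.1)) q.2))%:E)%E.
Proof.
rewrite hsq_esum esum_pair => [|p]; last by rewrite lee_fin sqabs_ge0.
by apply: eq_esum => y _; rewrite -nsqE.
Qed.

Lemma hsq_isometry X Y : (forall K, nsq (Y K) = nsq K) -> hsq (Y \o X) = hsq X.
Proof. by move=> h; rewrite !hsq_esum; apply: eq_esum => y _; rewrite /= h. Qed.

(** Equivariance lets every matrix row be moved to one whose first index is 1, so transposing the
    matrix only permutes the summed entries. *)
Lemma hsq_adj X Y : equivariant X -> isadj X Y -> hsq Y = hsq X.
Proof.
move=> eX XY; have eY := equivariant_adj eX XY; rewrite !hsqE.
(* Transposition exchanges the row [(1, y)] and the column [(a, b)]; translating both by [a^-1]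
   brings the first index back to 1. *)
pose e (q : Lam * HS) : Lam * HS := (q.2.2 * q.2.1^-1, (q.2.1^-1, q.1 * q.2.1^-1))%g.
rewrite [RHS](@reindex_esum _ _ _ setT setT e); last first.
  split=> // [[y [a b]] [y' [a' b']] _ _ /= [h1 h2 h3]|[y [a b]] _].
    have aa : a = a' by apply: invg_inj.
    by move: h1 h3; rewrite aa => /mulIg -> /mulIg ->.
  exists (b * a^-1, (a^-1, y * a^-1))%g => //; rewrite /e /=.
  by rewrite invgK !mulgVK.
apply: eq_esum => -[y [a b]] _; congr (_%:E); rewrite /e /=.
rewrite tens_delta (adj_deltaE _ _ XY) sqabsJ.
have -> : delta R ((a, b) : HS) = birtr a^-1%g (tens d1 (delta R (b * a^-1)%g)).
  by rewrite birtr_tens !rtr_delta invgK mul1g mulgVK tens_delta.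
by rewrite eX.2 birtrE /= mul1g.
Qed.

Lemma equivariant_eq0 X : equivariant X -> hsq X = 0%E -> forall K, X K = 0.
Proof.
move=> [bX hX] h0 K.
have X0 y : X (tens d1 (delta R y)) = 0.
  apply: nsq_le0; have P := esum_leP 0 (fun y => nsq_ge0 (X (tens d1 (delta R y)))).
  have := P.1; rewrite -hsq_esum h0 => /(_ (lexx _) [:: y] isT).
  by rewrite big_seq1.
suff -> : X = (0 : R[i]) *: X by rewrite opZE scale0r.
apply: hs_ext => [//||x y]; first exact: isbopZ.
rewrite opZE scale0r.
have -> : tens (delta R x) (delta R y) = birtr x^-1%g (tens d1 (delta R (y * x^-1)%g)).
  by rewrite birtr_tens !rtr_delta invgK mul1g mulgVK.
by rewrite hX X0 (bop0 (isbop_birtr _).1).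
Qed.

Lemma hsq_ge0 X : (0 <= hsq X)%E.
Proof. by rewrite hsq_esum; apply: esum_ge0 => y _; rewrite lee_fin nsq_ge0. Qed.

Lemma isadj_bimul a b : isadj (bimul a b) (bimul a^-1%g b^-1%g).
Proof. by split; [exact: isbop_bimul|exact: inner_bimul]. Qed.

Lemma hsq_bimull a b X : hsq (bimul a b \o X) = hsq X.
Proof. exact/hsq_isometry/nsq_bimul. Qed.

Lemma hsq_bimulr a b X : equivariant X -> hsq (X \o bimul a b) = hsq X.
Proof.
move=> eX; have [Y XY] := isadj_exists eX.1.
have eW := equivariant_bimul a b.
rewrite -(hsq_adj (equivariant_comp eX eW) (isadj_comp XY (isadj_bimul a b))).
by rewrite hsq_bimull (hsq_adj eX XY).
Qed.

Lemma hsq_finP X : (hsq X < +oo)%E <-> exists C : R, forall s : seq Lam, uniq s ->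
  \sum_(y <- s) nsq (X (tens d1 (delta R y))) <= C.
Proof.
have P C := esum_leP C (fun y => nsq_ge0 (X (tens d1 (delta R y)))).
rewrite -hsq_esum in P.
split=> [h|[C /P h]]; last by apply: le_lt_trans h _; exact: ltry.
exists (fine (hsq X)); apply/P; rewrite fineK// ge0_fin_numE//; exact: hsq_ge0.
Qed.

Lemma hsqZ_fin a X : (hsq X < +oo)%E -> (hsq (a *: X) < +oo)%E.
Proof.
move=> /hsq_finP[C h]; apply/hsq_finP; exists (sqabs a * C) => s us.
under eq_bigr do rewrite opZE nsqZ.
by rewrite -mulr_sumr ler_wpM2l ?sqabs_ge0// h.
Qed.

Lemma hsqD_fin X Y : (hsq X < +oo)%E -> (hsq Y < +oo)%E -> (hsq (X + Y)%R < +oo)%E.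
Proof.
move=> /hsq_finP[C h] /hsq_finP[D k]; apply/hsq_finP; exists (2 * C + 2 * D) => s us.
apply: (@le_trans _ _ (\sum_(y <- s) (2 * nsq (X (tens d1 (delta R y))) +
    2 * nsq (Y (tens d1 (delta R y)))))).
  by apply: ler_sum => y _; rewrite opDE; exact: nsqD_le.
by rewrite big_split /= -!mulr_sumr lerD ?ler_wpM2l ?h ?k.
Qed.

(** * Invariant operators are proportional *)

(* Coordinates of [X] in an orthonormal basis of the equivariant operators of
   finite [hsq], in which left and right multiplications become translations. *)
Definition hat X : ell2 R (Gam * (Gam * Gam))%type := locked_with lock_key (toell2 (fun l =>
  inner (X (tens d1 (u l.1 d1))) (tens (u l.2.1 d1) (u l.2.2 d1)))).

Lemma hat_esum X : isbop X -> (\esum_(l in [set: (Gam * (Gam * Gam))%type])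
  (sqabs (inner (X (tens d1 (u l.1 d1))) (tens (u l.2.1 d1) (u l.2.2 d1))))%:E = hsq X)%E.
Proof.
move=> bX; rewrite esum_pair => [|p]; last by rewrite lee_fin sqabs_ge0.
rewrite hsq_esum -(hs_onb d1 bX uonb); apply: eq_esum => i _ /=.
have oo := tens_onb uonb uonb.
rewrite -(onb_nsq _ oo) -nsqE; apply: eq_esum => p _.
by rewrite (coefsE oo.1).
Qed.

Lemma hatE X l : isbop X -> (hsq X < +oo)%E ->
  hat X l = inner (X (tens d1 (u l.1 d1))) (tens (u l.2.1 d1) (u l.2.2 d1)).
Proof.
by move=> bX fX; rewrite /hat unlock toell2E//; apply/square_summableP; rewrite hat_esum.
Qed.

Lemma nsq_hat X : isbop X -> (hsq X < +oo)%E -> hsq X = (nsq (hat X))%:E.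
Proof.
move=> bX fX; rewrite -nsqE -hat_esum//; apply: eq_esum => l _.
by rewrite hatE.
Qed.

(** On the input only the second leg is multiplied, since equivariance has pinned the first one to
    [d1]. The inverse makes [hat] intertwine this with the left regular representation. *)
Definition transl (k : (Gam * (Gam * Gam))%type) X : operator R HS :=
  bimul k.2.1 k.2.2 \o X \o bimul 1%g k.1^-1%g.

Lemma equivariant_transl k X : equivariant X -> equivariant (transl k X).
Proof.
move=> eX; apply: equivariant_comp; last exact: equivariant_bimul.
by apply: equivariant_comp => //; exact: equivariant_bimul.
Qed.

Lemma hsq_transl k X : equivariant X -> hsq (transl k X) = hsq X.
Proof.
move=> eX; rewrite hsq_bimulr ?hsq_bimull//.
by apply: equivariant_comp => //; exact: equivariant_bimul.
Qed.

Lemma hat_transl k X : equivariant X -> (hsq X < +oo)%E ->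
  hat (transl k X) = lreg R k (hat X).
Proof.
move=> eX fX; have et := equivariant_transl k eX.
have ft : (hsq (transl k X) < +oo)%E by rewrite hsq_transl.
apply: ell2P => l; rewrite lregE (hatE l et.1 ft) (hatE _ eX.1 fX).
rewrite /transl /= bimul_tens u1 uM.
by rewrite (inner_bimul k.2.1 k.2.2 (X (tens d1 (u (k.1^-1 * l.1)%g d1)))) bimul_tens !uM.
Qed.

Lemma hatD X Y z : isbop X -> isbop Y -> (hsq X < +oo)%E -> (hsq Y < +oo)%E ->
  hat (X + z *: Y) = hat X + z *: hat Y.
Proof.
move=> bX bY fX fY; have bZ := isbopZ z bY.
have fZ : (hsq (z *: Y) < +oo)%E.
  exact: hsqZ_fin.
apply: ell2P => l; rewrite !ell2E !hatE//.
- by rewrite !opDE !opZE innerDl innerZl.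
- exact: isbopD.
- exact: hsqD_fin.
Qed.

Lemma hatZ X z : isbop X -> (hsq X < +oo)%E -> hat (z *: X) = z *: hat X.
Proof.
move=> bX fX; apply: ell2P => l; rewrite ell2ZE !hatE//; last 2 first.
- exact: isbopZ.
- exact: hsqZ_fin.
by rewrite opZE innerZl.
Qed.

Definition invariant X := equivariant X /\
  forall g K, X (bimul g g K) = bimul g g (X K).

Lemma hsq_conj g X : equivariant X ->
  hsq (bimul g g \o X \o bimul g^-1%g g^-1%g) = hsq X.
Proof.
move=> eX; rewrite hsq_bimulr ?hsq_bimull//.
by apply: equivariant_comp => //; exact: equivariant_bimul.
Qed.

Lemma transl_conj X (k : (Gam * (Gam * Gam))%type) g : invariant X ->
  transl (k ^ (g, (g, g)))%g X = bimul g^-1%g g^-1%g \o transl k X \o bimul g g.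
Proof.
case: k => k3 [k1 k2] [_ iX]; apply: funext => K; rewrite /transl /=.
have -> : bimul 1%g k3^-1%g (bimul g g K) = bimul g g (bimul 1%g (k3 ^ g)^-1%g K).
  by rewrite !bimul_comp mulg1 mul1g -conjVg /conjg !mulgA mulgV mul1g.
rewrite (iX g (bimul 1%g (k3 ^ g)^-1%g K)) (bimul_comp k1 k2 g g).
by rewrite (bimul_comp g^-1%g g^-1%g (k1 * g)%g (k2 * g)%g).
Qed.

Local Opaque transl.

(** By [polar] it is enough to compare norms of [transl k X + z *: Y]. Conjugation by [bimul g g]
    fixes [Y], turns one translate of [X] into the other, and preserves [hsq]. *)
Lemma inner_hat_conj X Y (k : (Gam * (Gam * Gam))%type) g : invariant X -> invariant Y ->
  (hsq X < +oo)%E -> (hsq Y < +oo)%E ->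
  inner (lreg R (k ^ (g, (g, g)))%g (hat X)) (hat Y) = inner (lreg R k (hat X)) (hat Y).
Proof.
move=> [eX iX] [eY iY] fX fY.
have et k' := equivariant_transl k' eX.
have ft k' : (hsq (transl k' X) < +oo)%E by rewrite hsq_transl.
have eq k' z := equivariantD (et k') (equivariantZ z eY).
have fq k' z : (hsq (transl k' X + z *: Y)%R < +oo)%E.
  by apply: hsqD_fin => //; exact: hsqZ_fin.
apply: polar => z; apply: EFin_inj.
have bt k' := (et k').1.
rewrite -(hat_transl k eX fX) -(hat_transl (k ^ (g, (g, g)))%g eX fX).
have h k' : (nsq (hat (transl k' X) + z *: hat Y))%:E = hsq (transl k' X + z *: Y).
  by rewrite (nsq_hat (eq k' z).1 (fq k' z)) (hatD z (bt k') eY.1 (ft k') fY).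
apply: etrans (h (k ^ (g, (g, g)))%g) (etrans _ (esym (h k))).
have e : transl (k ^ (g, (g, g)))%g X + z *: Y =
    bimul g^-1%g g^-1%g \o (transl k X + z *: Y) \o bimul g^-1^-1%g g^-1^-1%g.
  rewrite invgK; move: (transl_conj k g (conj eX iX)).
  move: (transl _ X) (transl k X) => S' S ->; apply: funext => K.
  have h1 := bopD (isbop_bimul g^-1%g g^-1%g).1; have h2 := bopZ (isbop_bimul g^-1%g g^-1%g).1.
  rewrite [LHS]opDE /comp [in RHS]opDE h1 opZE [in RHS]opZE h2.
  by rewrite -(iY g^-1%g (bimul g g K)) (bimul_comp g^-1%g g^-1%g g g) mulVg bimul1.
exact: etrans (congr1 hsq e) (hsq_conj g^-1%g (eq k z)).
Qed.

Hypothesis iccG : icc Gam.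

(** Some component of [k] is nontrivial, and its conjugates alone already leave any finite set. *)
Lemma icc_prod (k : (Gam * (Gam * Gam))%type) : k <> 1%g ->
  forall s : seq (Gam * (Gam * Gam))%type, exists g, (k ^ (g, (g, g)))%g \notin s.
Proof.
move=> k1 s.
have [h [h1 [p hp]]] : exists h : Gam, h <> 1%g /\ exists p : Gam * (Gam * Gam) -> Gam,
    forall g, p (k ^ (g, (g, g)))%g = (h ^ g)%g.
  case: k k1 => k3 [k1 k2] k0; have [k31|/eqP h] := eqVneq k3 1%g; last first.
    by exists k3; split=> //; exists fst.
  have [k11|/eqP h] := eqVneq k1 1%g; last first.
    by exists k1; split=> //; exists (fun p => p.2.1).
  exists k2; split; last by exists (fun p => p.2.2).
  by move=> k21; apply: k0; rewrite k31 k11 k21.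
have [B [uB hB hs]] := @infinite_set_seq _ _ (size s).+1 (iccG h1).
apply: contrapT => /forallNP hk; move: hs; rewrite ltnNge; apply/negP/negPn.
rewrite -(size_map p s) uniq_leq_size// => x /hB [g _ <-].
by rewrite -hp; apply/mapP; exists (k ^ (g, (g, g)))%g => //; exact/negPn/negP.
Qed.

(** The inner product is constant along the infinite orbit of [k] under diagonal conjugation, yet
    tends to 0 at infinity by [lreg_c0]. *)
Lemma hat_orth X Y k : invariant X -> invariant Y ->
  (hsq X < +oo)%E -> (hsq Y < +oo)%E -> k <> 1%g ->
  inner (lreg R k (hat X)) (hat Y) = 0.
Proof.
move=> iX iY fX fY k1.
apply/eqP; rewrite -sqabs_eq0; apply/eqP/le_anti; rewrite sqabs_ge0 andbT.
suff key (r : R) : 0 < r -> sqabs (inner (lreg R k (hat X)) (hat Y)) <= r.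
  by apply/ler_addgt0Pr => r r0; rewrite add0r key.
move=> r0; have [s hs] := lreg_c0 (hat X) (hat Y) r0.
have [g /hs] := icc_prod k1 s.
by rewrite inner_hat_conj.
Qed.

(* Translates of a normalized [hat X] form an orthonormal basis, since Parseval
   holds for the deltas; an orthogonal [hat Y] must then vanish. *)
Lemma invariant_unique X Y : invariant X -> invariant Y ->
  (hsq X < +oo)%E -> (hsq Y < +oo)%E -> nsq (hat X) <> 0 ->
  inner (hat X) (hat Y) = 0 -> forall K, Y K = 0.
Proof.
move=> iX iY fX fY X0 XY.
pose a := (Num.sqrt (nsq (hat X)))^-1.
have nX : 0 < nsq (hat X) by rewrite lt_neqAle nsq_ge0 andbT eq_sym; apply/eqP.
have na : sqabs a%:C * nsq (hat X) = 1.
  by rewrite sqabs_real exprVn sqr_sqrtr ?nsq_ge0// mulVf// gt_eqF.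
pose b k := a%:C *: lreg R k (hat X).
have ob : orthofam b.
  move=> i j; rewrite innerZl innerZr conj_real.
  have hh : inner (lreg R i (hat X)) (lreg R j (hat X)) =
      inner (lreg R (j^-1 * i)%g (hat X)) (hat X).
    by rewrite -lreg_comp (inner_lreg j^-1%g (lreg R i (hat X)) (hat X)) invgK.
  rewrite hh; have [<-|/eqP ij] := eqVneq i j.
    rewrite mulVg lreg_id inner_nsq -!rmorphM /= mulrA -expr2 -sqabs_real na.
    by [].
  rewrite (hat_orth iX iX fX fX) ?mulr0// => /(congr1 (fun x => j * x)%g).
  by rewrite mulVKg mulg1.
have onb : isonb b.
  apply: isonbP => // x; rewrite -na -nsqZ.
  apply: EFin_inj; rewrite -!nsqE.
  (* The coefficients of [delta R x] are, up to conjugation, the values of [hat X] at [k^-1 * x],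
     which run once through the group. *)
  rewrite [RHS](@reindex_esum _ _ _ setT setT (fun k => k^-1 * x)%g); last first.
    split=> // [y z _ _ /mulIg /invg_inj//|y _].
    by exists (x * y^-1)%g => //; rewrite invgM invgK mulgVK.
  apply: eq_esum => k _.
  by rewrite (coefsE ob) innerJ sqabsJ inner_delta !ell2ZE lregE.
have Y0 : hat Y = 0.
  apply: (onb_ext onb) => k; rewrite inner0l innerZr.
  rewrite innerJ; have [->|/eqP k1] := eqVneq k 1%g.
    by rewrite lreg_id XY conj0 mulr0.
  by rewrite hat_orth// conj0 mulr0.
by apply: equivariant_eq0 iY.1 _; rewrite (nsq_hat iY.1.1 fY) Y0 nsq0.
Qed.

(** * The invariant projection *)

(* A weakly closed convex set of operators, stable under conjugation by the
   [bimul g g], that contains the projection onto the diagonal kernels. Its element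
   of least [hsq] is therefore invariant, and [good_low] makes it nonzero. *)
Record good (c : R) X : Prop := Good {
  good_equiv : equivariant X;
  good_contr : forall K, nsq (X K) <= nsq K;
  good_herm : forall K L, inner (X K) L = inner K (X L);
  good_sym : forall xi eta ze th,
    inner (X (tens xi eta)) (tens ze th) = inner (X (tens th eta)) (tens ze xi);
  good_trace : forall e : Lam -> ell2 R Lam, isonb e ->
    forall xi (s : seq Lam), uniq s ->
    \sum_(y <- s) complex.Re (inner (X (tens xi (e y))) (tens xi (e y))) <= nsq xi;
  good_hsq : forall s : seq Lam, uniq s ->
    \sum_(y <- s) nsq (X (tens d1 (delta R y))) <= 1;
  good_low : forall g, c <=
    complex.Re (inner (X (tens (u g d1) (u g d1))) (tens (u g d1) (u g d1))) }.

Lemma good_fin c X : good c X -> (hsq X < +oo)%E.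
Proof. by move=> gX; apply/hsq_finP; exists 1; exact: good_hsq gX. Qed.

(** The witness is [D' \o D] with [D] the restriction to the diagonal. A kernel [tens x x] has
    diagonal entries [sqabs (x s)], whose squared norm produces the fourth power in the hypothesis.
    The symmetry is commutativity of pointwise products. *)
Lemma good_diag (c : R) : (forall g, exists s, c <= sqabs (u g d1 s) ^+ 2) ->
  exists X, good c X.
Proof.
move=> hc; have [D [bD DE hD]] : exists D : ell2 R HS -> ell2 R Lam,
    [/\ isbop D, forall K a, D K a = K (a, a) & forall K, nsq (D K) <= 1 * nsq K].
  pose b a : ell2 R HS := delta R ((a, a) : HS).
  have ob : orthofam b.
    by move=> i j; rewrite inner_delta deltaE xpair_eqE andbb eq_sym.
  exists (coefs b); split; first exact: isbop_coefs.
    by move=> K a; rewrite (coefsE ob) inner_delta.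
  by move=> K; rewrite mul1r nsq_coefs_le.
have [D' DD'] := isadj_exists bD.
have hD' := isadj_bound ler01 DD' hD.
have bE : isbop (D' \o D) := isbop_comp DD'.1 bD.
have hE K L : inner ((D' \o D) K) L = inner (D K) (D L).
  by rewrite /= innerJ -DD'.2 -innerJ.
have Dt xi eta : (nsq (D (tens xi eta)))%:E =
    (\esum_(a in [set: Lam]) (sqabs (xi a) * sqabs (eta a))%:E)%E.
  by rewrite -nsqE; apply: eq_esum => a _; rewrite DE tensE sqabsM sqabsJ.
have tr (e : Lam -> ell2 R Lam) : isonb e -> forall xi (s : seq Lam), uniq s ->
    \sum_(y <- s) nsq (D (tens xi (e y))) <= nsq xi.
  move=> oe xi s us; rewrite -lee_fin -sumEFin.
  under eq_bigr do rewrite Dt.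
  rewrite -esum_sum; last by move=> *; rewrite lee_fin mulr_ge0 ?sqabs_ge0.
  rewrite -nsqE; apply: le_esum => a _; rewrite sumEFin lee_fin -mulr_sumr.
  rewrite -[leRHS]mulr1 ler_wpM2l ?sqabs_ge0//.
  under eq_bigr do rewrite -sqabsJ -delta_inner.
  by rewrite -(nsq_delta R a); apply: bessel => // i j _ _; exact: oe.1.
exists (D' \o D); split.
- split=> // t K; apply: inner_ext => L.
  have Db s K' : D (birtr s K') = rtr s (D K').
    by apply: ell2P => a; rewrite rtrE !DE birtrE.
  rewrite innerJ [RHS]innerJ inner_birtr !hE !Db; congr (_^*).
  by rewrite inner_rtr.
- move=> K; apply: le_trans (hD' _) _; rewrite mul1r -[leRHS]mul1r; exact: hD.
- by move=> K L; rewrite hE innerJ -hE -innerJ.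
- move=> xi eta ze th; apply: etrans (hE _ _) (etrans _ (esym (hE _ _))).
  apply: etrans (innerE _ _) (etrans _ (esym (innerE _ _))).
  apply: eq_complex_sum => a.
  have h p q p' q' : (D (tens p q) a : R[i]) * (D (tens p' q') a)^* =
      p a * (q a)^* * ((p' a)^* * q' a) by rewrite !DE !tensE !conjM !conjK.
  by rewrite !h; ring.
- move=> e oe xi s us; under eq_bigr do rewrite hE -nsq_Re.
  exact: tr.
- move=> s us; rewrite -(nsq_delta R (1%g : Lam)).
  apply: (le_trans _ (tr _ (isonb_delta R Lam) d1 s us)).
  by apply: ler_sum => y _; rewrite -[leRHS]mul1r; exact: hD'.
- move=> g; rewrite hE -nsq_Re; have [s hs] := hc g; apply: le_trans hs _.
  apply: le_trans (sqabs_le_nsq _ s).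
  by rewrite DE tensE sqabsM sqabsJ expr2.
Qed.

Lemma good_mid c X Y : good c X -> good c Y -> good c ((2^-1)%:C *: (X + Y)).
Proof.
move=> gX gY.
have i2 K L : inner (((2^-1)%:C *: (X + Y)) K) L =
    (2^-1)%:C * (inner (X K) L + inner (Y K) L).
  by rewrite opZE opDE innerZl innerDl.
have n2 K : nsq (((2^-1)%:C *: (X + Y)) K) <= 2^-1 * (nsq (X K) + nsq (Y K)).
  rewrite opZE opDE nsqZ sqabs_real; have := nsqD_le (X K) (Y K); lra.
split.
- exact/equivariantZ/equivariantD/gY.(good_equiv)/gX.(good_equiv).
- move=> K; have := n2 K; have := gX.(good_contr) K; have := gY.(good_contr) K; lra.
- move=> K L; rewrite i2 gX.(good_herm) gY.(good_herm).
  by rewrite opZE opDE innerZr conj_real innerDr.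
- by move=> xi eta ze th; rewrite !i2 gX.(good_sym) gY.(good_sym).
- move=> e oe xi s us; under eq_bigr do rewrite i2 ReZ ReD.
  rewrite -mulr_sumr big_split /=.
  have := gX.(good_trace) oe xi us; have := gY.(good_trace) oe xi us; lra.
- move=> s us; apply: (@le_trans _ _ (\sum_(y <- s) 2^-1 *
      (nsq (X (tens d1 (delta R y))) + nsq (Y (tens d1 (delta R y)))))).
    by apply: ler_sum => y _; exact: n2.
  rewrite -mulr_sumr big_split /=.
  have := gX.(good_hsq) us; have := gY.(good_hsq) us; lra.
- move=> g; rewrite i2 ReZ ReD.
  have := gX.(good_low) g; have := gY.(good_low) g; lra.
Qed.

Definition conjop g X : operator R HS := bimul g g \o X \o bimul g^-1%g g^-1%g.

Lemma equivariant_conjop g X : equivariant X -> equivariant (conjop g X).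
Proof.
move=> eX; apply: equivariant_comp; last exact: equivariant_bimul.
by apply: equivariant_comp => //; exact: equivariant_bimul.
Qed.

(** Conjugation moves the orthonormal basis and the index [g]; this is why [good_trace] ranges over
    all bases and [good_low] over all [g]. *)
Lemma good_conj c X g : good c X -> good c (conjop g X).
Proof.
move=> gX.
have ic K L : inner (conjop g X K) L =
    inner (X (bimul g^-1%g g^-1%g K)) (bimul g^-1%g g^-1%g L).
  by rewrite /conjop /= inner_bimul.
have ec := equivariant_conjop g gX.(good_equiv).
split=> //.
- by move=> K; rewrite /conjop /= nsq_bimul (le_trans (gX.(good_contr) _))// nsq_bimul.
- move=> K L; rewrite ic gX.(good_herm).
  by rewrite (inner_bimul g^-1%g g^-1%g K) invgK.
- by move=> xi eta ze th; rewrite !ic !bimul_tens gX.(good_sym).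
- move=> e oe xi s us; under eq_bigr do rewrite ic !bimul_tens.
  by have := gX.(good_trace) (u_onb g^-1%g oe) (u g^-1%g xi) us; rewrite nsq_u.
- apply/(esum_leP 1 (fun y => nsq_ge0 (conjop g X (tens d1 (delta R y))))).
  rewrite -hsq_esum hsq_conj ?hsq_esum; last exact: gX.(good_equiv).
  apply/(esum_leP 1 (fun y => nsq_ge0 (X (tens d1 (delta R y))))).
  exact: gX.(good_hsq).
- by move=> h; rewrite ic !bimul_tens !uM; exact: gX.(good_low).
Qed.

Lemma good_wlim c (T : nat -> operator R HS) T' : (forall n, good c (T n)) ->
  isbop T' -> (forall f h, ucvg (fun n => inner (T n f) h) (inner (T' f) h)) ->
  good c T'.
Proof.
move=> gT bT' hT; split.
- split=> // t K; apply: inner_ext => L; rewrite innerJ [RHS]innerJ; congr (_^*).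
  apply: (ucvg_unique (hT _ _)); rewrite inner_birtr.
  apply: eq_ucvg (hT _ _) => n /=.
  by rewrite (gT n).(good_equiv).2 inner_birtr.
- move=> K; have := @wlim_sum_nsq_le R HS HS T T' unit [:: tt] (fun=> K) (nsq K) 0 hT.
  by rewrite big_seq1; apply=> n _; rewrite big_seq1; exact: (gT n).(good_contr).
- move=> K L; apply: (ucvg_unique (hT _ _)); rewrite innerJ.
  apply: eq_ucvg (ucvgJ (hT L K)) => n /=.
  by rewrite -innerJ (gT n).(good_herm).
- move=> xi eta ze th; apply: (ucvg_unique (hT _ _)).
  by apply: eq_ucvg (hT _ _) => n /=; rewrite (gT n).(good_sym).
- move=> e oe xi s us; rewrite -Re_sum.
  apply: (@ucvg_Re_le _ _ _ _ 0) (ucvg_sum s (fun y => hT _ _)) => n _.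
  by rewrite Re_sum; exact: (gT n).(good_trace).
- move=> s us; apply: (wlim_sum_nsq_le (N := 0) hT) => n _.
  exact: (gT n).(good_hsq).
- move=> g; apply: (@ucvg_Re_ge _ _ _ _ 0) (hT _ _) => n _.
  exact: (gT n).(good_low).
Qed.

(** The weak limit of a minimizing sequence is good and attains the minimum by lower semicontinuity
    of [hsq]. Its conjugates attain it too, and the parallelogram law makes minimizers unique. *)
Lemma good_invariant c X0 : good c X0 -> exists X, good c X /\ invariant X.
Proof.
have mid (m q : R) : m <= 2^-1 ^+ 2 * q -> 2 * m + 2 * m - q <= 0 by lra.
move=> g0; pose A := [set nsq (hat X) | X in good c].
have A0 : has_inf A.
  by split; [exists (nsq (hat X0)), X0|exists 0 => _ [X _ <-]; exact: nsq_ge0].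
have [m hm near] : exists2 m : R, forall X, good c X -> m <= nsq (hat X) &
    forall n, exists X, good c X /\ nsq (hat X) <= m + n.+1%:R^-1.
  exists (inf A) => [X gX|n]; first by apply: ge_inf; [exact: A0.2|exists X].
  have [|_ [X gX <-] hX] := @inf_adherent R A n.+1%:R^-1 _ A0; first by rewrite invr_gt0.
  by exists X; split=> //; exact: ltW.
have /choice [T hT] := near.
have gT n := (hT n).1.
have [||X [lX nX cX]] := @wlim_op R HS HS T 1 ler01.
- by move=> n; exact: (gT n).(good_equiv).1.1.
- by move=> n f; rewrite mul1r (gT n).(good_contr).
have bX : isbop X by split=> //; exists 1.
have gX := good_wlim gT bX cX.
have Xm : nsq (hat X) = m.
  apply: le_anti; rewrite hm// andbT.
  suff key (r : R) : 0 < r -> nsq (hat X) <= m + r.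
    by apply/ler_addgt0Pr => r r0; rewrite key.
  move=> r0; rewrite -lee_fin -(nsq_hat bX (good_fin gX)) hsq_esum.
  apply/(esum_leP _ (fun y => nsq_ge0 (X (tens d1 (delta R y))))) => s us.
  have [N hN] := inv_small r0.
  apply: (wlim_sum_nsq_le (N := N) cX) => n Nn.
  move: s us; apply/(esum_leP _ (fun y => nsq_ge0 (T n (tens d1 (delta R y))))).
  rewrite -hsq_esum (nsq_hat (gT n).(good_equiv).1 (good_fin (gT n))) lee_fin.
  by apply: le_trans (hT n).2 _; rewrite lerD2l hN.
exists X; split=> //; split=> [|g K]; first exact: gX.(good_equiv).
pose Y := conjop g X; have gY : good c Y := good_conj g gX.
have fX := good_fin gX; have fY := good_fin gY.
have bY : isbop Y := gY.(good_equiv).1.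
have Ym : nsq (hat Y) = m.
  have h : hsq Y = hsq X := hsq_conj g gX.(good_equiv).
  apply: etrans _ Xm; apply: EFin_inj.
  exact: etrans (esym (nsq_hat bY fY)) (etrans h (nsq_hat bX fX)).
have /hm : good c ((2^-1)%:C *: (X + Y)) := good_mid gX gY.
have fXY : (hsq (X + Y)%R < +oo)%E by exact: hsqD_fin.
rewrite (hatZ _ (isbopD bX bY) fXY).
have -> : hat (X + Y) = hat X + hat Y.
  by have := hatD 1 bX bY fX fY; rewrite !scale1r.
rewrite nsqZ sqabs_real.
move=> hXY; have := parallelogram (hat X) (hat Y); rewrite Xm Ym => hp.
have hp0 : nsq (hat X - hat Y) <= 0.
  by rewrite hp; exact: mid hXY.
have XY0 : forall K, (X + (-1) *: Y) K = 0.
  have e : equivariant (X + (-1) *: Y).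
    exact: equivariantD gX.(good_equiv) (equivariantZ _ gY.(good_equiv)).
  have f : (hsq (X + (-1) *: Y)%R < +oo)%E by apply: hsqD_fin fX _; exact: hsqZ_fin.
  apply: equivariant_eq0 => //; rewrite (nsq_hat e.1 f) hatD// scaleN1r.
  by congr (_%:E); apply: le_anti; rewrite hp0 nsq_ge0.
have XY L : X L = Y L.
  have := XY0 L; rewrite opDE opZE scaleN1r => /eqP; rewrite subr_eq0 => /eqP.
  by [].
rewrite [LHS]XY /Y /conjop /=.
by rewrite (bimul_comp g^-1%g g^-1%g g g) mulVg bimul1.
Qed.

(** The constant [C] is only an a priori bound coming from the rescaling to a projection; [qf_trace]
    later sharpens it to an identity with constant 1. *)
Record diagproj (C : R) P : Prop := Diagproj {
  proj_inv : invariant P;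
  proj_herm : forall K L, inner (P K) L = inner K (P L);
  proj_sym : forall xi eta ze th,
    inner (P (tens xi eta)) (tens ze th) = inner (P (tens th eta)) (tens ze xi);
  proj_idem : forall K, P (P K) = P K;
  proj_trace : forall xi (s : seq Lam), uniq s ->
    \sum_(y <- s) nsq (P (tens xi (delta R y))) <= C * nsq xi;
  proj_neq0 : P (tens d1 d1) <> 0 }.

Lemma diagproj_exists (c : R) : 0 < c ->
  (forall g, exists s, c <= sqabs (u g d1 s) ^+ 2) -> exists C P, diagproj C P.
Proof.
move=> c0 /good_diag[X0 /good_invariant[X [gX iX]]].
have fX := good_fin gX; have [eX cX] := iX; have bX := eX.1.
have hX := gX.(good_herm).
pose K0 := tens d1 d1; pose r := complex.Re (inner (X K0) K0).
have r0 : 0 < r by apply: (lt_le_trans c0); have := gX.(good_low) 1%g; rewrite !u1.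
have rE : inner (X K0) K0 = r%:C.
  apply: complexP => //=; have := congr1 (@complex.Im R) (hX K0 K0).
  by rewrite [X in _ = _ X]innerJ ImJ; move: (complex.Im _) => x; lra.
have XK0 : X K0 <> 0 by move=> h; move: r0; rewrite /r h inner0l ltxx.
have iY : invariant (X \o X).
  by split=> [|g K /=]; [exact: equivariant_comp|rewrite !cX].
have fY : (hsq (X \o X) < +oo)%E.
  apply/hsq_finP; exists 1 => s us; apply: le_trans (gX.(good_hsq) us).
  by apply: ler_sum => y _; exact: gX.(good_contr).
have X0n : nsq (hat X) <> 0.
  by move=> h; apply: XK0; apply: equivariant_eq0 => //; rewrite nsq_hat// h.
(* The coefficient that makes [X \o X - a *: X] orthogonal to [X]; being invariant, this difference
   is zero by [invariant_unique]. *)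
pose a := inner (hat (X \o X)) (hat X) / (nsq (hat X))%:C.
have iZ : invariant ((X \o X) + (- a) *: X).
  split=> [|g K]; first exact: equivariantD iY.1 (equivariantZ _ eX).
  rewrite !opDE !opZE (bopD (isbop_bimul g g).1) (bopZ (isbop_bimul g g).1).
  by rewrite -(cX g K) -(iY.2 g K).
have fZ : (hsq ((X \o X) + (- a) *: X)%R < +oo)%E.
  by apply: hsqD_fin fY _; exact: hsqZ_fin.
have orth : inner (hat X) (hat ((X \o X) + (- a) *: X)) = 0.
  rewrite innerJ (hatD (- a) iY.1.1 bX fY fX) innerDl innerZl inner_nsq mulNr.
  rewrite /a mulfVK ?subrr ?conj0//.
  by apply/eqP => /(congr1 (@complex.Re R)).
have XX K : X (X K) = a *: X K.
  have := invariant_unique iX iZ fX fZ X0n orth K.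
  rewrite opDE opZE scaleNr => /eqP; rewrite subr_eq0 => /eqP.
  by [].
pose b := nsq (X K0) / r.
have b0 : 0 < b.
  rewrite divr_gt0// lt_neqAle nsq_ge0 andbT eq_sym; apply/eqP => h.
  exact/XK0/nsq_eq0.
have aE : a = b%:C.
  have := hX (X K0) K0; rewrite XX innerZl rE inner_nsq => h.
  apply: (mulIf (_ : r%:C != 0)).
    by apply/eqP => /(congr1 (@complex.Re R)) /= h'; move: r0; rewrite h' ltxx.
  by rewrite h -rmorphM /= /b mulfVK// gt_eqF.
have bK : (b^-1)%:C * b%:C = 1 :> R[i] by rewrite -rmorphM /= mulVf// gt_eqF.
pose P := (b^-1)%:C *: X.
have PE K : P K = (b^-1)%:C *: X K by rewrite /P opZE.
have Pid K : P (P K) = P K.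
  by rewrite !PE (bopZ bX.1) XX aE [(b^-1)%:C *: (b%:C *: _)]scalerA bK scale1r.
have Ph K L : inner (P K) L = inner K (P L).
  by rewrite !PE innerZl innerZr conj_real hX.
exists b^-1, P; split=> //.
- split=> [|g K]; first exact: equivariantZ.
  by rewrite !PE cX (bopZ (isbop_bimul g g).1).
- by move=> xi eta ze th; rewrite !PE !innerZl gX.(good_sym).
- move=> xi s us; apply: le_trans (_ : \sum_(y <- s) b^-1 * complex.Re (inner
      (X (tens xi (delta R y))) (tens xi (delta R y))) <= _).
    apply: ler_sum => y _; rewrite nsq_Re Ph Pid -Ph PE innerZl ReZ.
    by [].
  rewrite -mulr_sumr ler_wpM2l ?invr_ge0 ?(ltW b0)//.
  exact: gX.(good_trace) (isonb_delta R Lam) xi s us.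
- move=> h; apply: XK0; rewrite -[X K0]scale1r -bK mulrC -scalerA -PE h scaler0.
  by [].
Qed.

(** The coefficients of [N d1] in the basis [u h d1] are constant on conjugacy classes, so icc
    leaves only the one at 1. *)
Lemma factor_scalar N : vn N -> (forall g f, N (u g f) = u g (N f)) ->
  exists c : R[i], forall f, N f = c *: f.
Proof.
move=> vN cN; pose f := coefs (fun g => u g d1) (N d1).
have fE h : f h = inner (N d1) (u h d1) by rewrite /f (coefsE uonb.1).
have finv h g : f (h ^ g)%g = f h.
  have Uh : vn (u h^-1%g \o N) by exact: vn_comp.
  have ad : isadj (u g) (u g^-1%g) by split; [exact: (vu _).1|exact: uadj].
  have := trace_conj Uh (vu g) ad (uVK g).
  rewrite /= !fE => e.
  have e1 : inner (N d1) (u h d1) = inner (u h^-1%g (N d1)) d1 by rewrite uadj invgK.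
  by rewrite e1 -e uadj invgK cN uadj !uM /conjg mulgA.
exists (f 1%g) => k.
have h0 h : h <> 1%g -> f h = 0.
  by move=> h1; apply: icc_ell2_eq0 => // g; rewrite finv.
have e : N = f 1%g *: idfun.
  apply: vn_ext => //; first exact/vnZ/vn_id.
  apply: (onb_ext uonb) => h; rewrite -fE opZE innerZl.
  have := uonb.1 1%g h; rewrite /= u1 => ->.
  have [<-|/eqP h1] := eqVneq 1%g h; first by rewrite mulr1.
  by rewrite mulr0 h0// => h1'; apply: h1.
by rewrite {1}e opZE.
Qed.

(** * The quadratic form of the projection and its Gram vectors *)

Section projection.
Variables (C : R) (P : operator R HS).
Hypothesis hP : diagproj C P.

Let bP : isbop P := hP.(proj_inv).1.1.
Let lP : linear P := bP.1.
Let Ph := hP.(proj_herm).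
Let Pid := hP.(proj_idem).

(** For the projection onto the diagonal kernels this is the sum over [s] of
    [sqabs (a s) * sqabs (h s)]. *)
Definition qf a h : R := nsq (P (tens a h)).

Lemma projE K : inner (P K) K = (nsq (P K))%:C.
Proof. by rewrite -inner_nsq [RHS]Ph Pid Ph. Qed.

Lemma proj_contr K : nsq (P K) <= nsq K.
Proof.
have := Re_inner_half (P K) K; rewrite projE /=; lra.
Qed.

(** [proj_sym] exchanges two of the four legs and turns the left side into the pairing of
    [P (tens h a)] with [tens h a]. *)
Lemma qf_inner a h : inner (P (tens a a)) (tens h h) = (qf a h)%:C.
Proof.
have e x y : inner (P (tens y y)) (tens x x) = (qf x y)%:C.
  by rewrite -hP.(proj_sym) projE.
by rewrite Ph innerJ e conj_real.
Qed.

Lemma qf_sym a h : qf a h = qf h a.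
Proof.
have := qf_inner a h; rewrite Ph innerJ qf_inner conj_real => /(congr1 (@complex.Re R)).
by [].
Qed.

Lemma qf_ge0 a h : 0 <= qf a h. Proof. exact: nsq_ge0. Qed.

Lemma qf_le a h : qf a h <= nsq a * nsq h.
Proof. by rewrite -nsq_tens; exact: proj_contr. Qed.

Lemma qfZ a (z : R[i]) h : qf a (z *: h) = sqabs z * qf a h.
Proof. by rewrite /qf tensZr (bopZ lP) nsqZ sqabsJ. Qed.

Definition Vop xi : ell2 R Lam -> ell2 R HS := fun z => P (tens z xi).

Lemma isbop_Vop xi : isbop (Vop xi).
Proof.
split=> [a f h|]; first by rewrite /Vop tensDl tensZl lP.
by exists (nsq xi) => [|f]; rewrite ?nsq_ge0// mulrC qf_le.
Qed.

Definition Vadj xi := projT1 (cid (isadj_exists (isbop_Vop xi))).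

Lemma VadjP xi : isadj (Vop xi) (Vadj xi).
Proof. exact: projT2 (cid (isadj_exists (isbop_Vop xi))). Qed.

Lemma nsq_Vop xi z : nsq (Vop xi z) = qf xi z.
Proof. by rewrite qf_sym. Qed.

(* The analysis operator [xi |-> (P (xi delta_y^* ))_y]; its Gram operator commutes with
   all [u_g] and all right translations, hence is a scalar. *)
Definition Wop xi : ell2 R (Lam * HS)%type :=
  toell2 (fun p => P (tens xi (delta R p.1)) p.2).

Lemma Wop_esum xi : (\esum_(p in [set: (Lam * HS)%type])
    (sqabs (P (tens xi (delta R p.1)) p.2))%:E =
  \esum_(y in [set: Lam]) (qf xi (delta R y))%:E)%E.
Proof.
rewrite esum_pair => [|p]; last by rewrite lee_fin sqabs_ge0.
by apply: eq_esum => y _; rewrite -nsqE.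
Qed.

Lemma qf_esum_le xi : (\esum_(y in [set: Lam]) (qf xi (delta R y))%:E <= (C * nsq xi)%:E)%E.
Proof.
by apply/(esum_leP _ (fun y => qf_ge0 xi (delta R y))) => s us; exact: hP.(proj_trace).
Qed.

Lemma WopE xi p : Wop xi p = P (tens xi (delta R p.1)) p.2.
Proof.
rewrite toell2E//; apply/square_summableP; rewrite Wop_esum.
by apply: le_lt_trans (qf_esum_le xi) _; exact: ltry.
Qed.

Lemma nsq_Wop xi : (\esum_(y in [set: Lam]) (qf xi (delta R y))%:E = (nsq (Wop xi))%:E)%E.
Proof. by rewrite -nsqE -Wop_esum; apply: eq_esum => p _; rewrite WopE. Qed.

Lemma isbop_Wop : isbop Wop.
Proof.
split=> [a f h|].
  by apply: ell2P => p; rewrite !ell2E !WopE tensDl tensZl lP !ell2E.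
have C0 : 0 <= C.
  have := hP.(proj_trace) d1 (isT : uniq [::]).
  by rewrite big_nil nsq_delta mulr1.
by exists C => // f; rewrite -lee_fin -nsq_Wop; exact: qf_esum_le.
Qed.

Lemma nsq_Wop_onb (e : Lam -> ell2 R Lam) xi : isonb e ->
  (\esum_(y in [set: Lam]) (qf xi (e y))%:E = (nsq (Wop xi))%:E)%E.
Proof. by move=> oe; rewrite -nsq_Wop; exact: hs_onb. Qed.

Lemma nsq_Wop_u g xi : nsq (Wop (u g xi)) = nsq (Wop xi).
Proof.
have h := nsq_Wop_onb (u g xi) (u_onb g (isonb_delta R Lam)).
apply/EFin_inj/(etrans (esym h))/(etrans _ (nsq_Wop xi)).
apply: eq_esum => y _; congr (_%:E).
by rewrite /qf -bimul_tens hP.(proj_inv).2 nsq_bimul.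
Qed.

Lemma nsq_Wop_rtr t xi : nsq (Wop (rtr t xi)) = nsq (Wop xi).
Proof.
have oe : isonb (fun y => rtr t (delta R y)).
  apply: isonb_unitary (isonb_delta R Lam) (inner_rtr t) _ _ => f.
    by rewrite rtrM mulVg rtr1.
  by rewrite rtrM mulgV rtr1.
have h := nsq_Wop_onb (rtr t xi) oe.
apply/EFin_inj/(etrans (esym h))/(etrans _ (nsq_Wop xi)).
apply: eq_esum => y _; congr (_%:E).
by rewrite /qf -birtr_tens hP.(proj_inv).1.2 nsq_birtr.
Qed.

(** The sum is the squared norm of [Wop xi]. It is unchanged under [u g] and [rtr t], because these
    only change the orthonormal basis used for the second leg, so the Gram operator of [Wop] is
    scalar. *)
Lemma trace_const : exists c1 : R, forall xi,
  (\esum_(y in [set: Lam]) (qf xi (delta R y))%:E = (c1 * nsq xi)%:E)%E.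
Proof.
have [W' WW'] := isadj_exists isbop_Wop.
have bN : isbop (W' \o Wop) := isbop_comp WW'.1 isbop_Wop.
have [|g f|c hc] := @factor_scalar (W' \o Wop).
- split=> // t f; apply: (gram_commute WW' isbop_Wop (isbop_rtr R t) (inner_rtr t)).
    by move=> h; rewrite rtrM mulgV rtr1.
  exact: nsq_Wop_rtr.
- exact: (gram_commute WW' isbop_Wop (vu g).1 (uadj g) (uVK g) (nsq_Wop_u g)).
exists (complex.Re c) => xi; rewrite nsq_Wop; congr (_%:E).
have := hc xi => /(congr1 (fun v => complex.Re (inner v xi))).
rewrite /= innerZl innerJ -WW'.2 -innerJ inner_nsq inner_nsq cReM /= => ->.
by rewrite mulr0 subr0.
Qed.

(* [P (xi xi^* )] is the sum of the rank-one kernels of the vectors [gram xi p]. *)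
Definition gram xi (p : HS) : ell2 R Lam := Vadj xi (delta R p).

Lemma gram_coef xi z p : inner z (gram xi p) = P (tens z xi) p.
Proof. by rewrite -((VadjP xi).2 z) inner_delta. Qed.

Lemma gram_parseval xi z :
  (\esum_(p in [set: HS]) (sqabs (inner z (gram xi p)))%:E = (qf xi z)%:E)%E.
Proof.
by rewrite -nsq_Vop -nsqE; apply: eq_esum => p _; rewrite gram_coef.
Qed.

Lemma gram_nsq xi : (\esum_(p in [set: HS]) (nsq (gram xi p))%:E =
  \esum_(y in [set: Lam]) (qf xi (delta R y))%:E)%E.
Proof.
under eq_esum do rewrite -nsqE.
rewrite esum_swap; last by move=> *; rewrite lee_fin sqabs_ge0.
apply: eq_esum => y _; rewrite -gram_parseval; apply: eq_esum => p _.
by rewrite delta_inner sqabsJ.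
Qed.

Lemma normc_inner_tens K (x : ell2 R Lam) : normc (inner K (tens x x)) <= ell2_norm K * nsq x.
Proof.
rewrite -ler_sqr ?nnegrE ?normc_ge0 ?mulr_ge0 ?nsq_ge0 ?ell2_norm_ge0//.
rewrite -sqabs_normc exprMn ell2_norm_sq expr2 -nsq_tens; exact: cauchy_schwarz.
Qed.

(** Both sides are bounded functionals of [K], the right one because the Gram vectors have summable
    squared norms; it remains to compare them on matrix units. *)
Lemma gram_sum xi K : inner K (P (tens xi xi)) =
  complex_sum (fun p => inner K (tens (gram xi p) (gram xi p))).
Proof.
have [c1 hc1] := trace_const.
have [sg rg] := asummable_ge0 (fun p => nsq_ge0 (gram xi p)) (etrans (gram_nsq xi) (hc1 xi)).
have sK (K' : ell2 R HS) : asummable (fun p => ell2_norm K' * nsq (gram xi p)) by exact: asummableZ.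
have cK (K' : ell2 R HS) : csummable (fun p => inner K' (tens (gram xi p) (gram xi p))).
  rewrite /csummable; apply: asummable_le (sK K') => p.
  by rewrite ger0_norm ?normc_ge0// (le_trans (normc_inner_tens _ _))// ler_norm.
pose F (L : ell2 R HS) := inner L (P (tens xi xi)).
pose F' (L : ell2 R HS) := complex_sum (fun p => inner L (tens (gram xi p) (gram xi p))).
apply: (_ : F =1 F'); apply: bfunctional_ext => [||[x y]].
- exact: bfunctional_inner.
- split=> [a f h|].
    rewrite /F' -complex_sumZ// -complex_sumD//; last exact: csummableZ.
    by apply: eq_complex_sum => p; rewrite innerDl innerZl.
  exists (2 * (c1 * nsq xi) ^+ 2) => f.
  have := complex_sum_bound (fun p => normc_inner_tens f (gram xi p)) (sK f).
  by rewrite real_sumZ// rg exprMn ell2_norm_sq mulrAC mulrA.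
rewrite -tens_delta /F /F'.
transitivity (inner (Vop xi (delta R x)) (Vop xi (delta R y))).
  (* Alternating the symmetry with self-adjointness moves the two copies of [xi] into the second
     legs, where [P] acts as [Vop xi]. *)
  have s := hP.(proj_sym); set dx := delta R x; set dy := delta R y.
  rewrite -(Ph (tens dx dy) (tens xi xi)) (s dx dy xi xi).
  rewrite (Ph (tens xi dy) (tens xi dx)) innerJ (s xi dx xi dy) -innerJ.
  rewrite -(Ph (tens xi xi) (tens dy dx)) (s xi xi dy dx).
  by rewrite /Vop -(Ph (P (tens dx xi)) (tens dy xi)) Pid.
rewrite innerE; apply: eq_complex_sum => p.
by rewrite inner_tens gram_coef [inner (gram _ _) _]innerJ gram_coef.
Qed.

(** Pair the decomposition of [P (tens xi xi)] into rank-one kernels with [P (tens a a)]. *)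
Lemma qf_gram a xi :
  (\esum_(p in [set: HS]) (qf a (gram xi p))%:E = (qf a xi)%:E)%E.
Proof.
have [c1 hc1] := trace_const.
have [sg rg] := asummable_ge0 (fun p => nsq_ge0 (gram xi p)) (etrans (gram_nsq xi) (hc1 xi)).
have sq : asummable (fun p => qf a (gram xi p)).
  apply: asummable_le (asummableZ (nsq a) sg) => p.
  by rewrite !ger0_norm ?mulr_ge0 ?nsq_ge0// qf_le.
have := gram_sum xi (P (tens a a)); rewrite -Ph Pid qf_inner.
under eq_complex_sum do rewrite qf_inner.
move=> /(congr1 (@complex.Re R)) /=; rewrite real_sum_ge0E => [->|p]; last exact: qf_ge0.
by rewrite ge0_esum_fin// => p; exact: qf_ge0.
Qed.

(** Expanding each term of the trace at [d1] by [qf_gram] and exchanging the sums gives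
    [c1 = c1 * c1], and [proj_neq0] excludes 0. *)
Lemma qf_trace xi : (\esum_(y in [set: Lam]) (qf xi (delta R y))%:E = (nsq xi)%:E)%E.
Proof.
have [c1 hc1] := trace_const.
suff c11 : c1 = 1 by rewrite hc1 c11 mul1r.
have gn x := asummable_ge0 (fun p => nsq_ge0 (gram x p)) (etrans (gram_nsq x) (hc1 x)).
have cc : c1 = c1 * c1.
  apply: EFin_inj; have := hc1 d1; rewrite nsq_delta mulr1 => <-.
  under eq_esum do rewrite qf_sym -qf_gram.
  rewrite esum_swap; last by move=> *; rewrite lee_fin qf_ge0.
  under eq_esum do under eq_esum do rewrite qf_sym.
  under eq_esum do rewrite hc1.
  have c10 : 0 <= c1.
    rewrite -lee_fin -[c1]mulr1 -(nsq_delta R (1%g : Lam)) -hc1.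
    by apply: esum_ge0 => y _; rewrite lee_fin qf_ge0.
  have [sg rg] := gn d1.
  rewrite ge0_esum_fin; last 2 first.
  - by move=> p; rewrite mulr_ge0 ?nsq_ge0.
  - exact: asummableZ.
  rewrite fine_esumZ//; last by move=> p; exact: nsq_ge0.
  by rewrite gram_nsq hc1 /= nsq_delta mulr1.
have c1n : c1 != 0.
  apply/eqP => c0; apply: hP.(proj_neq0); apply: nsq_le0.
  rewrite -/(qf d1 d1); have [h _] := esum_leP 0 (fun y => qf_ge0 d1 (delta R y)).
  by have := h; rewrite hc1 c0 mul0r => /(_ (lexx _) [:: 1%g] isT); rewrite big_seq1.
by apply: (mulIf c1n); rewrite mul1r -cc.
Qed.

Lemma gram_trace xi : (\esum_(p in [set: HS]) (nsq (gram xi p))%:E = (nsq xi)%:E)%E.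
Proof. by rewrite gram_nsq qf_trace. Qed.

(** * Rank-one projections *)

Definition maxq a (l : R) := forall w, qf a w <= l * nsq w.

(** The positive operator [Vadj a \o Vop a] is bounded by [l], so a vector where its form attains
    [l] is an eigenvector. *)
Lemma eigE a l z : maxq a l -> qf a z = l * nsq z -> Vadj a (Vop a z) = l%:C *: z.
Proof.
move=> hl hz; apply/eqP; rewrite -subr_eq0; apply/eqP/nsq_le0.
have l0 : 0 <= l.
  by have := hl d1; rewrite nsq_delta mulr1; apply: le_trans; exact: qf_ge0.
have VV h : nsq (Vop a h) <= l * nsq h by rewrite nsq_Vop.
have h1 := isadj_bound l0 (VadjP a) VV (Vop a z).
have h2 : inner (Vadj a (Vop a z)) z = (qf a z)%:C.
  by rewrite innerJ -((VadjP a).2 z) -innerJ inner_nsq nsq_Vop.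
rewrite nsqB nsqZ sqabs_real innerZr conj_real ReZ h2 /=.
move: h1; rewrite nsq_Vop hz; move: (nsq (Vadj _ _)) (nsq z) => p q; nra.
Qed.

Lemma eig_qf a l z : Vadj a (Vop a z) = l%:C *: z -> qf a z = l * nsq z.
Proof.
move=> h; rewrite -nsq_Vop nsq_Re ((VadjP a).2 z) h innerZr conj_real ReZ.
by rewrite -nsq_Re.
Qed.

(* The left-hand side is at most the right-hand side, and their sums over [p] agree
   by [qf_gram] and [gram_trace]. *)
Lemma eig_gram a l xi p : maxq a l -> qf a xi = l * nsq xi ->
  qf a (gram xi p) = l * nsq (gram xi p).
Proof.
move=> hl hxi; have hh := asummable_ge0 (fun p => nsq_ge0 (gram xi p)) (gram_trace xi).
have l0 : 0 <= l.
  by have := hl d1; rewrite nsq_delta mulr1; apply: le_trans; exact: qf_ge0.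
have [sq rq] := asummable_ge0 (fun p => qf_ge0 a (gram xi p)) (qf_gram a xi).
have sN : asummable (fun p => - qf a (gram xi p)).
  by apply: asummable_le sq => g; rewrite normrN.
have sl := asummableZ l hh.1.
pose d p := l * nsq (gram xi p) - qf a (gram xi p).
have d0 p' : 0 <= d p' by rewrite subr_ge0.
have sd : asummable d := asummableD sl sN.
have rd : real_sum d = 0.
  rewrite /d real_sumD// real_sumN rq real_sumZ ?hh.2 ?hxi ?subrr//; exact: hh.1.
have := real_sum_ge0E d0; rewrite rd => f0.
have e0 := ge0_esum_fin d0 sd; rewrite -f0 in e0.
have [h _] := esum_leP 0 d0.
have := h; rewrite e0 => /(_ (lexx _) [:: p] isT); rewrite big_seq1.
by move=> /(conj (d0 p)) /andP /le_anti; rewrite /d => /eqP; rewrite eq_sym subr_eq0 => /eqP.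
Qed.

(** By [eig_gram] the Gram vectors of [xi] lie in the top eigenspace of [a], and they are the values
    of [Vadj xi] at the deltas. *)
Lemma eig_range a l xi K : maxq a l -> qf a xi = l * nsq xi ->
  Vadj a (Vop a (Vadj xi K)) = l%:C *: Vadj xi K.
Proof.
move=> hl hxi; have bx := (VadjP xi).1.
have bA : isbop (Vadj a \o Vop a) := isbop_comp (VadjP a).1 (isbop_Vop a).
have e : (Vadj a \o Vop a) \o Vadj xi = l%:C *: Vadj xi.
  apply: isbop_ext => [||p]; first exact: isbop_comp.
    exact: isbopZ.
  by rewrite opZE; exact: eigE hl (eig_gram p hl hxi).
by have := congr1 (fun T => T K) e; rewrite opZE.
Qed.

(** By [qf_inner] the form is a pairing of [tens z z] with a fixed kernel, and such tensors converge
    weakly along bounded weakly convergent sequences. *)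
Lemma qf_usc a (z : nat -> ell2 R Lam) z' : (forall n, nsq (z n) <= 1) ->
  (forall h, ucvg (fun n => inner (z n) h) (inner z' h)) ->
  ucvg (fun n => (qf a (z n))%:C) (qf a z')%:C.
Proof.
move=> z1 hz; rewrite -qf_inner innerJ.
apply: eq_ucvg (ucvgJ (wlim_tens (P (tens a a)) z1 z1 hz hz)) => n.
by rewrite -innerJ qf_inner.
Qed.

(** Weak continuity gives a maximizer on the unit ball. The maximum is positive because the trace
    [nsq a] is, and this forces the maximizer onto the sphere. *)
Lemma maxq_exists (a : ell2 R Lam) : a <> 0 -> exists (l : R) (z : ell2 R Lam),
  [/\ 0 < l, maxq a l, nsq z = 1 & qf a z = l].
Proof.
move=> a0; pose A (z : ell2 R Lam) := nsq z <= 1.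
have [||l [hl near]] := @sup_seq R _ A (qf a) (nsq a).
- by exists 0; rewrite /A nsq0.
- move=> z z1; apply: le_trans (qf_le a z) _.
  by rewrite -[leRHS]mulr1 ler_wpM2l ?nsq_ge0.
have [z hz] := choice near.
have [z' [z'1 cz]] := wlim (fun n => (hz n).1).
have lz : qf a z' = l.
  apply: le_anti; rewrite hl//=.
  suff key (r : R) : 0 < r -> l - r <= qf a z'.
    by apply/ler_addgt0Pr => r r0; have := key r r0; lra.
  move=> r0; have [N hN] := inv_small r0.
  apply: (@ucvg_Re_ge _ _ _ _ N) (qf_usc a (fun n => (hz n).1) cz) => n Nn /=.
  by apply: le_trans (hz n).2; rewrite lerD2l lerN2 hN.
have mx : maxq a l.
  move=> w; have [->|/eqP w0] := eqVneq w 0.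
    by rewrite /qf nsq0 mulr0 (_ : tens a 0 = 0) ?(bop0 lP) ?nsq0//;
      rewrite -[0 in LHS](scale0r 0) tensZr conj0 scale0r.
  have [c hc] := normalize w0.
  have := hl (c%:C *: w); rewrite /A nsqZ hc qfZ => /(_ (lexx _)) h.
  have := nsq_ge0 w; move: h hc; move: (sqabs _) (nsq w) (qf a w) => p q s ps pq q0.
  by rewrite -[s]mul1r -pq mulrAC [leRHS]mulrC [leRHS]mulrC ler_wpM2r.
have l0 : 0 < l.
  rewrite lt_neqAle -{2}lz qf_ge0 andbT; apply/eqP => l0; apply/a0/nsq_eq0.
  apply: EFin_inj; rewrite -qf_trace esum1// => y _; congr (_%:E).
  by apply: le_anti; rewrite qf_ge0 andbT; have := mx (delta R y); rewrite -l0 mul0r.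
exists l, z'; split=> //; apply: le_anti; rewrite z'1 /=.
by have := mx z'; rewrite lz -{1}[l]mulr1 ler_pM2l.
Qed.

Lemma eigD a l x y c : maxq a l -> qf a x = l * nsq x -> qf a y = l * nsq y ->
  qf a (x + c *: y) = l * nsq (x + c *: y).
Proof.
move=> hl /(eigE hl) hx /(eigE hl) hy; apply: eig_qf.
rewrite (bopD (isbop_Vop a).1) (bopZ (isbop_Vop a).1).
rewrite (bopD (VadjP a).1.1) (bopZ (VadjP a).1.1) hx hy scalerDr !scalerA.
by rewrite mulrC.
Qed.

(* Maximize [qf xi xi] over the unit sphere of a top eigenspace, which is weakly
   compact because [qf a] is weakly continuous. *)
Lemma max_diag_exists a l z : 0 < l -> maxq a l -> nsq z = 1 -> qf a z = l ->
  exists xi, [/\ nsq xi = 1, qf a xi = l &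
    forall w, qf a w = l * nsq w -> qf w w <= qf xi xi * nsq w ^+ 2].
Proof.
move=> l0 mx z1 zl; pose A (w : ell2 R Lam) := nsq w = 1 /\ qf a w = l.
have [||M [hM near]] := @sup_seq R _ A (fun w => qf w w) 1.
- by exists z.
- by move=> w [w1 _]; apply: le_trans (qf_le w w) _; rewrite w1 mulr1.
have [x hx] := choice near.
have x1 n : nsq (x n) <= 1 by rewrite (hx n).1.1.
have [x' [x'1 cx]] := wlim x1.
have lx : qf a x' = l.
  have h := qf_usc a x1 cx.
  have := ucvg_unique h (eq_ucvg (fun n => congr1 (real_complex R) (esym (hx n).1.2)) (ucvg_cst l%:C)).
  by move=> /(congr1 (@complex.Re R)).
have nx : nsq x' = 1.
  by apply: le_anti; rewrite x'1 /=; have := mx x'; rewrite lx -{1}[l]mulr1 ler_pM2l.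
pose T n := tens (x n) (x n); pose T' := tens x' x'.
have T1 n : nsq (T n) = 1 by rewrite nsq_tens (hx n).1.1 mulr1.
have T'1 : nsq T' = 1 by rewrite nsq_tens nx mulr1.
have cT K : ucvg (fun n => inner (T n) K) (inner T' K) by exact: wlim_tens.
have Mx : M <= qf x' x'.
  suff key (r : R) : 0 < r -> M - r <= qf x' x'.
    by apply/ler_addgt0Pr => r r0; have := key r r0; lra.
  move=> r0; have [N hN] := inv_small r0.
  have two := ucvg_cst (2%:C : R[i]).
  (* Here [qf w w] is the squared norm of [P (tens w w)], only lower semicontinuous as such. But the
     squared norm of [(1 - P) (tens w w)] is lower semicontinuous too and all tensors have norm 1,
     so the maximum persists in the limit. *)
  have c1 := ucvgB (ucvgZ 2%:C (cT (P T'))) (ucvgZ 2%:C (cT T')).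
  have := ucvg_Re_ge (C := M - r - 2 + qf x' x') (N := N) _ c1.
  rewrite ReB !ReZ -[inner T' (P T')]Ph projE inner_nsq /= T'1 -/(qf x' x') => h.
  suff : M - r - 2 + qf x' x' <= 2 * qf x' x' - 2 * 1 by lra.
  apply: h => n Nn; rewrite ReB !ReZ.
  have h1 : M - r <= qf (x n) (x n).
    by apply: le_trans (hx n).2; rewrite lerD2l lerN2 hN.
  have h2 := proj_contr (T n - T').
  move: h2; rewrite (bopB lP) !nsqB T1 T'1 -/(qf (x n) (x n)) -/(qf x' x') [inner (P _) _]Ph Pid.
  move: h1; move: (complex.Re _) (complex.Re _) (qf _ _) (qf _ _) => p q s t; lra.
have E : M = qf x' x' by apply: le_anti; rewrite Mx hM.
exists x'; split=> // w hw; have [->|/eqP w0] := eqVneq w 0.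
  have -> : qf 0 0 = 0 by apply: le_anti; rewrite qf_ge0 andbT (le_trans (qf_le 0 0))// nsq0 mulr0.
  by rewrite nsq0 expr0n mulr0.
have [c hc] := normalize w0.
have := hM (c%:C *: w); rewrite /A nsqZ hc qfZ hw mulrCA hc mulr1 => /(_ (conj erefl erefl)).
rewrite qfZ qf_sym qfZ E.
have := nsq_ge0 w; move: hc; move: (sqabs _) (nsq w) (qf w w) (qf x' x') => p q s t.
move=> pq q0 h; have -> : s = (p * (p * s)) * q ^+ 2.
  by rewrite mulrA mulrAC -expr2 -exprMn pq expr1n mul1r.
by rewrite ler_wpM2r ?sqr_ge0.
Qed.

(** Take [xi] maximizing [qf w w] in a top eigenspace. Its own top eigenspace lies inside that one,
    and maximality forces it to be the line of [xi]. All Gram vectors of [xi] are then multiples of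
    [xi], and the trace identity gives [qf xi xi = 1]. *)
Lemma rank_one_exists : exists xi, nsq xi = 1 /\ P (tens xi xi) = tens xi xi.
Proof.
have d0 : d1 <> 0 by move=> h; have := nsq_delta R (1%g : Lam); rewrite h nsq0; lra.
have [l [z [l0 mx z1 zl]]] := maxq_exists d0.
have [xi [x1 xl hxi]] := max_diag_exists l0 mx z1 zl.
have xe : qf d1 xi = l * nsq xi by rewrite x1 mulr1.
have xi0 : xi <> 0 by move=> h; move: x1; rewrite h nsq0; lra.
have [l2 [z2 [l20 mx2 z21 z2l]]] := maxq_exists xi0.
pose K := P (tens xi xi); set M := qf xi xi.
have nK : nsq K = M by [].
have sub w : qf xi w = l2 * nsq w -> qf d1 w = l * nsq w.
  move=> hw; have w2 := eigE mx2 hw.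
  have -> : w = (l2^-1)%:C *: Vadj xi (Vop xi w).
    by rewrite w2 scalerA -rmorphM /= mulVf ?gt_eqF// scale1r.
  apply: eig_qf; rewrite (bopZ (isbop_Vop d1).1) (bopZ (VadjP d1).1.1) (eig_range _ mx xe).
  by rewrite !scalerA mulrC.
have KP w : inner K (P (tens w w)) = (qf xi w)%:C by rewrite -Ph Pid qf_inner.
(* Cauchy-Schwarz for [K] and [P (tens z2 z2)], both of squared norm at most [M]. *)
have l2M : l2 = M.
  have M0 : M <= l2 by have := mx2 xi; rewrite x1 mulr1.
  apply: le_anti; rewrite M0 andbT.
  have e2 : qf xi z2 = l2 * nsq z2 by rewrite z21 mulr1.
  have h1 := hxi z2 (sub z2 e2); rewrite z21 expr1n mulr1 in h1.
  have h2 := cauchy_schwarz K (P (tens z2 z2)).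
  rewrite KP z2l sqabs_real nK -/(qf z2 z2) in h2.
  have Mge0 : 0 <= M := qf_ge0 xi xi.
  move: h1 h2; rewrite -/M; move: (qf z2 z2) => t; nra.
(* This is the equality case of the same Cauchy-Schwarz inequality. *)
have diagE w : qf xi w = M * nsq w -> P (tens w w) = (nsq w)%:C *: K.
  rewrite -l2M => hw; apply/eqP; rewrite -subr_eq0; apply/eqP/nsq_le0.
  rewrite nsqB nsqZ sqabs_real innerZr conj_real ReZ -ReinnerC KP /= hw nK l2M.
  have := hxi w (sub w hw); rewrite -/M -/(qf w w).
  move: (qf w w) (nsq w) => p q; nra.
have mxM : maxq xi M by rewrite -l2M.
have xM : qf xi xi = M * nsq xi by rewrite x1 mulr1.
have l2_0 : 0 < M by rewrite -l2M.
have orth w : qf xi w = M * nsq w -> inner w xi = 0 -> w = 0.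
  move=> hw ox.
  (* Expand [diagE] at [xi + c w]; the values [c = 1] and [c = i] separate the two cross terms, and
     each vanishes. *)
  have pol c : sqabs c = 1 -> c^* *: P (tens xi w) + c *: P (tens w xi) = 0.
    move=> c1; have hc := diagE _ (eigD c mxM xM hw).
    have nc : nsq (xi + c *: w) = 1 + nsq w.
      by rewrite nsqD nsqZ c1 mul1r x1 innerZr innerJ ox conj0 mulr0 /= mulr0 addr0.
    have ec : tens (xi + c *: w) (xi + c *: w) =
        tens xi xi + c^* *: tens xi w + (c *: tens w xi + (c * c^*) *: tens w w).
      by rewrite tensDr !tensDl !tensZr !tensZl scalerA addrACA ?[c^* * _]mulrC.
    rewrite nc ec sqabsE c1 scale1r !(bopD lP) !(bopZ lP) (diagE _ hw) -/K in hc.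
    apply: (addIr (K + (nsq w)%:C *: K)); rewrite add0r addrACA [_ + K]addrC.
    by rewrite hc rmorphD /= scalerDl scale1r.
  have h1 := pol 1 (sqabs1 R); rewrite conj1 !scale1r in h1.
  have hi := pol (Complex 0 1) _.
  have si : sqabs (Complex 0 1 : R[i]) = 1 by rewrite /sqabs /= expr0n expr1n add0r.
  have {}hi := hi si.
  have ci : (Complex 0 1 : R[i])^* = - (Complex 0 1) by apply: complexP => /=; rewrite ?oppr0.
  rewrite ci (_ : P (tens xi w) = - P (tens w xi)) in hi; last by apply/eqP; rewrite -addr_eq0 h1.
  rewrite scalerN scaleNr opprK -scalerDl in hi.
  have P0 : P (tens w xi) = 0.
    apply: nsq_eq0; have := congr1 (fun v => nsq v) hi; rewrite nsqZ nsq0 => /eqP.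
    rewrite mulf_eq0 => /orP[|/eqP //].
    by rewrite /sqabs /= => /eqP; lra.
  have e : M * nsq w = 0 by rewrite -hw qf_sym /qf P0 nsq0.
  by apply: nsq_eq0; apply: (mulfI (lt0r_neq0 l2_0)); rewrite e mulr0.
have line w : qf xi w = M * nsq w -> w = inner w xi *: xi.
  move=> hw; have h := eigD (- inner w xi) mxM hw xM.
  have := orth _ h; rewrite innerDl innerZl inner_nsq x1 mulr1 subrr => /(_ erefl) /eqP.
  by rewrite scaleNr subr_eq0 => /eqP.
have M1 : M = 1.
  apply: EFin_inj; rewrite -gram_parseval -x1 -gram_trace; apply: eq_esum => p _.
  rewrite innerJ sqabsJ; congr (_%:E); have hp := line _ (eig_gram p mxM xM).
  have := congr1 (fun v => nsq v) hp; rewrite nsqZ x1 mulr1 => ->.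
  by [].
exists xi; split=> //; apply/eqP; rewrite -subr_eq0; apply/eqP/nsq_le0.
by rewrite nsqB projE nsq_tens x1 -/K nK M1 /=; lra.
Qed.

(** Fixing [tens x x] makes [P] kill [tens w x] for [w] orthogonal to [x], so
    [P (tens y x) = inner y x *: tens x x]. Evaluating against the fixed kernel [tens y y] in two
    ways gives [inner y x * sqabs (inner x y) = inner y x]. *)
Lemma rank_one_dichotomy x y : nsq x = 1 -> nsq y = 1 ->
  P (tens x x) = tens x x -> P (tens y y) = tens y y ->
  inner x y = 0 \/ sqabs (inner x y) = 1.
Proof.
move=> x1 y1 Px Py.
have mx : maxq x 1.
  by move=> w; rewrite mul1r; apply: le_trans (qf_le x w) _; rewrite x1 mul1r.
have qx w : qf x w = sqabs (inner w x).
  by apply: complexI; rewrite -qf_inner Px inner_tens -sqabsE innerJ mulrC.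
pose w := y - inner y x *: x.
have ow : inner w x = 0 by rewrite /w innerBl innerZl inner_nsq x1 mulr1 subrr.
have Pw : P (tens w x) = 0.
  by apply: nsq_eq0; rewrite -/(qf w x) qf_sym qx ow sqabs0.
have Pyx : P (tens y x) = inner y x *: tens x x.
  have ey : y = w + inner y x *: x by rewrite subrK.
  by rewrite {1}ey tensDl tensZl (bopD lP) (bopZ lP) Pw Px add0r.
have e1 := Ph (tens y x) (tens y y).
rewrite Pyx Py innerZl !inner_tens inner_nsq y1 mul1r in e1.
have [e0|/eqP e0] := eqVneq (inner y x) 0; first by left; rewrite innerJ e0 conj0.
right; rewrite innerJ sqabsJ; apply: complexI; rewrite -sqabsE -innerJ mulrC.
by apply: (mulfI (introN eqP e0)); rewrite e1 rmorph1 mulr1.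
Qed.

End projection.

Lemma dichotomy_vector (c : R) : 0 < c ->
  (forall g, exists s, c <= sqabs (u g d1 s) ^+ 2) ->
  exists2 xi, nsq xi = 1 & forall g s, inner (u g xi) (rtr s xi) = 0 \/
    sqabs (inner (u g xi) (rtr s xi)) = 1.
Proof.
move=> c0 hc; have [C [P hP]] := diagproj_exists c0 hc.
have [xi [x1 Px]] := rank_one_exists hP.
exists xi => // g s; apply: (rank_one_dichotomy hP).
- by rewrite nsq_u.
- by rewrite nsq_rtr.
- by rewrite -bimul_tens hP.(proj_inv).2 Px.
- by rewrite -birtr_tens hP.(proj_inv).1.2 Px.
Qed.

End kernels.

(** * Commuting actions of icc groups *)

(** A Schur test: the Gram matrix has entries of modulus at most 1 and at most [N] nonzero ones in
    each row, diagonal included, hence norm at most [N]. *)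
Lemma schur_bessel (R : realType) (K : choiceType) (I : eqType) (v : I -> ell2 R K)
    (r : seq I) (N : nat) (d : ell2 R K) :
  (forall i, i \in r -> nsq (v i) <= 1) ->
  (forall i, i \in r -> (count (fun j => inner (v i) (v j) != 0%R) r <= N)%N) ->
  \sum_(i <- r) sqabs (inner d (v i)) <= N%:R * nsq d.
Proof.
move=> v1 hN; pose c i := inner d (v i); set S := \sum_(i <- r) _.
have S0 : 0 <= S by apply: sumr_ge0 => i _; exact: sqabs_ge0.
pose w := \sum_(i <- r) c i *: v i.
have dw : inner d w = S%:C.
  rewrite inner_sumr rmorph_sum; apply: eq_bigr => i _.
  by rewrite innerZr -/(c i) mulrC sqabsE.
have term i j : i \in r -> j \in r -> complex.Re (c i * ((c j)^* * inner (v i) (v j))) <=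
    (inner (v i) (v j) != 0)%:R * (2^-1 * (sqabs (c i) + sqabs (c j))).
  move=> ir jr; have [->|nz] /= := eqVneq (inner (v i) (v j)) 0.
    by rewrite !mulr0 mul0r.
  rewrite mul1r; have h := Re_inner_half (c i *: v i) (c j *: v j).
  rewrite innerZl innerZr !nsqZ in h.
  have h1 : sqabs (c i) * nsq (v i) <= sqabs (c i) * 1 by rewrite ler_wpM2l ?sqabs_ge0 ?v1.
  have h2 : sqabs (c j) * nsq (v j) <= sqabs (c j) * 1 by rewrite ler_wpM2l ?sqabs_ge0 ?v1.
  lra.
have nw : nsq w <= N%:R * S.
  rewrite nsq_Re /w inner_suml Re_sum.
  have half (F : I -> I -> R) : (forall i j, F i j = F j i) ->
      \sum_(i <- r) \sum_(j <- r) F i j * (2^-1 * (sqabs (c i) + sqabs (c j))) =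
      \sum_(i <- r) \sum_(j <- r) F i j * sqabs (c i).
    move=> Fs; under eq_bigr do under eq_bigr do rewrite mulrDr mulrDr.
    under eq_bigr do rewrite big_split /=.
    rewrite big_split /= [X in _ + X]exchange_big /=.
    rewrite -big_split /=; apply: eq_bigr => i _; rewrite -big_split /=.
    by apply: eq_bigr => j _; rewrite (Fs j i); lra.
  apply: (@le_trans _ _ (\sum_(i <- r) \sum_(j <- r)
     (inner (v i) (v j) != 0)%:R * (2^-1 * (sqabs (c i) + sqabs (c j))))).
    rewrite big_seq [leRHS]big_seq; apply: ler_sum => i ir.
    rewrite inner_sumr Re_sum big_seq [leRHS]big_seq; apply: ler_sum => j jr.
    by rewrite innerZl innerZr term.
  rewrite half; last first.
    move=> i j; congr ((nat_of_bool (~~ _))%:R).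
    by rewrite innerJ -!sqabs_eq0 sqabsJ.
  rewrite /S mulr_sumr big_seq [leRHS]big_seq; apply: ler_sum => i ir.
  rewrite -mulr_suml ler_wpM2r ?sqabs_ge0// -natr_sum ler_nat.
  apply: leq_trans (hN i ir); rewrite -sum1_count [X in (_ <= X)%N]big_mkcond.
  by apply: leq_sum => j _; case: (_ != _).
have := cauchy_schwarz d w; rewrite dw sqabs_real => h.
have [->|S1] := eqVneq S 0; first by rewrite mulr_ge0 ?nsq_ge0.
have Sp : 0 < S by rewrite lt_neqAle eq_sym S1.
have nd := nsq_ge0 d.
have : S * S <= N%:R * nsq d * S.
  rewrite -expr2; apply: le_trans h (le_trans (ler_wpM2l nd nw) _).
  by rewrite mulrCA mulrA.
by rewrite ler_pM2r.
Qed.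

Lemma unit_parallel (R : realType) (K : choiceType) (x y : ell2 R K) :
  nsq x = 1 -> nsq y = 1 -> sqabs (inner x y) = 1 -> x = inner x y *: y.
Proof.
move=> x1 y1 h; apply/eqP; rewrite -subr_eq0; apply/eqP/nsq_le0.
rewrite nsqB nsqZ innerZr x1 y1 h [_^* * _]mulrC sqabsE h /=; lra.
Qed.

Lemma bounded_finite (T : choiceType) (A : set T) (n : nat) :
  (forall s : seq T, uniq s -> (forall x, x \in s -> A x) -> (size s <= n)%N) ->
  exists s : seq T, forall x, A x -> x \in s.
Proof.
move=> h; have /finite_seqP[s ->] : finite_set A; last by exists s.
apply: contrapT => /(@infinite_set_seq _ A n.+1) [s [us sA]].
by rewrite ltnNge h.
Qed.

Record based_rep (R : realType) (K : choiceType) (G : groupType)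
    (U : G -> operator R K) (d : ell2 R K) : Prop := BasedRep {
  repM : forall g h f, U g (U h f) = U (g * h)%g f;
  rep1 : forall f, U 1%g f = f;
  rep_adj : forall g f h, inner (U g f) h = inner f (U g^-1%g h);
  rep_linear : forall g, linear (U g);
  rep_onb : isonb (fun g => U g d) }.

Section commuting_actions.
Variables (R : realType) (K : choiceType) (G H : groupType).
Variables (U : G -> operator R K) (V : H -> operator R K) (d e xi : ell2 R K).
Hypothesis hU : based_rep U d.
Hypothesis hV : based_rep V e.
Hypothesis UV : forall g h f, U g (V h f) = V h (U g f).
Hypothesis xi1 : nsq xi = 1.
Hypothesis dich : forall g h, inner (U g xi) (V h xi) = 0 \/
  sqabs (inner (U g xi) (V h xi)) = 1.

Let UM := hU.(repM).
Let U1 := hU.(rep1).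
Let Uadj := hU.(rep_adj).
Let Ulin := hU.(rep_linear).
Let Uonb := hU.(rep_onb).
Let VM := hV.(repM).
Let V1 := hV.(rep1).
Let Vadj := hV.(rep_adj).
Let Vlin := hV.(rep_linear).
Let Vonb := hV.(rep_onb).

Let nsqU g f : nsq (U g f) = nsq f.
Proof. by rewrite !nsq_Re Uadj UM mulVg U1. Qed.

Let nsqV g f : nsq (V g f) = nsq f.
Proof. by rewrite !nsq_Re Vadj VM mulVg V1. Qed.

Definition colinear g h := exists2 c : R[i], sqabs c = 1 & U g xi = c *: V h xi.

Lemma colinear_inner g h : inner (U g xi) (V h xi) <> 0 -> colinear g h.
Proof.
case: (dich g h) => // h1 _; exists (inner (U g xi) (V h xi)) => //.
by apply: unit_parallel; rewrite ?nsqU ?nsqV.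
Qed.

(** Products in [H] come out reversed, since [V h'] is pulled out past [U g] before [V h]
    appears. *)
Lemma colinearM g h g' h' : colinear g h -> colinear g' h' -> colinear (g * g')%g (h' * h)%g.
Proof.
move=> [c c1 hc] [c' c'1 hc']; exists (c' * c); first by rewrite sqabsM c1 c'1 mulr1.
by rewrite -UM hc' (bopZ (Ulin g)) UV hc (bopZ (Vlin h')) scalerA VM.
Qed.

Lemma colinearV g h : colinear g h -> colinear g^-1%g h^-1%g.
Proof.
move=> [c c1 hc]; exists c^*; first by rewrite sqabsJ.
have : U g^-1%g (V h^-1%g (U g xi)) = U g^-1%g (V h^-1%g (c *: V h xi)) by rewrite hc.
rewrite (bopZ (Vlin _)) (bopZ (Ulin _)) VM mulVg V1 -UV UM mulVg U1 => ->.
by rewrite scalerA mulrC sqabsE c1 scale1r.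
Qed.

(** The coefficients of [xi] in the basis [U g d] have constant modulus along cosets of the
    stabilizer, so a nonzero one bounds its size. *)
Lemma stabilizer_finite : exists n : nat, forall s : seq G, uniq s ->
  (forall g, g \in s -> colinear g 1%g) -> (size s <= n)%N.
Proof.
pose f := coefs (fun g => U g d) xi.
have fE g : f g = inner xi (U g d) by rewrite /f (coefsE Uonb.1).
have [h fh] : exists h, sqabs (f h) <> 0.
  apply: contrapT => /forallNP f0; have := onb_nsq xi Uonb.
  rewrite -/f (_ : f = 0) ?nsq0 ?xi1; first lra.
  apply: ell2P => g; rewrite ell20E; apply/eqP; rewrite -sqabs_eq0; apply/eqP.
  exact: contrapT (f0 g).
have fp : 0 < sqabs (f h) by rewrite lt_neqAle eq_sym sqabs_ge0 andbT; apply/eqP.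
exists (Num.truncn (nsq f / sqabs (f h))) => s us hs.
have sq g : g \in s -> sqabs (f (g * h)%g) = sqabs (f h).
  move=> /hs /colinearV [c c1]; rewrite invg1 V1 => hc.
  by rewrite !fE -UM innerJ sqabsJ Uadj hc innerZr sqabsM sqabsJ c1 mul1r innerJ sqabsJ.
have := sum_le_nsq f (etrans (map_inj_uniq (mulIg h) s) us).
rewrite big_map big_seq (eq_bigr (fun=> sqabs (f h))) => [|g /sq //].
rewrite -big_seq big_const_seq count_predT iter_addr_0 -mulr_natl -ler_pdivlMr// => le.
by rewrite truncn_ge_nat// divr_ge0 ?nsq_ge0 ?sqabs_ge0.
Qed.

(** Representatives of distinct left cosets of the subgroup of those [g] that are colinear with some
    [h]. *)
Definition independent (s : seq G) := uniq s /\ forall g g', g \in s -> g' \in s ->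
  (exists h, colinear (g'^-1 * g)%g h) -> g = g'.

(** For [g] in [s], the vectors [U g (V h xi)] are orthogonal for different [g], and for fixed [g]
    each meets at most [n] others, itself included. So [schur_bessel] bounds the total mass of [e]
    against them by [n], while each [g] contributes exactly 1. *)
Lemma independent_size (n : nat) (s : seq G) :
  (forall r : seq H, uniq r -> (forall h, h \in r -> colinear 1%g h) -> (size r <= n)%N) ->
  independent s -> (size s <= n)%N.
Proof.
move=> hn [us hs]; pose v (p : G * H) := U p.1 (V p.2 xi).
have vv p q : inner (v p) (v q) <> 0 -> colinear (q.1^-1 * p.1)%g (p.2^-1 * q.2)%g.
  move=> nz; apply: colinear_inner.
  by rewrite -VM -Vadj -UM -UV innerJ -Uadj -innerJ -?UV.
have key (r : seq H) : uniq r ->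
    \sum_(h <- r) \sum_(g <- s) sqabs (inner e (v (g, h))) <= n%:R * nsq e.
  move=> ur; rewrite exchange_big /=.
  have E : \sum_(p <- [seq (x, y) | x <- s, y <- r]) sqabs (inner e (v p)) =
    \sum_(g <- s) \sum_(h <- r) sqabs (inner e (v (g, h))) by exact: big_allpairs.
  rewrite -E.
  have gm (g' : G) h' : (g', h') \in [seq (x, y) | x <- s, y <- r] -> g' \in s.
    by case/allpairsP => -[? ?] [? _ [-> _]].
  apply: schur_bessel => [p _|[g h] pr]; first by rewrite nsqU nsqV xi1.
  rewrite -size_filter -(size_map (fun q : G * H => h^-1 * q.2)%g); apply: hn.
    rewrite map_inj_in_uniq ?filter_uniq ?allpairs_uniq//.
      by move=> [? ?] [? ?] _ _ [-> ->].
    move=> [g1 h1] [g2 h2]; rewrite !mem_filter /= => /andP[/eqP n1 m1] /andP[/eqP n2 m2] /mulgI ->.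
    have c1 := vv _ _ n1; have c2 := vv _ _ n2.
    have e1 : g = g1 by apply: (hs _ _ (gm _ _ pr) (gm _ _ m1)); exists (h^-1 * h1)%g.
    have e2 : g = g2 by apply: (hs _ _ (gm _ _ pr) (gm _ _ m2)); exists (h^-1 * h2)%g.
    by rewrite -e1 -e2.
  move=> h' /mapP[[g2 h2]]; rewrite mem_filter => /andP[/eqP n2 m2] ->.
  have c2 := vv _ _ n2; have e2 : g = g2.
    by apply: (hs g g2 (gm _ _ pr) (gm _ _ m2)); exists (h^-1 * h2)%g.
  by move: c2; rewrite /= -e2 mulVg.
have e1 : nsq e = 1.
  have := Vonb.1 1%g 1%g; rewrite /= eqxx V1 inner_nsq => /(congr1 (@complex.Re R)).
  by [].
have one g : (\esum_(h in [set: H]) (sqabs (inner e (v (g, h))))%:E = 1%:E)%E.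
  rewrite -xi1 -(nsqU g) -(onb_nsq _ Vonb) -nsqE.
  rewrite [LHS](@reindex_esum _ _ _ setT setT (fun h => h^-1)%g); last first.
    by split=> // [x y _ _ /invg_inj//|y _]; exists y^-1%g; rewrite ?invgK.
  apply: eq_esum => h _; rewrite (coefsE Vonb.1) /v /= UV innerJ sqabsJ Vadj invgK.
  by [].
have S0 h : 0 <= \sum_(g <- s) sqabs (inner e (v (g, h))).
  by apply: sumr_ge0 => g _; exact: sqabs_ge0.
have P := (esum_leP (n%:R * nsq e) S0).2 key; rewrite e1 mulr1 in P.
rewrite -(ler_nat R) -lee_fin; apply: le_trans P.
under eq_esum do rewrite -sumEFin.
rewrite esum_sum; last by move=> *; rewrite lee_fin sqabs_ge0.
under eq_bigr do rewrite one.
by rewrite sumEFin big_const_seq count_predT iter_addr_0.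
Qed.

(** A largest independent list represents all cosets of a subgroup that normalizes the finite
    stabilizer. Conjugates of a stabilizing [g] therefore lie in finitely many conjugates of a
    finite set, against icc. *)
Lemma stabilizer_trivial (n : nat) : icc G ->
  (forall r : seq H, uniq r -> (forall h, h \in r -> colinear 1%g h) -> (size r <= n)%N) ->
  forall g, colinear g 1%g -> g = 1%g.
Proof.
move=> iG hn g cg; apply: contrapT => g1.
have [m hm] := stabilizer_finite; have [L hL] := bounded_finite hm.
pose Q k := `[< exists2 s, independent s & size s = k >].
have Q0 : exists k, Q k.
  by exists 0%N; apply/asboolP; exists [::] => //; split.
have Qn k : Q k -> (k <= n)%N by move=> /asboolP[s si <-]; exact: independent_size.
case: (ex_maxnP Q0 Qn) => k /asboolP[s [us si] sk] kmax.
have cover x : exists2 g', g' \in s & exists h, colinear (g'^-1 * x)%g h.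
  apply: contrapT => hx.
  have xs y : y \in s -> ~ exists h, colinear (y^-1 * x)%g h.
    by move=> ys hy; apply: hx; exists y.
  have : Q k.+1.
    apply/asboolP; exists (x :: s); last by rewrite /= sk.
    split=> [|y z].
      rewrite /= us andbT; apply/negP => xs'; apply: (xs _ xs').
      exists 1%g; rewrite mulVg; exists 1; rewrite ?sqabs1// U1 V1 scale1r.
      by [].
    rewrite !inE => /orP[/eqP ->|ys] /orP[/eqP ->|zs] //; last exact: si.
      by move=> /(xs _ zs).
    move=> [h /colinearV]; rewrite invgM invgK => c; case: (xs _ ys); exists h^-1%g.
    by [].
  by move=> /kmax; rewrite ltnn.
apply: (iG g g1); apply: (@sub_finite_set _ _ [set` [seq (y * l * y^-1)%g | y <- s, l <- L]]); last first.
  exact: finite_seq.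
move=> _ [x _ <-] /=; have [y ys [h ch]] := cover x^-1%g.
(* [y^-1 * x^-1] lies in the normalizing subgroup, so conjugating [g] by it stays in the stabilizer;
   conjugating back by [y] gives [g ^ x]. *)
apply/allpairsP; exists (y, (y^-1 * x^-1 * g * x * y)%g) => /=; split=> //.
  apply: hL; have := colinearM (colinearM ch cg) (colinearV ch).
  by rewrite mul1g mulVg invgM !invgK !mulgA.
by rewrite /conjg !mulgA mulgV mul1g mulgK.
Qed.

(** A trivial stabilizer in [H] bounds the number of cosets by 1, while [g] and 1 would represent
    two. *)
Lemma colinear_total : (forall h, colinear 1%g h -> h = 1%g) ->
  forall g, exists h, colinear g h.
Proof.
move=> ht g; apply: contrapT => hg.
have c1 : colinear 1%g 1%g by exists 1; rewrite ?sqabs1// U1 V1 scale1r.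
have g1 : g <> 1%g by move=> e1; apply: hg; exists 1%g; rewrite e1.
suff : (size [:: g; 1%g] <= 1)%N by [].
apply: independent_size.
  move=> r ur hr; rewrite -[1%N]/(size [:: 1%g : H]).
  by apply: uniq_leq_size => // h /hr /ht ->; rewrite inE.
split=> [|x y]; first by rewrite /= inE andbT; apply/eqP.
rewrite !inE => /orP[] /eqP -> /orP[] /eqP -> //.
  by rewrite invg1 mul1g => /hg.
by rewrite mulg1 => -[h /colinearV]; rewrite invgK => c; case: hg; exists h^-1%g.
Qed.

End commuting_actions.

Lemma rtr_onb (R : realType) (G : groupType) : isonb (fun s : G => rtr s (delta R 1%g)).
Proof.
have rd (s : G) : rtr s (delta R 1%g) = delta R s^-1%g by rewrite rtr_delta mul1g.
apply: isonbP => [s t|x].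
  by rewrite !rd inner_delta deltaE (inj_eq invg_inj) eq_sym.
suff -> : coefs (fun s : G => rtr s (delta R 1%g)) (delta R x) = delta R x^-1%g.
  by rewrite nsq_delta.
apply: ell2P => s; rewrite coefsE; last first.
  by move=> i j; rewrite !rd inner_delta deltaE (inj_eq invg_inj) eq_sym.
by rewrite rd inner_delta !deltaE -(inj_eq invg_inj) invgK.
Qed.

Lemma based_rep_rtr (R : realType) (G : groupType) : based_rep (@rtr R G) (delta R 1%g).
Proof.
split; [exact: rtrM|exact: rtr1|exact: inner_rtr|exact: linear_rtr|exact: rtr_onb].
Qed.

Lemma colinear_sym (R : realType) (K : choiceType) (G H : groupType)
    (U : G -> operator R K) (V : H -> operator R K) xi g h :
  colinear U V xi g h -> colinear V U xi h g.
Proof.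
by move=> [c c1 hc]; exists c^*; rewrite ?sqabsJ// hc scalerA mulrC sqabsE c1 scale1r.
Qed.

Lemma stabilizers_trivial (R : realType) (K : choiceType) (G H : groupType)
    (U : G -> operator R K) (V : H -> operator R K) (d e xi : ell2 R K) :
  based_rep U d -> based_rep V e -> (forall g h f, U g (V h f) = V h (U g f)) ->
  nsq xi = 1 -> (forall g h, inner (U g xi) (V h xi) = 0 \/
    sqabs (inner (U g xi) (V h xi)) = 1) -> icc G ->
  forall g, colinear U V xi g 1%g -> g = 1%g.
Proof.
move=> hU hV UV xi1 dich iG.
have [n hn] := stabilizer_finite hV hU (fun h g f => esym (UV g h f)) xi1.
apply: (stabilizer_trivial hU hV UV xi1 dich (n := n)) => // r ur hr.
by apply: hn => // h /hr; exact: colinear_sym.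
Qed.

(** * The isomorphism and the unitary obtained from the vector *)

Section intertwiner.
Variables (R : realType) (Gam Lam : groupType) (u : Gam -> operator R Lam).
Local Notation d1 := (delta R (1%g : Lam)).
Local Notation rho := (@rtr R Lam).
Hypothesis ru : based_rep u d1.
Hypothesis urtr : forall g s f, u g (rtr s f) = rtr s (u g f).
Hypothesis iccG : icc Gam.
Hypothesis iccL : icc Lam.
Variable xi : ell2 R Lam.
Hypothesis xi1 : nsq xi = 1.
Hypothesis dich : forall g s, inner (u g xi) (rtr s xi) = 0 \/
  sqabs (inner (u g xi) (rtr s xi)) = 1.

Let dich' s g : inner (rtr s xi) (u g xi) = 0 \/ sqabs (inner (rtr s xi) (u g xi)) = 1.
Proof.
rewrite innerJ sqabsJ; case: (dich g s) => [->|h]; last by right.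
by left; rewrite conj0.
Qed.

Let rr := based_rep_rtr R Lam.
Let rtru s g f : rtr s (u g f) = u g (rtr s f). Proof. by rewrite urtr. Qed.

Local Notation col := (colinear u rho xi).

Lemma col_left g : col g 1%g -> g = 1%g.
Proof. exact: (stabilizers_trivial ru rr urtr xi1 dich iccG). Qed.

Lemma col_right s : col 1%g s -> s = 1%g.
Proof.
by move=> /colinear_sym; exact: (stabilizers_trivial rr ru rtru xi1 dich' iccL).
Qed.

Lemma col_total_left g : exists s, col g s.
Proof. exact: (colinear_total ru rr urtr xi1 dich col_right). Qed.

Lemma col_total_right s : exists g, col g s.
Proof.
have [|g /colinear_sym] := colinear_total rr ru rtru xi1 dich' _ s; last by exists g.
by move=> h /colinear_sym /col_left.
Qed.

Lemma group_isomorphism : exists (gamma : Gam -> R[i]) (delta : {multiplicative Gam -> Lam}),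
  [/\ character gamma, bijective delta &
      forall g, u g xi = gamma g *: rtr (delta g)^-1%g xi].
Proof.
have /choice[s hs] := col_total_left.
have colM := colinearM ru rr urtr; have colV := colinearV ru rr urtr.
have suniq g t t' : col g t -> col g t' -> t = t'.
  move=> c c'; have := colM _ _ _ _ _ c (colV _ _ _ c'); rewrite mulgV => /col_right.
  by move=> /(congr1 (fun x => t' * x)%g); rewrite mulVKg mulg1.
(* The inverse undoes the reversal of products in [colinearM]. *)
pose de g := (s g)^-1%g; pose gamma g := inner (u g xi) (rtr (s g) xi).
have sM g h : s (g * h)%g = (s h * s g)%g by apply: suniq (hs _) (colM _ _ _ _ _ (hs g) (hs h)).
have deM : {morph de : g h / (g * h)%g} by move=> g h; rewrite /de sM invgM.
have nr t : nsq (rtr t xi) = 1 by rewrite nsq_rtr.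
have gammaE g c : sqabs c = 1 -> u g xi = c *: rtr (s g) xi -> gamma g = c.
  by move=> c1 e; rewrite /gamma e innerZl inner_nsq nr mulr1.
have ugE g : u g xi = gamma g *: rtr (s g) xi.
  by have [c c1 e] := hs g; rewrite (gammaE g c).
have gamma1 g : sqabs (gamma g) = 1 by have [c c1 e] := hs g; rewrite (gammaE g c).
have deinj : injective de.
  move=> g h e; have eg : s g = s h by apply: invg_inj.
  have := colM _ _ _ _ _ (hs g) (colV _ _ _ (hs h)); rewrite eg mulVg => /col_left.
  by move=> /(congr1 (fun x => x * h)%g); rewrite mulgVK mul1g.
have /choice[k hk] t : exists g, de g = t.
  have [g cg] := col_total_right t^-1%g; exists g.
  by rewrite /de (suniq _ _ _ (hs g) cg) invgK.
have bde : bijective de by exists k => // g; apply: deinj; rewrite hk.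
exists gamma, (HB.pack_for {multiplicative Gam -> Lam} de (isMultiplicative.Build Gam Lam de deM)).
split=> //; last by move=> g; rewrite /= /de invgK ugE.
split=> [g|g h]; first exact/sqabs_eq1.
apply: gammaE; first by rewrite sqabsM !gamma1 mulr1.
rewrite -ru.(repM) (ugE h) (bopZ (ru.(rep_linear) g)) urtr (ugE g) (bopZ (linear_rtr _)).
by rewrite scalerA rtrM sM mulrC.
Qed.

(** Distinct translates are orthogonal because the stabilizer is trivial. Parseval at [delta R x]
    sums [sqabs] of [xi] over the whole group. *)
Lemma intertwiner_onb : isonb (fun s : Lam => rtr s^-1%g xi).
Proof.
have ob : orthofam (fun s : Lam => rtr s^-1%g xi).
  move=> s t; rewrite inner_rtr rtrM invgK.
  have [->|/eqP st] := eqVneq s t; first by rewrite mulgV rtr1 inner_nsq xi1.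
  have h : inner (u 1%g xi) (rtr (s * t^-1)%g xi) = 0.
    apply: contrapT => nz.
    have /col_right := colinear_inner ru rr xi1 dich nz.
    by move=> /(congr1 (fun x => x * t)%g); rewrite mulgVK mul1g.
  by rewrite ru.(rep1) in h; rewrite h.
apply: isonbP => // x; apply: EFin_inj; rewrite -nsqE -xi1 -nsqE.
rewrite [RHS](@reindex_esum _ _ _ setT setT (fun s => x * s^-1)%g); last first.
  split=> // [y z _ _ /mulgI /invg_inj//|y _].
  by exists (y^-1 * x)%g => //; rewrite invgM invgK mulVKg.
by apply: eq_esum => s _; rewrite (coefsE ob) innerJ sqabsJ inner_delta rtrE.
Qed.

Lemma unitary_intertwiner (gamma : Gam -> R[i]) (de : Gam -> Lam) :
  (forall g, `|gamma g| = 1) ->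
  (forall g, u g xi = gamma g *: rtr (de g)^-1%g xi) ->
  exists w, [/\ vn w, unitary w &
    forall g, w \o u g \o adjoint w = gamma g *: lreg R (de g)].
Proof.
move=> gamma1 ugE; have wonb := intertwiner_onb.
pose w : operator R Lam := coefs (fun s : Lam => rtr s^-1%g xi).
have wE f s : w f s = inner f (rtr s^-1%g xi) by rewrite /w (coefsE wonb.1).
have bw : isbop w by exact: isbop_coefs wonb.1.
have [bw' ww'] := adjointP bw; set w' := adjoint w in bw' ww' *.
have w'w f : w' (w f) = f.
  by apply: inner_ext => h; rewrite -ww'; exact: wonb.2.
have w'd s : w' (delta R s) = rtr s^-1%g xi.
  by apply: inner_ext => h; rewrite -ww' inner_delta wE.
have ww'1 : w \o w' = idfun.
  apply: isbop_ext => [||s]; [exact: isbop_comp|exact: isbop_id|].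
  rewrite /= w'd; apply: ell2P => t; rewrite wE (wonb.1 s t) deltaE.
  by rewrite eq_sym.
exists w; split.
- split=> // t f; apply: ell2P => s; rewrite rtrE !wE inner_rtr rtrM invgM.
  by [].
- by split=> //; apply: funext => f; exact: w'w.
- move=> g; apply: funext => f; rewrite opZE -[in RHS](congr1 (fun T => T f) ww'1 : w (w' f) = f).
  change (w (u g (w' f)) = gamma g *: lreg R (de g) (w (w' f))).
  move: (w' f) => h; apply: ell2P => s; rewrite ell2ZE lregE !wE.
  rewrite invgM invgK -rtrM ru.(rep_adj) urtr.
  have -> : u g^-1%g xi = (gamma g)^* *: rtr (de g) xi.
    have g1 : sqabs (gamma g) = 1 by apply/sqabs_eq1.
    rewrite -[in RHS](ru.(rep1) (rtr (de g) xi)) -(mulVg g) -ru.(repM) urtr (ugE g).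
    rewrite (bopZ (linear_rtr _)) (bopZ (ru.(rep_linear) _)) rtrM mulgV rtr1.
    by rewrite scalerA mulrC sqabsE g1 scale1r.
  by rewrite (bopZ (linear_rtr _)) innerZr conjK.
Qed.

End intertwiner.

(** * Distance and coefficients *)

(** The crude factor suffices, since only its dependence on the length alone matters. *)
Lemma nsq_sum_le (R : realType) (G : choiceType) (I : Type) (r : seq I) (v : I -> ell2 R G) :
  nsq (\sum_(i <- r) v i) <= 2 ^+ size r * \sum_(i <- r) nsq (v i).
Proof.
elim: r => [|i r ih]; first by rewrite !big_nil nsq0 mulr0.
rewrite !big_cons; apply: le_trans (nsqD_le _ _) _.
have -> : size (i :: r) = (size r).+1 by []; rewrite exprS.
have h1 : 1 <= 2 ^+ size r :> R by rewrite exprn_ege1// ler1n.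
move: ih h1 (nsq_ge0 (v i)); move: (nsq (v i)) (nsq (\sum_(j <- r) v j)) (2 ^+ size r).
by move: (\sum_(j <- r) nsq (v j)) => S p q x; nra.
Qed.

(** Were all coefficients smaller, [a] would have squared norm at most [1/8] on [S] and at most
    [1/4] off it, hence at most [3/4] in total. *)
Lemma large_coef (R : realType) (G : choiceType) (a b : ell2 R G) (S : seq G) :
  nsq a = 1 -> nsq (a - b) <= 4^-1 -> (forall x, x \notin S -> b x = 0) ->
  exists s, (8 * (size S).+1%:R)^-1 <= sqabs (a s).
Proof.
move=> a1 ab bS; apply: contrapT => /forallNP h.
set c : R := (8 * _)^-1 in h; have c0 : 0 < c by rewrite invr_gt0 mulr_gt0// ltr0n.
pose aS := \sum_(s <- undup S) a s *: delta R s.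
have h1 : nsq (a - aS) <= 4^-1.
  apply: le_trans ab; apply/nsq_leP => r ur; apply: le_trans (sum_le_nsq _ ur).
  apply: ler_sum => x _; rewrite !ell2BE sum_deltaE ?undup_uniq// mem_undup.
  case: ifPn => [_|/bS ->]; last by rewrite !subr0.
  by rewrite subrr sqabs0 sqabs_ge0.
have h2 : nsq aS <= 8^-1.
  rewrite nsq_sum_delta ?undup_uniq//.
  apply: (@le_trans _ _ (\sum_(s <- undup S) c)).
    by apply: ler_sum => s _; rewrite ltW// ltNge; apply/negP/h.
  rewrite big_const_seq count_predT iter_addr_0.
  apply: (@le_trans _ _ (c *+ (size S).+1)).
    by rewrite ler_pMn2l// (leq_trans (size_undup S)).
  by rewrite -[leLHS]mulr_natr /c invfM -mulrA mulVf ?mulr1// pnatr_eq0.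
have := nsqD_le (a - aS) aS; rewrite subrK a1; lra.
Qed.

Section heights.
Variables (R : realType) (Lam : groupType).
Local Notation d1 := (delta R (1%g : Lam)).

(* Truncating [w d1] and [w^* d1] shows that [w^* v_t w] is uniformly close to
   operators with boundedly many coefficients. *)
Lemma conj_height (w : operator R Lam) : vn w -> unitary w ->
  exists2 c : R, 0 < c & forall t, exists s, c <= sqabs (adjoint w (lreg R t (w d1)) s).
Proof.
move=> vw [w'w ww']; have aw := adjointP vw.1; have vw' := vn_adj vw aw.
set w' := adjoint w in w'w ww' aw vw' *.
have {}w'w f : w' (w f) = f := congr1 (fun T => T f) w'w.
have {}ww' f : w (w' f) = f := congr1 (fun T => T f) ww'.
have nw f : nsq (w f) = nsq f by rewrite !nsq_Re aw.2 w'w.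
have nw' f : nsq (w' f) = nsq f by rewrite -nw ww'.
pose f := w d1; pose h := w' d1.
have f1 : nsq f = 1 by rewrite nw nsq_delta.
have [F [uF hF]] := @fin_approx R Lam f 16^-1 (ltac:(by rewrite invr_gt0)).
(* The power of 2 cancels the factor of [nsq_sum_le]; the two truncation errors are then at most
   [1/16] each, and [nsqD_le] gives the [1/4] of [large_coef], uniformly in [t]. *)
pose e2 : R := (16 * 2 ^+ size F)^-1.
have e20 : 0 < e2 by rewrite invr_gt0 mulr_gt0// exprn_gt0.
have [F' [h0 [hF' h0E]]] : exists (F' : seq Lam) (h0 : ell2 R Lam), nsq (h - h0) < e2 /\
    forall x, h0 x = if x \in F' then h x else 0.
  have [F' [uF' hF']] := fin_approx h e20; exists F'.
  by exists (\sum_(z <- F') h z *: delta R z); split=> // x; rewrite sum_deltaE.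
exists (8 * (size F * size F').+1%:R)^-1; first by rewrite invr_gt0 mulr_gt0// ltr0n.
move=> t; pose b := \sum_(y <- F) f y *: rtr (t * y)^-1%g h0.
have sS : size [seq (z * (t * y))%g | y <- F, z <- F'] = (size F * size F')%N.
  by rewrite size_allpairs.
rewrite -sS; apply: (@large_coef R Lam _ b).
- by rewrite nw' nsq_lreg.
- have -> : w' (lreg R t f) - b = w' (lreg R t (f - \sum_(y <- F) f y *: delta R y)) +
      \sum_(y <- F) f y *: rtr (t * y)^-1%g (h - h0).
    have e : w' (lreg R t (\sum_(y <- F) f y *: delta R y)) =
        \sum_(y <- F) f y *: rtr (t * y)^-1%g h.
      rewrite (bop_sum (linear_lreg t)) (bop_sum vw'.1.1); apply: eq_bigr => y _.
      by rewrite (bopZ (linear_lreg t)) (bopZ vw'.1.1) lreg_delta vn_delta.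
    rewrite (bopB (linear_lreg t)) (bopB vw'.1.1) e -addrA; congr (_ + _).
    rewrite /b -!sumrN -big_split /=; apply: eq_bigr => y _.
    by rewrite (bopB (linear_rtr _)) scalerBr addrA addNr add0r.
  apply: le_trans (nsqD_le _ _) _; rewrite nw' nsq_lreg.
  have := nsq_sum_le F (fun y => f y *: rtr (t * y)^-1%g (h - h0)).
  have -> : \sum_(y <- F) nsq (f y *: rtr (t * y)^-1%g (h - h0)) =
      (\sum_(y <- F) sqabs (f y)) * nsq (h - h0).
    by rewrite mulr_suml; apply: eq_bigr => y _; rewrite nsqZ nsq_rtr.
  move=> le.
  have b1 : (\sum_(y <- F) sqabs (f y)) * nsq (h - h0) <= 1 * e2.
    apply: ler_pM; rewrite ?nsq_ge0 ?(ltW hF')//.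
      by apply: sumr_ge0 => y _; exact: sqabs_ge0.
    by rewrite -f1 sum_le_nsq.
  have b2 : 2 ^+ size F * ((\sum_(y <- F) sqabs (f y)) * nsq (h - h0)) <= 16^-1.
    apply: le_trans (ler_wpM2l _ b1) _; first by rewrite exprn_ge0.
    by rewrite mul1r /e2 invfM mulrCA mulfV ?mulr1// expf_neq0// pnatr_eq0.
  have := le_trans le b2; have := ltW hF.
  move: (nsq _) (nsq _) => p q; lra.
- move=> x xS; rewrite /b ell2_sumE big_seq big1// => y yF.
  rewrite ell2ZE rtrE h0E ifN ?mulr0//; apply/negP => zF.
  case/negP: xS; apply/allpairsP; exists (y, (x * (t * y)^-1)%g); split=> //=.
  by rewrite mulgVK.
Qed.

Lemma norm2E (x : operator R Lam) : isbop x -> norm2 x = Num.sqrt (nsq (x d1)).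
Proof.
move=> bx; rewrite /norm2 /trace /=; congr Num.sqrt.
by rewrite innerJ -(adjointP bx).2 ReJ nsq_Re.
Qed.

Lemma norm2_phase (U : operator R Lam) (a b : R[i]) s : vn U -> nsq (U d1) = 1 ->
  sqabs a = 1 -> sqabs b = 1 ->
  norm2 (a *: U - b *: lreg R s) = Num.sqrt (2 - 2 * complex.Re (a * U d1 s * b^*)).
Proof.
move=> vU U1 a1 b1.
have bU : isbop (a *: U) by exact/isbopZ/vU.1.
have bv : isbop (b *: lreg R s : operator R Lam) by exact/isbopZ/isbop_lreg.
rewrite norm2E; last exact: isbopB.
congr Num.sqrt; rewrite opBE !opZE nsqB !nsqZ a1 b1 U1 nsq_lreg nsq_delta.
rewrite lreg_delta mulg1 innerZl innerZr inner_delta mulrA mulrAC.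
by rewrite !mul1r; congr (_ - _); ring.
Qed.

End heights.

Section distance.
Variables (R : realType) (Gam Lam : groupType) (u : Gam -> operator R Lam).
Local Notation d1 := (delta R (1%g : Lam)).
Local Notation v := (fun s : Lam => lreg R s : operator R Lam).
Hypothesis vu : forall g, vn (u g).
Hypothesis nu : forall g, nsq (u g d1) = 1.

(** A distance below the square root of 2 keeps the real part in [norm2_phase] away from 0. The
    midpoint [r'] leaves room for an infimum that need not be attained. *)
Lemma dist2_height :
  (dist2 (circle_multiples u) (circle_multiples v) < (Num.sqrt 2)%:E)%E ->
  exists2 c : R, 0 < c & forall g, exists s, c <= sqabs (u g d1 s).
Proof.
set D := dist2 _ _ => D2.
have Di g : (ereal_inf [set (norm2 (u g - y)%R)%:E | y in circle_multiples v] <= D)%E.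
  apply: ereal_sup_ubound; exists (u g) => //; exists 1, g.
  by rewrite normr1 scale1r.
have D0 : (0 <= D)%E.
  apply: le_trans (Di 1%g); apply: le_ereal_inf_tmp => _ [y _ <-].
  by rewrite lee_fin sqrtr_ge0.
have [r Dr] : exists r : R, D = r%:E.
  by exists (fine D); rewrite fineK// ge0_fin_numE// (lt_trans D2)// ltry.
rewrite Dr lte_fin in D2; rewrite Dr lee_fin in D0.
have s0 : Num.sqrt 2 ^+ 2 = 2 :> R by rewrite sqr_sqrtr.
have s1 : 0 <= Num.sqrt 2 :> R by exact: sqrtr_ge0.
pose r' : R := (r + Num.sqrt 2) / 2.
have rr' : r < r' by rewrite /r'; lra.
have r'2 : r' < Num.sqrt 2 by rewrite /r'; lra.
have r'0 : 0 <= r' by lra.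
pose h : R := (2 - r' ^+ 2) / 2.
have h0 : 0 < h by rewrite /h; nra.
exists (h ^+ 2) => [|g]; first exact: exprn_gt0.
have : (ereal_inf [set (norm2 (u g - y)%R)%:E | y in circle_multiples v] < r'%:E)%E.
  by apply: le_lt_trans (Di g) _; rewrite Dr lte_fin.
move=> /ereal_inf_lt [_ [_ [b [s [/sqabs_eq1 b1 ->]] <-]]]; rewrite lte_fin => lt.
exists s; have := @norm2_phase R Lam (u g) 1 b s (vu g) (nu g) (sqabs1 R) b1.
rewrite scale1r mul1r => e; rewrite e in lt.
set x := u g d1 s * b^* in lt.
have hx : h < complex.Re x.
  have : 2 - 2 * complex.Re x < r' ^+ 2.
    rewrite -ltr_sqrt ?(le_lt_trans (sqrtr_ge0 _) lt)//.
      by rewrite sqrtr_sqr ger0_norm.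
    by rewrite exprn_gt0// (le_lt_trans _ lt)// sqrtr_ge0.
  by rewrite /h; lra.
have -> : sqabs (u g d1 s) = sqabs x by rewrite /x sqabsM sqabsJ b1 mulr1.
rewrite /sqabs; have := sqr_ge0 (complex.Im x); nra.
Qed.

(** The phase [b] is chosen to make the coefficient real and positive in [norm2_phase]; its modulus
    is at least its square because it is at most 1. *)
Lemma height_dist2 (c : R) : 0 < c -> (forall g, exists s, c <= sqabs (u g d1 s)) ->
  (dist2 (circle_multiples u) (circle_multiples v) < (Num.sqrt 2)%:E)%E.
Proof.
move=> c0 hc; apply: (@le_lt_trans _ _ (Num.sqrt (2 - 2 * c))%:E); last first.
  rewrite lte_fin ltr_sqrt//; lra.
apply: ge_ereal_sup => _ [_ [a [g [/sqabs_eq1 a1 ->]] <-]].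
have [s hs] := hc g; set x := u g d1 s in hs.
have n0 : 0 < normc x.
  by rewrite lt_neqAle normc_ge0 andbT eq_sym normc_eq0 -sqabs_eq0 gt_eqF// (lt_le_trans c0).
have x1 : sqabs x <= 1 by rewrite -(nu g) sqabs_le_nsq.
have cn : c <= normc x.
  apply: le_trans hs _; move: x1; rewrite sqabs_normc; move: (normc x) n0 => n; nra.
pose b := a * x * (normc x)^-1%:C.
have b1 : sqabs b = 1.
  by rewrite /b !sqabsM a1 mul1r sqabs_normc sqabs_real -exprMn mulfV ?expr1n// gt_eqF.
apply: ge_ereal_inf; exists (norm2 (a *: u g - b *: lreg R s))%:E.
  by exists (b *: lreg R s) => //; exists b, s; split=> //; apply/sqabs_eq1.
rewrite lee_fin norm2_phase// -/x.
have -> : complex.Re (a * x * b^*) = normc x.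
  rewrite /b conjM conj_real mulrA sqabsE sqabsM a1 mul1r sqabs_normc -rmorphM /=.
  by rewrite expr2 mulfK// gt_eqF.
apply: ler_wsqrtr; lra.
Qed.

End distance.

Local Open Scope complex_scope.

(* The identification of the two von Neumann algebras is the *-isomorphism
   theta; inside the group von Neumann algebra of Lam the canonical unitaries
   are u_g = theta (lreg R g) and v_s = lreg R s. *)
Theorem theorem3p1 (R : realType) (Gam Lam : groupType)
    (theta : operator R Gam -> operator R Lam)
    (countable_Gam : countable [set: Gam])
    (countable_Lam : countable [set: Lam])
    (icc_Gam : icc Gam) (icc_Lam : icc Lam)
    (iso_theta : star_isomorphism (groupvN R Gam) (groupvN R Lam) theta) :
  let u := fun g : Gam => theta (lreg R g) in
  let v := fun s : Lam => lreg R s in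
  (dist2 (circle_multiples u) (circle_multiples v) < (Num.sqrt 2)%:E)%E
  <->
  exists (w : operator R Lam) (gamma : Gam -> R[i])
         (delta : {multiplicative Gam -> Lam}),
    [/\ groupvN R Lam w, unitary w, character gamma, bijective delta &
        forall g : Gam, w \o u g \o adjoint w = gamma g *: v (delta g)].
Proof.
move=> u v.
have vu g : vn (u g) by apply: theta_vn iso_theta _ (vn_lreg R g).
have ru : based_rep u (delta R 1%g).
  split.
  - exact: theta_lregM.
  - exact: theta_lreg1.
  - by move=> g; exact: (theta_lreg_adj iso_theta g).2.
  - by move=> g; exact: (vu g).1.1.
  - exact: theta_onb.
have nu g : nsq (u g (delta R 1%g)) = 1.
  have := ru.(rep_onb).1 g g; rewrite eqxx inner_nsq => /(congr1 (@complex.Re R)).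
  by [].
split=> [/(dist2_height vu nu)[c c0 hc]|[w [gamma [de [/groupvNP vw uw [gamma1 _] _ conj]]]]].
  (* [good_diag] needs the bound for fourth powers of moduli. *)
  have hc2 g : exists s, c ^+ 2 <= sqabs (u g (delta R 1%g) s) ^+ 2.
    have [s hs] := hc g; exists s; rewrite ler_sqr ?nnegrE ?sqabs_ge0//.
    exact: ltW.
  have [xi xi1 dich] := dichotomy_vector vu ru.(repM) ru.(rep1) ru.(rep_adj)
    ru.(rep_onb) icc_Gam (exprn_gt0 2 c0) hc2.
  have urtr g s f : u g (rtr s f) = rtr s (u g f) by exact: (vu g).2.
  have [gamma [de [chg bde ugE]]] := group_isomorphism ru urtr icc_Gam icc_Lam xi1 dich.
  have [w [vw uw wE]] := unitary_intertwiner ru urtr icc_Lam xi1 dich chg.1 ugE.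
  by exists w, gamma, de; split=> //; apply/groupvNP.
have [c c0 hc] := conj_height vw uw.
apply: (height_dist2 vu nu c0) => g; have [s hs] := hc (de g); exists s.
apply: le_trans hs _; have w1 f : adjoint w (w f) = f := congr1 (fun T => T f) uw.1.
(* Evaluate the intertwining relation at [w (delta R 1%g)] and apply [adjoint w]. *)
have -> : u g (delta R 1%g) = gamma g *: adjoint w (lreg R (de g) (w (delta R 1%g))).
  have := congr1 (fun T => adjoint w (T (w (delta R 1%g)))) (conj g).
  rewrite /= !w1 => ->.
  by rewrite -(bopZ (vn_adj vw (adjointP vw.1)).1.1).
rewrite ell2ZE sqabsM.
by have /sqabs_eq1 -> := gamma1 g; rewrite mul1r.
Qed.
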